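(* Let $r>0$, $r_0>0$, and let the kernel $\eta$ satisfy the standing assumptions in the context. The delay equation $\dot x(t)=L(t)x_t=\int_{-r}^{0}d_\theta\eta(t,\theta)x(t+\theta)$ admits an exponential dichotomy on the whole line $\mathbb{R}$ if and only if there exists a pair of constants $b^-$ and $b^+$ with $b^-<0<b^+$ such that both $(\mathcal{H}_{b^+}(\mathbb{R}),\mathcal{Y}_{b^+}(\mathbb{R}))$ and $(\mathcal{H}_{b^-}(\mathbb{R}),\mathcal{Y}_{b^-}(\mathbb{R}))$ are properly admissible with respect to the nonhomogeneous equation $\dot y(t)=L(t)y_t+h(t)$.
   Context: $\mathbb{R}^n$ carries the norm $|\cdot|$ induced by the inner product; $C([-r,0],\mathbb{R}^n)$ is the Banach space of continuous functions with the supremum norm; $x_t(\theta)=x(t+\theta)$ for $\theta\in[-r,0]$. Standing assumptions. $\eta$ is an $n\times n$ matrix-valued function on $\mathbb{R}\times\mathbb{R}$ and $L(t)\phi=\int_{-r}^0 d_\theta\eta(t,\theta)\phi(\theta)$ for $\phi\in C([-r,0],\mathbb{R}^n)$, where: $\eta$ is measurable in $(t,\theta)$, continuous from the left in $\theta$ on $(-r,0)$, $\eta(t,\theta)=0$ for $\theta\ge 0$ and $\eta(t,\theta)=\eta(t,-r)$ for $\theta\le -r$; $\eta(t,\cdot)$ has bounded variation on $[-r,0]$ for each $t$; $L(t)\phi$ is measurable in $t$ for each $\phi$; and $\|L(t)\|$ is locally integrable with $\sup_{t\in\mathbb{R}}\frac{1}{r_0}\int_t^{t+r_0}\|L(u)\|\,du\le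 M<+\infty$. Evolution operators. For $s\in\mathbb{R}$, $\phi\in C([-r,0],\mathbb{R}^n)$ there is a unique continuous $x:[s-r,\infty)\to\mathbb{R}^n$ with $x_s=\phi$, locally absolutely continuous on $[s,\infty)$ and satisfying $\dot x(t)=L(t)x_t$ for a.e. $t\ge s$; set $T(t,s)\phi=x_t$ for $t\ge s$. Exponential dichotomy. The delay equation admits an exponential dichotomy on $\mathbb{R}$ (with exponent $\alpha>0$ and bound $K>0$) if there are projections $P(t)$ on $C([-r,0],\mathbb{R}^n)$, $t\in\mathbb{R}$, such that: $T(t,s)P(s)=P(t)T(t,s)$ for $t\ge s$; $T(t,s)|_{\mathcal{N}(P(s))}$ is an isomorphism from the kernel $\mathcal{N}(P(s))$ onto $\mathcal{N}(P(t))$ for $t\ge s$, with inverse denoted $T(s,t)$; and $\|T(t,s)P(s)\|\le Ke^{-\alpha(t-s)}$ for $t\ge s$, $\|T(t,s)(Id-P(s))\|\le Ke^{-\alpha(s-t)}$ for $s\ge t$. Function spaces. For $b\in\mathbb{R}$, $\mathcal{H}_b(\mathbb{R})$ is the Banach space of locally integrable $h:\mathbb{R}\to\mathbb{R}^n$ (modulo a.e. equality) with norm $\|h\|_{\mathcal{H}_b(\mathbb{R})}=\sup_{t}\frac{1}{r_0}e^{b|t|}\int_t^{t+r_0}|h(\tau)|\,d\tau<\infty$; $\mathcal{Y}_b(\mathbb{R})$ is the Banach space of continuous $y:\mathbb{R}\to\mathbb{R}^n$ with norm $\|y\|_{\mathcal{Y}_b(\mathbb{R})}=\sup_t e^{b|t|}|y(t)|<\infty$.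 Proper admissibility. $(\mathcal{H}_b(\mathbb{R}),\mathcal{Y}_b(\mathbb{R}))$ is properly admissible with respect to $\dot y=L(t)y_t+h(t)$ if for each $h\in\mathcal{H}_b(\mathbb{R})$ this equation has a unique solution $y\in\mathcal{Y}_b(\mathbb{R})$ (a locally absolutely continuous function on $\mathbb{R}$ satisfying the equation for a.e. $t\in\mathbb{R}$). *)

(* Defs.v *)
From HB Require Import structures.
From mathcomp Require Import all_boot all_order all_algebra.
From mathcomp Require Import all_classical all_reals all_analysis.
From mathcomp Require Import measurable_realfun.

Set Implicit Arguments.
Unset Strict Implicit.
Unset Printing Implicit Defensive.
Import Order.TTheory GRing.Theory Num.Theory.
Import numFieldNormedType.Exports.
Local Open Scope classical_set_scope.
Local Open Scope ring_scope.

(* The library norm `|x| on column vectors is the max norm; it induces the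
   same topology. *)
Definition enorm {R : realType} {n : nat} (x : 'cV[R]_n) : R :=
  Num.sqrt (\sum_(i < n) x i ord0 ^+ 2).

Definition opnorm {R : realType} {V W : Type} (nV : V -> R) (nW : W -> R)
    (A : V -> W) : \bar R :=
  ereal_sup [set (nW (A v))%:E | v in [set v | nV v <= 1]].

(* Measurability with respect to the completion of [mu]: the library equips
   [R] and [R * R] with their Borel sigma-algebras. *)
Definition cmeasurable {R : realType} {d d' : measure_display}
    {T : measurableType d} {U : measurableType d'}
    (mu : {measure set T -> \bar R}) (f : T -> U) : Prop :=
  forall B : set U, measurable B -> completed_algebra_gen mu (f @^-1` B).

(* For a function that is only measurable for the completion, the library's
   integral (a supremum over Borel simple functions below [f^+] and [f^-]) still
   is the Lebesgue integral. *)
Definition loc_integrable {R : realType} (f : R -> \bar R) : Prop :=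
  cmeasurable (@lebesgue_measure R) f /\
  forall a b : R, (\int[lebesgue_measure]_(t in `[a, b]) `|f t| < +oo)%E.

(* The finite family [I] of pairs (u, v) encodes nonoverlapping subintervals
   [u, v] of [a, b]. *)
Definition abs_cont_on {R : realType} {n : nat} (a b : R) (x : R -> 'cV[R]_n) :
    Prop :=
  forall eps : R, 0 < eps -> exists2 delta : R, 0 < delta &
    forall I : seq (R * R),
      all (fun p => [&& a <= p.1, p.1 <= p.2 & p.2 <= b]) I ->
      pairwise (fun p q => (p.2 <= q.1) || (q.2 <= p.1)) I ->
      \sum_(p <- I) (p.2 - p.1) < delta ->
      \sum_(p <- I) enorm (x p.2 - x p.1) < eps.

Definition is_RSint {R : realType} {n : nat} (a b : R) (g : R -> 'M[R]_n)
    (f : R -> 'cV[R]_n) (v : 'cV[R]_n) : Prop :=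
  forall eps : R, 0 < eps -> exists2 delta : R, 0 < delta &
    forall (s : seq R) (c : nat -> R),
      let p := nth b (a :: s) in
      itv_partition a b s ->
      (forall i, (i < size s)%N ->
         [/\ p i.+1 - p i < delta, p i <= c i & c i <= p i.+1]) ->
      enorm (\sum_(0 <= i < size s) (g (p i.+1) - g (p i)) *m f (c i) - v)
        < eps.

Definition RSint {R : realType} {n : nat} (a b : R) (g : R -> 'M[R]_n)
    (f : R -> 'cV[R]_n) : 'cV[R]_n :=
  xget 0 [set v | is_RSint a b g f v].

(* A continuous function on [-r,0] is represented by its extension by zero,
   so that Leibniz equality is equality on [-r,0]. *)
Definition Cseg_pred {R : realType} (r : R) (n : nat) :
    {pred (R -> 'cV[R]_n)} :=
  mem [set f : R -> 'cV[R]_n |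
        {within `[- r, 0], continuous f} /\ f = patch (fun=> 0) `[- r, 0] f].
Arguments Cseg_pred {R} r n _.

Lemma Cseg_submod {R : realType} (r : R) (n : nat) :
  submod_closed (Cseg_pred r n).
Proof.
split=> [|a f g].
  apply/mem_set; split; first by apply: continuous_subspaceT => x; exact: cvg_cst.
  by apply/funext => t; rewrite /patch; case: ifP.
move=> /set_mem[cf ef] /set_mem[cg eg]; apply/mem_set; split.
  move=> x; apply: cvgD; last exact: cg.
  by apply: cvgZr; exact: cf.
rewrite {1}ef {1}eg; apply/funext => t; rewrite /patch !fctE.
by case: ifP => // _; rewrite scaler0 addr0.
Qed.

HB.instance Definition _ {R : realType} (r : R) (n : nat) :=
  GRing.isSubmodClosed.Build R (R -> 'cV[R]_n) (Cseg_pred r n)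
    (Cseg_submod r n).

Record Cseg {R : realType} (r : R) (n : nat) := MkCseg {
  Cseg_fun :> R -> 'cV[R]_n;
  _ : Cseg_fun \in Cseg_pred r n
}.

HB.instance Definition _ {R : realType} (r : R) (n : nat) :=
  [isSub for @Cseg_fun R r n].
HB.instance Definition _ {R : realType} (r : R) (n : nat) :=
  [Choice of Cseg r n by <:].
HB.instance Definition _ {R : realType} (r : R) (n : nat) :=
  [SubChoice_isSubLmodule of Cseg r n by <:].

Definition cnorm {R : realType} {r : R} {n : nat} (phi : Cseg r n) : R :=
  sup [set enorm (phi theta) | theta in `[- r, 0]].

(* The segment x_t; the default value 0 is used only if [x] is not continuous
   on [t - r, t]. *)
Definition segment {R : realType} (r : R) {n : nat} (x : R -> 'cV[R]_n)
    (t : R) : Cseg r n :=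
  insubd (0 : Cseg r n)
    (patch (fun=> 0) `[- r, 0] (fun theta => x (t + theta))).

Definition delay_op {R : realType} (r : R) {n : nat} (eta : R -> R -> 'M[R]_n)
    (t : R) (phi : Cseg r n) : 'cV[R]_n :=
  RSint (- r) 0 (eta t) phi.

Definition delay_opnorm {R : realType} (r : R) {n : nat}
    (eta : R -> R -> 'M[R]_n) (t : R) : \bar R :=
  opnorm (@cnorm R r n) (@enorm R n) (delay_op eta t).

Record standing_assumptions {R : realType} (r r0 : R) {n : nat}
    (eta : R -> R -> 'M[R]_n) : Prop := {
  sa_measurable : forall i j : 'I_n,
    cmeasurable (@lebesgue_measure R \x @lebesgue_measure R)%E
      (fun p : R * R => eta p.1 p.2 i j);
  sa_left_continuous : forall t theta : R, - r < theta < 0 ->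
    eta t u @[u --> theta^'-] --> eta t theta;
  sa_right : forall t theta : R, 0 <= theta -> eta t theta = 0;
  sa_left : forall t theta : R, theta <= - r -> eta t theta = eta t (- r);
  sa_bounded_variation : forall (t : R) (i j : 'I_n),
    bounded_variation (- r) 0 (fun theta => eta t theta i j);
  sa_op_measurable : forall (phi : Cseg r n) (i : 'I_n),
    cmeasurable (@lebesgue_measure R) (fun t => delay_op eta t phi i ord0);
  sa_norm_loc_integrable : loc_integrable (delay_opnorm r eta);
  sa_norm_bounded : exists M : R,
    (ereal_sup (range (fun t : R => (r0^-1)%:E *
       \int[lebesgue_measure]_(u in `[t, (t + r0)%R]) delay_opnorm r eta u))
     <= M%:E)%E
}.

Definition ivp_solution {R : realType} (r : R) {n : nat}
    (eta : R -> R -> 'M[R]_n) (s : R) (phi : Cseg r n) (x : R -> 'cV[R]_n) :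
    Prop :=
  [/\ {within `[s - r, +oo[, continuous x},
      segment r x s = phi,
      forall b : R, s <= b -> abs_cont_on s b x
    & {ae lebesgue_measure, forall t : R, s <= t ->
        is_derive t (1 : R) x (delay_op eta t (segment r x t))}].

(* T(t,s), for s <= t; under the standing assumptions the solution exists and
   is unique on [s - r, +oo[. *)
Definition evolution {R : realType} (r : R) {n : nat}
    (eta : R -> R -> 'M[R]_n) (t s : R) (phi : Cseg r n) : Cseg r n :=
  segment r (xget (fun=> 0) [set x | ivp_solution eta s phi x]) t.

Definition bounded_op {R : realType} {r : R} {n : nat}
    (A : Cseg r n -> Cseg r n) : Prop :=
  (opnorm cnorm cnorm A < +oo)%E.

Definition is_projection {R : realType} {r : R} {n : nat}
    (P : Cseg r n -> Cseg r n) : Prop :=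
  [/\ linear P, bounded_op P & forall phi, P (P phi) = P phi].

Definition kernel_of {R : realType} {r : R} {n : nat}
    (P : Cseg r n -> Cseg r n) : set (Cseg r n) :=
  [set phi | P phi = 0].

(* Inverse of the restriction of [A] to [N], meaningful on the image of [N]. *)
Definition inv_on {R : realType} {r : R} {n : nat} (N : set (Cseg r n))
    (A : Cseg r n -> Cseg r n) : Cseg r n -> Cseg r n :=
  'pinv_(fun=> 0) N A.

Definition is_isomorphism_on {R : realType} {r : R} {n : nat}
    (N N' : set (Cseg r n)) (A : Cseg r n -> Cseg r n) : Prop :=
  [/\ forall (a : R) (phi psi : Cseg r n), N phi -> N psi ->
        A (a *: phi + psi) = a *: A phi + A psi,
      set_bij N N' A,
      exists c : R, forall phi, N phi -> cnorm (A phi) <= c * cnorm phi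
    & exists c : R, forall psi, N' psi -> cnorm (inv_on N A psi) <= c * cnorm psi].

Definition exponential_dichotomy {R : realType} (r : R) {n : nat}
    (eta : R -> R -> 'M[R]_n) : Prop :=
  exists (alpha K : R) (P : R -> Cseg r n -> Cseg r n),
  let T := evolution eta in
  let N t := kernel_of (P t) in
  [/\ 0 < alpha /\ 0 < K,
      forall t, is_projection (P t),
      forall t s phi, s <= t -> T t s (P s phi) = P t (T t s phi),
      forall t s, s <= t -> is_isomorphism_on (N s) (N t) (T t s)
    & (forall t s, s <= t ->
         (opnorm cnorm cnorm (fun phi => T t s (P s phi))
           <= (K * expR (- alpha * (t - s)))%:E)%E) /\
      (forall t s, t <= s ->
         (opnorm cnorm cnorm (fun phi => inv_on (N t) (T s t) (phi - P s phi)%R)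
           <= (K * expR (- alpha * (s - t)))%:E)%E)].

(* Elements of H_b are represented by functions, not by classes modulo
   a.e. equality: the notion of solution only depends on the class. *)
Definition in_H {R : realType} (r0 b : R) {n : nat} (h : R -> 'cV[R]_n) :
    Prop :=
  (forall i : 'I_n, loc_integrable (fun t => (h t i ord0)%:E)) /\
  (ereal_sup (range (fun t : R => (r0^-1 * expR (b * `|t|))%:E *
     \int[lebesgue_measure]_(u in `[t, (t + r0)%R]) (enorm (h u))%:E))
   < +oo)%E.

Definition in_Y {R : realType} (b : R) {n : nat} (y : R -> 'cV[R]_n) : Prop :=
  continuous y /\
  (ereal_sup (range (fun t : R => (expR (b * `|t|) * enorm (y t))%:E)) < +oo)%E.

Definition nonhom_solution {R : realType} (r : R) {n : nat}
    (eta : R -> R -> 'M[R]_n) (h y : R -> 'cV[R]_n) : Prop :=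
  (forall a b : R, a <= b -> abs_cont_on a b y) /\
  {ae lebesgue_measure, forall t : R,
     is_derive t (1 : R) y (delay_op eta t (segment r y t) + h t)}.

Definition properly_admissible {R : realType} (r r0 b : R) {n : nat}
    (eta : R -> R -> 'M[R]_n) : Prop :=
  forall h : R -> 'cV[R]_n, in_H r0 b h ->
    exists! y : R -> 'cV[R]_n, in_Y b y /\ nonhom_solution r eta h y.

(* Main.v *)
Require Import Defs.
From HB Require Import structures.
From mathcomp Require Import all_boot all_order all_algebra.
From mathcomp Require Import all_classical all_reals all_analysis.
From mathcomp Require Import measurable_realfun ring lra.
Set Implicit Arguments.
Unset Strict Implicit.
Unset Printing Implicit Defensive.
Import Order.TTheory GRing.Theory Num.Theory.
Import numFieldNormedType.Exports.
Local Open Scope classical_set_scope.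
Local Open Scope ring_scope.

(** Both implications compare solutions that are bounded on the whole line.

    From admissibility to a dichotomy. Every forcing in H_b has exactly one
    solution in Y_b; a closed graph argument makes this quantitative, with
    |y|_b <= C |h|_b ([bounded_solution_operator]). Let x solve the homogeneous
    equation from the state phi at time s. Switching x on gradually over
    [s, s + 1] gives a function w that vanishes before s, differs from x by at
    most |phi| until s + 1 and equals x afterwards; it solves the equation with
    a forcing h supported in [s, s + 1 + r] and of the size of phi
    ([forcing_of_state]). If y is the bounded solution for the same h, then
    v = w - y solves the homogeneous equation on the whole line. Before s, v is
    -y; after s, x - v is (x - w) + y. Hence phi is the sum of v_s, whose
    backward orbit is small, and of phi - v_s, whose forward orbit is small,
    where small means at most C |phi| e^{b (|s| - |t|)}
    ([splitting_estimates]). The weight is centred at time 0: b^+ gives decay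
    away from 0, b^- gives decay towards 0, and cutting an orbit at time 0
    combines them into a uniform rate alpha = min(b^+, -b^-)
    ([unstable_part_bound]). A homogeneous solution bounded on the whole line
    vanishes, so the splitting is unique; it is therefore linear and invariant
    under the evolution, and yields the projections
    ([admissible_dichotomy]).

    From a dichotomy to admissibility, for b = alpha / 2 and b = - alpha / 2.
    A forcing supported in [s, s + l] has a solution bounded by a multiple of
    e^{- alpha |t - s|}: take the solution that vanishes before s and subtract
    the full orbit of the unstable part of its state at s + l
    ([block_solution]). A forcing in H_b is cut into such pieces; since the
    weight e^{- b |t|} varies by at most e^{(alpha / 2) |t - s|}, the responses
    can be summed in Y_b ([localized_admissible]). Uniqueness holds because the
    stable and the unstable part of a homogeneous solution grow at most like
    e^{(alpha / 2) |t|} but contract at rate alpha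
    ([dichotomy_bounded_zero]).

    Equations are treated in integrated form ([sol_from]); this rests on the
    fundamental theorem of calculus for absolutely continuous functions
    ([acont_constant], [acont_int_derive]), on the existence of
    Riemann-Stieltjes integrals ([RS_monotone]), on the measurability of
    t |-> L(t) x_t ([vlocint_delay]) and on the Volterra theory of the equation
    ([sol_from_exists], [sol_from_bound]). *)

(** * Integrals of functions measurable up to a null set *)

Section AnyIntegral.
Context {R : realType}.
Local Notation mu := (@lebesgue_measure R).
Local Open Scope ereal_scope.

Lemma ae_imp (P Q : R -> Prop) : (forall x, P x -> Q x) ->
  {ae mu, forall x, P x} -> {ae mu, forall x, Q x}.
Proof.
by move=> PQ; apply: filterS => //; exact: (ae_filter_ringOfSetsType mu).
Qed.

Lemma ae_and (P Q : R -> Prop) :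
  {ae mu, forall x, P x} -> {ae mu, forall x, Q x} -> {ae mu, forall x, P x /\ Q x}.
Proof.
by move=> aP aQ; apply: filterS2 aP aQ => //; exact: (ae_filter_ringOfSetsType mu).
Qed.

Lemma ae_neq (c : R) : {ae mu, forall t, (t != c)}.
Proof.
exists [set c]; split => //; first exact: lebesgue_measure_set1.
by move=> x /=; apply: contra_notP => /eqP.
Qed.

(** The integral is a supremum over simple functions below the integrand, so it
    is monotone without measurability. *)
Lemma ge0_le_integral_any (D : set R) (f g : R -> \bar R) :
  (forall x, D x -> 0 <= f x) -> (forall x, D x -> f x <= g x) ->
  \int[mu]_(x in D) f x <= \int[mu]_(x in D) g x.
Proof.
move=> f0 fg; have g0 x : D x -> 0 <= g x by move=> Dx; exact: le_trans (f0 _ Dx) (fg _ Dx).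
rewrite !ge0_integralE//; apply: ereal_sup_le => _ [h /= hf <-].
exists h => //= x; apply: le_trans (hf x) _.
by rewrite !patchE; case: ifPn => // /set_mem Dx; exact: fg.
Qed.

(** [f] lies between two Borel versions of [g], one set to 0 and the other raised
    to +oo on a null Borel set containing the points where [f] differs from [g]. *)
Lemma ge0_ae_eq_integral_any (D : set R) (f g : R -> \bar R) :
  measurable D -> measurable_fun D g ->
  (forall x, D x -> 0 <= f x) -> (forall x, D x -> 0 <= g x) ->
  {ae mu, forall x, D x -> f x = g x} ->
  \int[mu]_(x in D) f x = \int[mu]_(x in D) g x.
Proof.
move=> mD mg f0 g0 [N [mN N0 sN]].
have fgN x : D x -> ~ N x -> f x = g x.
  by move=> Dx Nx; apply: contrapT => fg; apply: Nx; apply: sN => /= /(_ Dx).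
have mcN : measurable (~` N) by exact: measurableC.
pose lo := g \_ (~` N).
pose up x := g x + ((cst +oo) \_ N) x.
have mlo : measurable_fun D lo.
  by apply/measurable_restrict => //; exact: measurable_funS mg.
have mup : measurable_fun D up.
  by apply: emeasurable_funD => //; apply/measurable_restrict.
have aeN (k : R -> \bar R) : (forall x, ~ N x -> k x = g x) -> ae_eq mu D k g.
  move=> kg; exists N; split => // x /=; apply: contra_notP => Nx _; exact: kg.
have lo0 x : D x -> 0 <= lo x.
  by move=> Dx; rewrite /lo patchE; case: ifP => // _; exact: g0.
have up0 x : D x -> 0 <= up x.
  by move=> Dx; rewrite /up patchE; apply: adde_ge0; [exact: g0|case: ifP => _ /=; rewrite ?leey].
have elo : \int[mu]_(x in D) lo x = \int[mu]_(x in D) g x.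
  by apply: ge0_ae_eq_integral => //; apply: aeN => x Nx; rewrite /lo patchE mem_set.
have eup : \int[mu]_(x in D) up x = \int[mu]_(x in D) g x.
  by apply: ge0_ae_eq_integral => //; apply: aeN => x Nx; rewrite /up patchE memNset// adde0.
apply/eqP; rewrite eq_le -{1}eup -elo; apply/andP; split.
  apply: ge0_le_integral_any => // x Dx; rewrite /up patchE; case: ifPn => [_|].
    by rewrite addey ?leey// gt_eqF// (lt_le_trans _ (g0 _ Dx)).
  by rewrite notin_setE adde0 => Nx; rewrite fgN.
apply: ge0_le_integral_any => // x Dx; rewrite /lo patchE; case: ifPn => [|_]; last exact: f0.
by rewrite inE => Nx; rewrite fgN.
Qed.

Lemma ae_eq_integral_any (D : set R) (f g : R -> \bar R) :
  measurable D -> measurable_fun D g ->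
  {ae mu, forall x, D x -> f x = g x} ->
  \int[mu]_(x in D) f x = \int[mu]_(x in D) g x.
Proof.
move=> mD mg fg; rewrite integralE [RHS]integralE; congr (_ - _).
  apply: ge0_ae_eq_integral_any => //; first exact: measurable_funepos.
  by apply: ae_imp fg => x + Dx => /(_ Dx); rewrite !funeposE => ->.
apply: ge0_ae_eq_integral_any => //; first exact: measurable_funeneg.
by apply: ae_imp fg => x + Dx => /(_ Dx); rewrite !funenegE => ->.
Qed.

(** The sets [f < q], with [q] rational, are Borel up to null sets. Off a single
    null Borel set containing all the exceptions they are traces of Borel sets,
    and the Borel version is 0 on that null set. *)
Lemma cmeasurable_borel (f : R -> \bar R) : cmeasurable mu f ->
  exists2 g : R -> \bar R, measurable_fun setT g & {ae mu, forall x, f x = g x}.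
Proof.
move=> mf.
have mray (q : rat) : measurable [set y : \bar R | y < (ratr q)%:E].
  rewrite (_ : [set _ | _] = `]-oo, (ratr q)%:E[%classic); first exact: emeasurable_itv.
  by apply/seteqP; split => x /=; rewrite in_itv.
have /choice[A hA] (q : rat) : exists A : set R, measurable A /\
   {ae mu, forall x, (f x < (ratr q)%:E) = (x \in A)}.
  have [A mA [B [N [mN N0 BN]] E]] := mf _ (mray q).
  exists A; split => //; exists N; split => // x /=; apply: contra_notP => Nx.
  apply/idP/idP => [fx|/set_mem Ax].
    have : (f @^-1` [set y : \bar R | y < (ratr q)%:E]) x by [].
    by rewrite -E => -[/mem_set//|/BN].
  suff : (f @^-1` [set y : \bar R | y < (ratr q)%:E]) x by [].
  by rewrite -E; left.
have [NN [mNN NN0 sNN]] : {ae mu, forall x, forall k : nat,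
    if unpickle k is Some q then (f x < (ratr q)%:E) = (x \in A q) else True}.
  apply: ae_foralln => k; case: unpickle => [q|]; first exact: (hA q).2.
  exact: aeW.
have hN q x : ~ NN x -> (f x < (ratr q)%:E) = (x \in A q).
  move=> Nx; apply: contrapT => h; apply: Nx; apply: sNN => /= /(_ (pickle q)).
  by rewrite pickleK.
exists (f \_ (~` NN)); last first.
  exists NN; split => // x /=; apply: contra_notP => Nx.
  by rewrite patchE mem_set.
refine (@measurability _ _ R (\bar R) setT _ (@ErealGenInftyO.G R) _ _); last move=> _ [_ [x ->] <-].
  exact: ErealGenInftyO.measurableE.
have -> : [set: R] `&` (f \_ (~` NN)) @^-1` `]-oo, x%:E[%classic =
    \bigcup_q (if (ratr q <= x)%R then
    (A q `\` NN) `|` (if (0 < ratr q :> R)%R then NN else set0) else set0).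
  rewrite setTI.
  apply/seteqP; split => [y|y [q _]] /=; last first.
    case: ifP => // qx [[Ay Ny]|] /=; rewrite in_itv/= patchE.
      rewrite mem_set//; apply: (@lt_le_trans _ _ (ratr q)%:E); last by rewrite lee_fin.
      by rewrite hN//; exact: mem_set.
    case: ifP => // q0 Ny; rewrite memNset => [|/(_ Ny)//].
    by rewrite lte_fin (lt_le_trans q0).
  rewrite in_itv/= patchE; case: ifPn => [/set_mem/= Ny fx|].
    have [q fq qx] : exists2 q : rat, f y < (ratr q)%:E & (ratr q < x)%R.
      move: fx; case: (f y) => [z| |] //=; rewrite ?lte_fin => zx.
        by have [q] := rat_in_itvoo zx; rewrite in_itv/= => /andP[zq qx]; exists q.
      have : (x - 1 < x)%R by rewrite gtrBl.
      by move=> /rat_in_itvoo[q]; rewrite in_itv/= => /andP[_ qx]; exists q; rewrite ?ltNyr.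
    exists q => //; rewrite ltW//; left; split => //.
    by apply/set_mem; rewrite -hN.
  rewrite notin_setE => /contrapT Ny; rewrite lte_fin => x0.
  have [q] := rat_in_itvoo x0; rewrite in_itv/= => /andP[q0 qx].
  by exists q => //; rewrite ltW// q0; right.
apply: bigcupT_measurable_rat => q; case: ifP => // _; apply: measurableU.
  by apply: measurableD => //; have [] := hA q.
by case: ifP.
Qed.

End AnyIntegral.

(** * Locally integrable functions on the line *)

Definition borel_locint {R : realType} (g : R -> R) : Prop :=
  measurable_fun setT g /\
  forall a b, (@lebesgue_measure R).-integrable `[a, b] (EFin \o g).

(** Coefficients and forcings are measurable only for the completed measure;
    they are handled through an a.e. equal Borel function. *)
Definition locint {R : realType} (f : R -> R) : Prop :=
  exists2 g : R -> R, borel_locint g &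
    {ae (@lebesgue_measure R), forall t, f t = g t}.

(** Locked so that unification does not unfold Lebesgue integrals. The value is
    0 when [t < s]. *)
HB.lock Definition integral_from_to {R : realType} (s t : R) (f : R -> R) : R :=
  \int[@lebesgue_measure R]_(u in `[s, t]) f u.

Section Locint.
Context {R : realType}.
Local Notation mu := (@lebesgue_measure R).
Local Notation int := integral_from_to.
Implicit Types (f g h : R -> R) (s t c : R).

Lemma int_ae s t f g : borel_locint g -> {ae mu, forall u, f u = g u} ->
  int s t f = int s t g.
Proof.
move=> [mg ig] fg; rewrite !integral_from_to.unlock /Rintegral; congr fine.
apply: ae_eq_integral_any => //.
  by apply/measurable_EFinP; exact: measurable_funS mg.
by apply: ae_imp fg => u -> _.
Qed.

Lemma borel_locint_locint g : borel_locint g -> locint g.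
Proof. by exists g => //; exact: aeW. Qed.

Lemma locint_ae f g : locint g -> {ae mu, forall u, f u = g u} -> locint f.
Proof.
move=> [k bk gk] fg; exists k => //.
by apply: ae_imp (ae_and fg gk) => u [->].
Qed.

Lemma int_eq_ae s t f g : locint g -> {ae mu, forall u, f u = g u} ->
  int s t f = int s t g.
Proof.
move=> [k bk gk] fg; rewrite (int_ae s t bk gk); apply: int_ae => //.
by apply: ae_imp (ae_and fg gk) => u [->].
Qed.

Lemma borel_locintD f g : borel_locint f -> borel_locint g ->
  borel_locint (fun u => f u + g u).
Proof.
move=> [mf If] [mg Ig]; split; first exact: measurable_funD.
by move=> a b; have := integrableD _ (If a b) (Ig a b); apply.
Qed.

Lemma borel_locintZ c f : borel_locint f -> borel_locint (fun u => c * f u).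
Proof.
move=> [mf If]; split; first exact: measurable_funM.
by move=> a b; have := integrableZl _ c (If a b); apply.
Qed.

Lemma borel_locint_norm f : borel_locint f -> borel_locint (fun u => `|f u|).
Proof.
move=> [mf If]; split; first exact: measurableT_comp.
by move=> a b; exact: integrable_norm.
Qed.

Lemma borel_locint_continuous f : continuous f -> borel_locint f.
Proof.
move=> cf; split; first exact: continuous_measurable_fun.
move=> a b; apply: continuous_compact_integrable; first exact: segment_compact.
exact: continuous_subspaceT.
Qed.

Lemma locintD f g : locint f -> locint g -> locint (fun u => f u + g u).
Proof.
move=> [f' bf ef] [g' bg eg]; exists (fun u => f' u + g' u).
  exact: borel_locintD.
by apply: ae_imp (ae_and ef eg) => u [-> ->].
Qed.

Lemma locintZ c f : locint f -> locint (fun u => c * f u).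
Proof.
move=> [f' bf ef]; exists (fun u => c * f' u); first exact: borel_locintZ.
by apply: ae_imp ef => u ->.
Qed.

Lemma locintN f : locint f -> locint (fun u => - f u).
Proof. by move=> /(locintZ (-1)); congr (@locint R _); apply/funext => u; rewrite mulN1r. Qed.

Lemma locintB f g : locint f -> locint g -> locint (fun u => f u - g u).
Proof. by move=> lf lg; apply: locintD => //; exact: locintN. Qed.

Lemma locint_norm f : locint f -> locint (fun u => `|f u|).
Proof.
move=> [f' bf ef]; exists (fun u => `|f' u|); first exact: borel_locint_norm.
by apply: ae_imp ef => u ->.
Qed.

Lemma locint_continuous f : continuous f -> locint f.
Proof. by move=> cf; exact/borel_locint_locint/borel_locint_continuous. Qed.

Lemma locint_cst c : @locint R (fun=> c).
Proof. by apply: locint_continuous => x; exact: cvg_cst. Qed.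

Lemma locint_sum (I : Type) (r : seq I) (F : I -> R -> R) :
  (forall i, locint (F i)) -> locint (fun u => \sum_(i <- r) F i u).
Proof.
move=> lF; elim: r => [|i r IH].
  by rewrite (_ : (fun u => _) = cst 0); [exact: locint_cst|apply/funext => u; rewrite big_nil].
rewrite (_ : (fun u => _) = fun u => F i u + \sum_(j <- r) F j u); first exact: locintD.
by apply/funext => u; rewrite big_cons.
Qed.

Lemma borel_locint_dominated f g : measurable_fun setT f -> borel_locint g ->
  {ae mu, forall u, `|f u| <= g u} -> borel_locint f.
Proof.
move=> mf [mg Ig] fg; split=> // a b.
have mfab : measurable_fun `[a, b] (EFin \o f).
  by apply/measurable_EFinP; exact: measurable_funS mf.
apply/integrableP; split => //.
have /integrableP[mgab] := Ig a b; apply: le_lt_trans.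
apply: ae_ge0_le_integral => //.
- exact: measurableT_comp.
- exact: measurableT_comp.
by apply: ae_imp fg => u fgu _ /=; rewrite lee_fin (le_trans fgu)// ler_norm.
Qed.

Lemma locint_dominated f f' g : measurable_fun setT f' ->
  {ae mu, forall u, f u = f' u} -> locint g ->
  {ae mu, forall u, `|f u| <= g u} -> locint f.
Proof.
move=> mf' ff' [g' bg gg'] fg; exists f' => //.
apply: borel_locint_dominated bg _ => //.
by apply: ae_imp (ae_and ff' (ae_and gg' fg)) => u [<- [<-]].
Qed.

Lemma locint_indic (A : set R) f : measurable A -> locint f ->
  locint (fun u => \1_A u * f u).
Proof.
move=> mA [f' bf ff'].
apply: (@locint_dominated _ (fun u => \1_A u * f' u) (fun u => `|f' u|)).
- by apply: measurable_funM => //; exact: bf.1.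
- by apply: ae_imp ff' => u ->.
- exact/borel_locint_locint/borel_locint_norm.
apply: ae_imp ff' => u ->; rewrite normrM ger0_norm//.
by rewrite ler_piMl// indicE; case: (_ \in _).
Qed.

Lemma intD s t f g : locint f -> locint g ->
  int s t (fun u => f u + g u) = int s t f + int s t g.
Proof.
move=> [f' bf ef] [g' bg eg].
rewrite (int_ae s t bf ef) (int_ae s t bg eg) (@int_ae s t _ (fun u => f' u + g' u)).
- by rewrite !integral_from_to.unlock; apply: RintegralD => //; [exact: bf.2|exact: bg.2].
- exact: borel_locintD.
by apply: ae_imp (ae_and ef eg) => u [-> ->].
Qed.

Lemma intZ s t c f : locint f -> int s t (fun u => c * f u) = c * int s t f.
Proof.
move=> [f' bf ef]; rewrite (int_ae s t bf ef) (@int_ae s t _ (fun u => c * f' u)).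
- by rewrite !integral_from_to.unlock; apply: RintegralZl => //; exact: bf.2.
- exact: borel_locintZ.
by apply: ae_imp ef => u ->.
Qed.

Lemma intN s t f : locint f -> int s t (fun u => - f u) = - int s t f.
Proof.
by move=> lf; rewrite -mulN1r -intZ//; congr (@integral_from_to R _ _ _); apply/funext => u; rewrite mulN1r.
Qed.

Lemma intB s t f g : locint f -> locint g ->
  int s t (fun u => f u - g u) = int s t f - int s t g.
Proof. by move=> lf lg; rewrite intD ?intN//; exact: locintN. Qed.

Lemma int_sum s t (I : Type) (r : seq I) (F : I -> R -> R) :
  (forall i, locint (F i)) ->
  int s t (fun u => \sum_(i <- r) F i u) = \sum_(i <- r) int s t (F i).
Proof.
move=> lF; elim: r => [|i r IH].
  rewrite big_nil (_ : (fun u => _) = cst 0); last by apply/funext => u; rewrite big_nil.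
  by rewrite integral_from_to.unlock Rintegral_cst// mul0r.
rewrite big_cons -IH -intD//; last exact: locint_sum.
by congr (@integral_from_to R _ _ _); apply/funext => u; rewrite big_cons.
Qed.

Lemma int_le s t f g : locint f -> locint g ->
  {ae mu, forall u, s <= u <= t -> f u <= g u} -> int s t f <= int s t g.
Proof.
move=> [f' bf ef] [g' bg eg] fg.
rewrite (int_ae s t bf ef) (int_ae s t bg eg).
have {}fg : {ae mu, forall u, `[s, t]%classic u -> f' u <= g' u}.
  by apply: ae_imp (ae_and fg (ae_and ef eg)) => u [H [<- <-]] /=; rewrite in_itv.
rewrite -subr_ge0 !integral_from_to.unlock -RintegralB//; [|exact: bg.2|exact: bf.2].
have [bd1 bd2] := borel_locintD bg (borel_locintZ (-1) bf).
rewrite /Rintegral (_ : \int[mu]_(x in _) _ =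
    \int[mu]_(x in `[s,t]) (Num.max (g' x - f' x) 0)%:E)%E; last first.
  apply: ae_eq_integral => //.
  - apply/measurable_EFinP; apply: measurable_funB; [exact: measurable_funS bg.1|exact: measurable_funS bf.1].
  - apply/measurable_EFinP; apply: measurable_maxr => //.
    by apply: measurable_funB; [exact: measurable_funS bg.1|exact: measurable_funS bf.1].
  by apply: ae_imp fg => u H /H; rewrite -subr_ge0 => /max_idPl ->.
by rewrite fine_ge0// integral_ge0// => u _; rewrite lee_fin le_max lexx orbT.
Qed.

Lemma int_ge0 s t f : (forall u, 0 <= f u) -> 0 <= int s t f.
Proof. by move=> f0; rewrite integral_from_to.unlock; exact: Rintegral_ge0. Qed.

Lemma int0 s t : int s t (fun=> 0) = 0.
Proof. by rewrite integral_from_to.unlock Rintegral_cst// mul0r. Qed.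

Lemma int_cst s t c : s <= t -> int s t (fun=> c) = c * (t - s).
Proof.
move=> st; rewrite integral_from_to.unlock Rintegral_cst//= lebesgue_measure_itv/= lte_fin.
by case: ltgtP st => // -> _; rewrite subrr mulr0.
Qed.

Lemma int_norm s t f : locint f -> `|int s t f| <= int s t (fun u => `|f u|).
Proof.
move=> lf; rewrite ler_norml; apply/andP; split.
  rewrite -[leLHS]opprK opprK -intN; last exact: locint_norm.
  apply: int_le => //; first exact/locintN/locint_norm.
  by apply: aeW => u _; rewrite lerNl ler_normr lexx orbT.
by apply: int_le => //; [exact: locint_norm|apply: aeW => u _; exact: ler_norm].
Qed.

Lemma int_cat s t u f : locint f -> s <= t -> t <= u ->
  int s u f = int s t f + int t u f.
Proof.
move=> [g bg fg] st tu; rewrite !(int_ae _ _ bg fg) !integral_from_to.unlock.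
rewrite -[X in _ = _ + X]Rintegral_itv_obnd_cbnd; last first.
  by apply: integrableS (bg.2 t u) => //; exact: subset_itv_oc_cc.
by rewrite -(@Rintegral_itvB _ _ (BLeft s) _ t) ?bnd_simp//; [rewrite addrC subrK|exact: bg.2].
Qed.

Lemma intxx s f : int s s f = 0.
Proof. by rewrite integral_from_to.unlock set_itv1 Rintegral_set1. Qed.

Lemma int_nd s s' t' t f : locint f -> (forall u, 0 <= f u) -> s <= s' -> s' <= t' -> t' <= t ->
  int s' t' f <= int s t f.
Proof.
move=> lf f0 ss st tt; rewrite (@int_cat s s' t)//; last exact: le_trans tt.
rewrite (@int_cat s' t' t)//.
by rewrite addrCA lerDl addr_ge0// int_ge0.
Qed.

Lemma integral_int s t f : locint f -> (forall u, 0 <= f u) ->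
  (\int[mu]_(u in `[s, t]) (f u)%:E = (int s t f)%:E)%E.
Proof.
move=> [g bg fg] f0; rewrite !integral_from_to.unlock /Rintegral fineK//.
rewrite (ae_eq_integral_any (g := EFin \o g))//.
- exact: (integrable_fin_num _ (bg.2 s t)).
- by apply/measurable_EFinP; exact: measurable_funS bg.1.
by apply: ae_imp fg => u /= -> _.
Qed.

Lemma ereal_locint (G : R -> \bar R) : measurable_fun setT G ->
  (forall a b, (\int[mu]_(t in `[a, b]) `|G t| < +oo)%E) ->
  borel_locint (fine \o G) /\ {ae mu, forall t, G t \is a fin_num}.
Proof.
move=> mG iG; split.
  split; first exact: measurableT_comp.
  move=> a b; apply/integrableP; split.
    by apply/measurable_EFinP; apply: measurableT_comp => //; exact: measurable_funS mG.
  apply: le_lt_trans (iG a b); apply: ge0_le_integral_any => // t _ /=.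
  by case: (G t) => //= ; rewrite ?normr0 ?leey.
have : {ae mu, forall t, forall k : nat, `[- k%:R, k%:R]%classic t -> G t \is a fin_num}.
  apply: ae_foralln => k; apply: (@integrable_ae _ _ _ mu `[- k%:R, k%:R]%classic _ G) => //.
  by apply/integrableP; split; [exact: measurable_funS mG|exact: iG].
apply: ae_imp => t /(_ (Num.truncn `|t|).+1); apply; rewrite /= in_itv/= -ler_norml.
exact/ltW/truncnS_gt.
Qed.

End Locint.

(** * Absolute continuity and the fundamental theorem of calculus *)

Section DeriveIncrement.
Context {R : realType} {V : normedModType R}.
Implicit Types (F : R -> V) (t : R) (l : V).

Lemma is_derive_increment F t l : is_derive t 1 F l <->
  forall e, 0 < e -> exists2 d, 0 < d &
    forall h, `|h| < d -> `|F (t + h) - F t - h *: l| <= e * `|h|.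
Proof.
have E h m : h != 0 -> m - h^-1 *: (F (h *: 1 + t) - F t) =
    - (h^-1 *: (F (t + h) - F t - h *: m)).
  move=> h0; have -> : h *: 1 + t = t + h by rewrite addrC; congr (_ + _); exact: mulr1.
  by rewrite [in RHS]scalerBr scalerA mulVf// scale1r opprB.
split=> [[dF <-] e e0|H].
  have /cvgrPdist_le /(_ _ e0) : (fun h => h^-1 *: (F (h *: 1 + t) - F t)) @ 0^' --> 'D_1 F t.
    exact: dF.
  move=> /nbhs_ballP [d /= d0 H]; exists d => // h hd.
  have [->|h0] := eqVneq h 0; first by rewrite addr0 subrr scale0r subr0 !normr0 mulr0.
  have := H h; rewrite /ball/= sub0r normrN => /(_ hd h0).
  rewrite E//.
  by rewrite normrN normrZ normfV ler_pdivrMl ?normr_gt0// mulrC.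
have C : (fun h => h^-1 *: (F (h *: 1 + t) - F t)) @ 0^' --> l.
  apply/cvgrPdist_le => e e0; have [d d0 Hd] := H e e0.
  apply/nbhs_ballP; exists d => //= h; rewrite /ball/= sub0r normrN => hd h0.
  by rewrite E// normrN normrZ normfV ler_pdivrMl ?normr_gt0// mulrC Hd.
split; first by apply/cvg_ex; exists l.
by apply: cvg_lim => //; exact: norm_hausdorff.
Qed.

End DeriveIncrement.

(** The scalar form of [abs_cont_on], to which the latter reduces coordinate by
    coordinate. *)
Definition acont {R : realType} (a b : R) (F : R -> R) : Prop :=
  forall eps : R, 0 < eps -> exists2 delta : R, 0 < delta &
    forall I : seq (R * R),
      all (fun p => [&& a <= p.1, p.1 <= p.2 & p.2 <= b]) I ->
      pairwise (fun p q => (p.2 <= q.1) || (q.2 <= p.1)) I ->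
      \sum_(p <- I) (p.2 - p.1) < delta ->
      \sum_(p <- I) `|F p.2 - F p.1| < eps.

Section Acont.
Context {R : realType}.
Local Notation mu := (@lebesgue_measure R).
Local Notation int := integral_from_to.
Implicit Types (F g w : R -> R) (a b s t c : R).

Lemma acontB a b F g : acont a b F -> acont a b g -> acont a b (fun t => F t - g t).
Proof.
move=> cF cg e e0; have e20 : 0 < e / 2 by rewrite divr_gt0.
have [d1 d10 H1] := cF _ e20; have [d2 d20 H2] := cg _ e20.
exists (Num.min d1 d2) => [|I aI pI]; first by rewrite lt_min d10.
rewrite lt_min => /andP[/(H1 _ aI pI) S1 /(H2 _ aI pI) S2].
rewrite [e]splitr; apply: le_lt_trans (ltrD S1 S2); rewrite -big_split/=.
apply: ler_sum => p _.
have -> : F p.2 - g p.2 - (F p.1 - g p.1) = F p.2 - F p.1 - (g p.2 - g p.1) by ring.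
exact: ler_normB.
Qed.

(** The points without zero derivative are covered by an open set [U] of measure
    below the modulus of absolute continuity for [e]. Moving right from [a], the
    increment of [F] is at most [e] times the distance, up to increments over
    disjoint intervals inside [U], whose sum is below [e]. This property passes
    across every point, through [U] or through the derivative, so it reaches
    [b]. *)
Lemma acont_constant a b F : a <= b -> acont a b F ->
  {ae mu, forall t, a < t < b -> is_derive t 1 F 0} -> F b = F a.
Proof.
move=> ab cF dF.
have [N' [mN' N'0 sN]] := ae_and dF (ae_and (ae_neq a) (ae_neq b)).
have {}sN t : ~ N' t -> [/\ a < t < b -> is_derive t 1 F 0, t != a & t != b].
  move=> Nt; have [? [? ?]] := contrapT (contra_not (@sN t) Nt).
  by split.

suff H e : 0 < e -> `|F b - F a| <= e * (b - a) + e.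
  apply/eqP; rewrite -subr_eq0 -normr_le0; apply/ler_addgt0Pl => e e0.
  have ba : 0 < b - a + 1 by rewrite ltr_wpDl// subr_ge0.
  rewrite addr0; apply: le_trans (H (e / (b - a + 1)) _) _; first by rewrite divr_gt0.
  by rewrite -[X in _ + X]mulr1 -mulrDr divfK// gt_eqF.
move=> e0; have [d d0 Hd] := cF e e0.
have N0 : mu N' = 0%E := N'0.
have Nfin : (mu N' < +oo)%E by rewrite N0 ltry.
have [U [oU N'U]] := lebesgue_regularity_outer mN' Nfin d0.
have mU : measurable U by exact: open_measurable.
move=> UN; have Ud : (mu U < d%:E)%E.
  apply: le_lt_trans UN; rewrite (measureDI mu mU mN') (setIidr N'U).
  by rewrite [X in (_ + X <= _)%E]N0 adde0.
(* the estimate on [a, t], with the intervals inside [U] listed in [I] *)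
pose good t := a <= t <= b /\ exists I : seq (R * R),
  [/\ all (fun p => [&& a <= p.1, p.1 <= p.2 & p.2 <= t]) I,
      pairwise (fun p q => (p.2 <= q.1) || (q.2 <= p.1)) I,
      ((\sum_(p <- I) (p.2 - p.1))%:E <= mu (U `&` `[a, t]))%E &
      `|F t - F a| <= e * (t - a) + \sum_(p <- I) `|F p.2 - F p.1|].
(* goodness passes from the left to the right of every point *)
have step tau : a <= tau <= b -> exists2 eta, 0 < eta & forall u v, u <= tau -> tau <= v ->
    tau - eta < u -> v < tau + eta -> v <= b -> good u -> good v.
  move=> /andP[atau taub]; have [Ut|Ut] := pselect (U tau).
    have [eta /= eta0 etaU] : exists2 x : R, 0 < x & ball tau x `<=` U.
      by apply/nbhs_ballP; exact: open_nbhs_nbhs.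
    exists eta => // u v ut tv etau veta vb [/andP[au ub] [I [aI pI mI FI]]].
    have uv : u <= v := le_trans ut tv.
    have uvU : `]u, v]%classic `<=` U.
      move=> x /=; rewrite in_itv/= => /andP[ux xv]; apply: etaU.
      by rewrite /ball/= distrC ltr_norml; apply/andP; split; lra.
    split; first by rewrite (le_trans au uv).
    exists ((u, v) :: I); split.
    - rewrite /= au uv lexx/=; apply: sub_all aI => p /and3P[-> -> pu].
      by rewrite (le_trans pu).
    - rewrite /= pI andbT; apply: sub_all aI => p /and3P[_ _ pu].
      by rewrite pu orbT.
    - rewrite big_cons/= EFinD.
      have -> : U `&` `[a, v] = (`]u, v]%classic) `|` (U `&` `[a, u]).
        apply/seteqP; split => x /=; rewrite !in_itv/=.
          move=> [Ux /andP[ax xv]]; case: (leP x u) => xu; [right|left] => //.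
            by rewrite ax.
        case=> [/andP[ux xv]|[Ux /andP[ax xu]]]; last by rewrite ax (le_trans xu).
        by rewrite xv (le_trans au (ltW ux)); split => //; apply: uvU; rewrite /= in_itv/= ux.
      rewrite measureU//; first last.
      - apply/seteqP; split => // x /=; rewrite !in_itv/= => -[/andP[ux _] [_ /andP[_ xu]]].
        by rewrite leNgt ux in xu.
      - exact: measurableI.
      apply: leeD => //; rewrite [leRHS]lebesgue_measure_itv/= lte_fin.
      by case: ltP => // vu; rewrite lee_fin subr_le0.
    rewrite big_cons/=.
    have -> : F v - F a = (F v - F u) + (F u - F a) by rewrite addrA subrK.
    rewrite (le_trans (ler_normD _ _))// addrCA lerD2l (le_trans FI)// lerD2r.
    by rewrite ler_wpM2l ?(ltW e0)// lerD2r.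
  have [dFt ta tb] : [/\ a < tau < b -> is_derive tau 1 F 0, tau != a & tau != b].
    by apply: sN => Nt; apply: Ut; apply: N'U.
  have {dFt}dF' : is_derive tau 1 F 0.
    by apply: dFt; rewrite !lt_neqAle eq_sym ta atau tb.
  have [eta eta0 Heta] := (is_derive_increment F tau 0).1 dF' e e0.
  exists eta => // u v ut tv etau veta vb [/andP[au ub] [I [aI pI mI FI]]].
  have uv : u <= v := le_trans ut tv.
  split; first by rewrite (le_trans au uv).
  exists I; split => //.
  - by apply: sub_all aI => p /and3P[-> -> pu]; rewrite (le_trans pu).
  - apply: le_trans mI _; apply: le_measure; rewrite ?inE; try exact: measurableI.
    by move=> x /=; rewrite !in_itv/= => -[Ux /andP[-> xu]]; rewrite (le_trans xu).
  have -> : F v - F a = ((F v - F tau) - (F u - F tau)) + (F u - F a).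
    by ring.
  have Fv : `|F v - F tau| <= e * (v - tau).
    have := Heta (v - tau); rewrite ger0_norm ?subr_ge0// ltrBlDl => /(_ veta).
    by rewrite subrKC scaler0 subr0.
  have Fu : `|F u - F tau| <= e * (tau - u).
    have := Heta (u - tau); rewrite distrC ger0_norm ?subr_ge0// ltrBlDr -ltrBlDl => /(_ etau).
    by rewrite subrKC scaler0 subr0.
  rewrite (le_trans (ler_normD _ _))//.
  apply: le_trans (lerD (le_trans (ler_normB _ _) (lerD Fv Fu)) FI) _.
  by rewrite addrA lerD2r -!mulrDr ler_pM2l//; lra.
have ga : good a.
  split; first by rewrite lexx.
  exists [::]; split => //; rewrite ?big_nil ?measure_ge0//.
  by rewrite !subrr normr0 mulr0 addr0.
pose S := [set t | good t].
have supS : has_sup S.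
  by split; [exists a|exists b => t [/andP[]]].
pose tau := sup S.
have /andP[atau taub] : a <= tau <= b.
  by rewrite ub_le_sup//; [apply: ge_sup; [exists a|move=> t [/andP[]]]|exact: supS.2].
have [eta eta0 Heta] : exists2 eta, 0 < eta & forall u v, u <= tau -> tau <= v ->
    tau - eta < u -> v < tau + eta -> v <= b -> good u -> good v.
  by apply: step; rewrite atau.
have [u Su etau] := sup_adherent eta0 supS.
have utau : u <= tau by apply: ub_le_sup => //; exact: supS.2.
have [[_ [I [aI pI mI FI]]]] : good b.
  have [btau|taub'] := ltP b (tau + eta); first by apply: Heta Su.
  have : good (tau + eta / 2).
    apply: Heta Su => //; rewrite ?lerDl ?ltrD2l ?divr_ge0 ?(ltW eta0)//; lra.
  move=> /(ub_le_sup supS.2); rewrite -/tau gerDl => /(lt_le_trans _) -/(_ 0).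
  by rewrite divr_gt0// ltxx => /(_ isT).
apply: le_trans FI _; rewrite lerD2l ltW//; apply: Hd => //.
rewrite -lte_fin (le_lt_trans mI)// (le_lt_trans _ Ud)// le_measure// ?inE//.
exact: measurableI.
Qed.

End Acont.

Section Primitive.
Context {R : realType}.
Local Notation mu := (@lebesgue_measure R).
Local Notation int := integral_from_to.
Implicit Types (F g w : R -> R) (a b s t c e : R).

Lemma int_nonoverlap a b w (I : seq (R * R)) : locint w -> (forall u, 0 <= w u) ->
  all (fun p => [&& a <= p.1, p.1 <= p.2 & p.2 <= b]) I ->
  pairwise (fun p q => (p.2 <= q.1) || (q.2 <= p.1)) I ->
  \sum_(p <- I) int p.1 p.2 w <= int a b w.
Proof.
move=> lw w0 aI pI.
pose chi (p : R * R) (u : R) := \1_(`]p.1, p.2[%classic : set R) u : R.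
have lchi p : locint (fun u => chi p u * w u) by exact: locint_indic.
have E p : p \in I -> int p.1 p.2 w = int a b (fun u => chi p u * w u).
  move=> pI'; have /and3P[ap pp pb] := allP aI _ pI'.
  have [g bg wg] := lw.
  rewrite (int_ae _ _ bg wg) (@int_eq_ae _ a b _ (fun u => chi p u * g u)).
  - rewrite !integral_from_to.unlock (_ : (fun u => chi p u * g u) = g \_ `]p.1, p.2[).
      rewrite -Rintegral_mkcondr (_ : `[a, b] `&` `]p.1, p.2[ = `]p.1, p.2[%classic).
        rewrite /Rintegral; congr fine; apply: integral_itv_bndoo.
        by apply/measurable_EFinP; exact: measurable_funS bg.1.
      apply/seteqP; split => x /=; rewrite !in_itv/=; first by case.
      by move=> /andP[px xp]; rewrite px xp (le_trans ap (ltW px)) (le_trans (ltW xp) pb).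
    by apply/funext => u; rewrite /chi patchE indicE; case: ifP; rewrite ?mul1r ?mul0r.
  - exact/locint_indic/borel_locint_locint.
  by apply: ae_imp wg => u ->.
rewrite big_seq (eq_bigr _ E) -big_seq -int_sum//.
apply: int_le => //; first exact: locint_sum.
apply: aeW => u _; rewrite -mulr_suml ler_piMl//.
elim: I pI {aI E} => [|p I IH]; first by rewrite big_nil.
rewrite /= => /andP[ap pI]; rewrite big_cons.
have [up|up] := boolP (u \in (`]p.1, p.2[%classic : set R)); last first.
  by rewrite {1}/chi indicE (negbTE up) add0r IH.
rewrite {1}/chi indicE up big_seq big1 ?addr0// => q qI.
rewrite /chi indicE memNset// => /=; move: up; rewrite inE/= !in_itv/= => /andP[pu up] /andP[qu uq].
have /orP[h|h] := allP ap _ qI.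
  by have := lt_trans up (le_lt_trans h qu); rewrite ltxx.
by have := lt_trans uq (le_lt_trans h pu); rewrite ltxx.
Qed.

Lemma int_tail a b w e : borel_locint w -> (forall u, 0 <= w u) -> 0 < e ->
  exists k : nat, int a b (fun u => w u - Num.min (w u) k%:R) < e.
Proof.
move=> [mw Iw] w0 e0.
have mfk k : measurable_fun `[a, b] (fun u => (w u - Num.min (w u) k%:R)%:E).
  apply/measurable_EFinP; apply: (@measurable_funS _ _ _ _ setT) => //.
  by apply: measurable_funB => //; exact: measurable_minr.
have bd k u : 0 <= w u - Num.min (w u) k%:R <= w u.
  by rewrite subr_ge0 ge_min lexx/= gerBl le_min w0 ler0n.
have H : (\int[mu]_(u in `[a, b]) (w u - Num.min (w u) k%:R)%:E @[k --> \oo] -->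
    \int[mu]_(u in `[a, b]) cst 0 u)%E.
  apply: (@dominated_cvg _ _ _ mu _ _ _ (cst 0%E) (EFin \o w)) => //.
  - move=> x _; apply: cvg_near_cst.
    near=> k; apply/eqP; rewrite eqe subr_eq0 eq_sym; apply/eqP/min_idPl.
    by near: k; exact: nbhs_infty_ger.
  - by move=> k x _; rewrite /= lee_fin ger0_norm; have /andP[] := bd k x.
rewrite integral_cst// mul0e in H.
have /fine_cvgP[fk] := H; move=> /cvgrPdist_lt /(_ _ e0) [k _ Hk].
exists k; rewrite integral_from_to.unlock; have := Hk k (leqnn _); rewrite /= sub0r normrN ger0_norm//.
by apply: Rintegral_ge0 => u _; have /andP[] := bd k u.
Unshelve. all: by end_near. Qed.

(** The truncation of |g| at height [k] contributes at most [k] times the total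
    length; the rest of |g| has a small integral, whatever the intervals. *)
Lemma acont_int a b s g : locint g -> s <= a -> acont a b (fun t => int s t g).
Proof.
move=> lg sa e e0.
have [g' bg' gg'] := lg.
pose w u := `|g' u|; have bw : borel_locint w by exact: borel_locint_norm.
have w0 u : 0 <= w u by exact: normr_ge0.
have e20 : 0 < e / 2 by rewrite divr_gt0.
have [k Hk] := int_tail a b bw w0 e20.
have lwk : locint (fun u => Num.min (w u) k%:R).
  apply: (@locint_dominated _ _ (fun u => Num.min (w u) k%:R) w).
  - by apply: measurable_minr => //; exact: bw.1.
  - exact: aeW.
  - exact: borel_locint_locint.
  apply: aeW => u; have m0 : 0 <= Num.min (w u) k%:R by rewrite le_min w0 ler0n.
  by rewrite (ger0_norm m0) ge_min lexx.
have lw : locint w by exact: borel_locint_locint.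
exists (e / 2 / k.+1%:R) => [|I aI pI SI]; first by rewrite divr_gt0.
have H : \sum_(p <- I) `|int s p.2 g - int s p.1 g| <=
    \sum_(p <- I) (k%:R * (p.2 - p.1) + int p.1 p.2 (fun u => w u - Num.min (w u) k%:R)).
  rewrite big_seq [leRHS]big_seq; apply: ler_sum => p pI'.
  have /and3P[ap pp pb] := allP aI _ pI'.
  rewrite (int_cat lg (le_trans sa ap) pp) addrC addKr.
  rewrite (int_eq_ae _ _ _ gg'); last exact: borel_locint_locint.
  rewrite (le_trans (int_norm _ _ _))//; first exact: borel_locint_locint.
  rewrite -/w intB// addrC -[leLHS](subrK (int p.1 p.2 (fun u => Num.min (w u) k%:R))) lerD2l.
  rewrite -int_cst//; apply: int_le => //; first exact: locint_cst.
  by apply: aeW => u _; rewrite ge_min lexx orbT.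
apply: le_lt_trans H _; rewrite big_split/= [e]splitr ltr_leD//.
  rewrite -mulr_sumr; have [->|k0] := posnP k; first by rewrite mul0r.
  rewrite mulrC -ltr_pdivlMr ?ltr0n// (lt_trans SI)// ltr_pM2l//.
  by rewrite ltf_pV2 ?posrE ?ltr0n// ltr_nat.
apply: le_trans (int_nonoverlap _ _ aI pI) (ltW Hk); first exact: locintB.
by move=> u; rewrite subr_ge0 ge_min lexx.
Qed.

Lemma is_derive_int s g : locint g ->
  {ae mu, forall t, s < t -> is_derive t 1 (fun t => int s t g) (g t)}.
Proof.
move=> [g' bg' gg'].
have loc : locally_integrable [set: R] g'.
  split; [exact: bg'.1|exact: openT|move=> K _ cK].
  have [M [_ MK]] := compact_bounded cK.
  have /integrableP[mI Ifin] := bg'.2 (- (M + 1)) (M + 1).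
  apply: le_lt_trans Ifin; rewrite -[leRHS]/(\int[mu]_(x in `[(- (M + 1))%R, (M + 1)%R]) `|g' x|%:E)%E.
  apply: ge0_subset_integral => //.
  - exact: compact_measurable.
  - by apply/measurable_EFinP; apply: measurableT_comp => //; exact: measurable_funS bg'.1.
  move=> x Kx /=; rewrite in_itv/= -ler_norml; apply: MK => //; rewrite ltrDl//.
have -> : (fun t => int s t g) = fun t => \int[mu]_(u in `[s, t]) g' u.
  by apply/funext => t; rewrite (int_ae s t bg' gg') integral_from_to.unlock.
have int' y : mu.-integrable [set` Interval (BLeft s) (BRight y)] (EFin \o g') by exact: bg'.2.
have := FTC1 int' loc; move=> /(ae_and gg'); apply: ae_imp => t [-> H] st.
have [|dG <-] := H; first by first [done | by rewrite (@lte_fin R) | by rewrite lteBSide /= ltW | by rewrite /Order.lt /= ltW | by apply: (ltW st)].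
by split; [exact: dG|rewrite derive1E].
Qed.

Lemma acont_int_derive a b F g : a <= b -> acont a b F -> locint g ->
  {ae mu, forall t, a < t < b -> is_derive t 1 F (g t)} -> F b - F a = int a b g.
Proof.
move=> ab cF lg dF; pose D t := F t - int a t g.
have : D b = D a.
  apply: acont_constant => //; first by apply: acontB => //; exact: acont_int.
  apply: ae_imp (ae_and dF (is_derive_int a lg)) => t [H1 H2] atb.
  have atb' := atb; move: atb' => /andP[at' _].
  have := @is_deriveB _ _ _ _ _ _ _ _ _ (H1 atb) (H2 at'); rewrite subrr.
  by congr is_derive.
by rewrite /D intxx subr0 => <-; ring.
Qed.

Lemma acont_continuous a b F : acont a b F -> forall e, 0 < e ->
  exists2 d, 0 < d & forall s t, a <= s -> s <= t -> t <= b -> t - s < d -> `|F t - F s| < e.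
Proof.
move=> cF e e0; have [d d0 H] := cF e e0; exists d => // s t as' st tb std.
have := H [:: (s, t)]; rewrite /= as' st tb !big_seq1/=; apply => //.
Qed.

Lemma acont_lipschitz a b F g k : 0 <= k ->
  (forall s t, a <= s -> s <= t -> t <= b -> `|g t - g s| <= k * `|F t - F s|) ->
  acont a b F -> acont a b g.
Proof.
move=> k0 gF cF e e0.
have k1 : 0 < k + 1 by rewrite ltr_wpDl.
have [d d0 H] := cF (e / (k + 1)) (divr_gt0 e0 k1).
exists d => // I aI pI SI; have := H I aI pI SI; rewrite ltr_pdivlMr// => {}H.
apply: le_lt_trans H; rewrite mulr_suml big_seq [leRHS]big_seq.
apply: ler_sum => p pI'; have /and3P[ap pp pb] := allP aI _ pI'.
rewrite (le_trans (gF _ _ ap pp pb))// mulrC ler_wpM2l//.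
by rewrite lerDl.
Qed.

End Primitive.

(** * Euclidean norm and vector-valued functions *)

Section Enorm.
Context {R : realType} {n : nat}.
Implicit Types (x y v : 'cV[R]_n).

Lemma enorm_ge0 v : 0 <= enorm v.
Proof. exact: sqrtr_ge0. Qed.

Lemma sum_sqr_ge0 v : 0 <= \sum_(i < n) v i ord0 ^+ 2.
Proof. by apply: sumr_ge0 => i _; exact: sqr_ge0. Qed.

Lemma sqr_enorm v : enorm v ^+ 2 = \sum_(i < n) v i ord0 ^+ 2.
Proof. by rewrite sqr_sqrtr// sum_sqr_ge0. Qed.

Lemma enorm0 : enorm (0 : 'cV[R]_n) = 0.
Proof. by rewrite /enorm big1 ?sqrtr0// => i _; rewrite mxE expr0n. Qed.

Lemma enormZ a v : enorm (a *: v) = `|a| * enorm v.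
Proof.
rewrite /enorm (eq_bigr (fun i => a ^+ 2 * v i ord0 ^+ 2)); last first.
  by move=> i _; rewrite mxE exprMn.
by rewrite -mulr_sumr sqrtrM ?sqr_ge0// sqrtr_sqr.
Qed.

Lemma enormN v : enorm (- v) = enorm v.
Proof. by rewrite -scaleN1r enormZ normrN1 mul1r. Qed.

Lemma enormBC x y : enorm (x - y) = enorm (y - x).
Proof. by rewrite -enormN opprB. Qed.

Lemma cauchy_schwarz x y :
  (\sum_(i < n) x i ord0 * y i ord0) ^+ 2 <= enorm x ^+ 2 * enorm y ^+ 2.
Proof.
rewrite !sqr_enorm; set A := \sum_i x i _ ^+ 2; set B := \sum_i y i _ ^+ 2.
set C := \sum_i x i _ * y i _.
have B0 : 0 <= B by exact: sum_sqr_ge0.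
have : 0 <= \sum_(i < n) (B * x i ord0 - C * y i ord0) ^+ 2.
  by apply: sumr_ge0 => i _; exact: sqr_ge0.
have -> : \sum_(i < n) (B * x i ord0 - C * y i ord0) ^+ 2 = B * (A * B - C ^+ 2).
  rewrite (eq_bigr (fun i => B ^+ 2 * (x i ord0 ^+ 2) + (- 2 * B * C) * (x i ord0 * y i ord0)
     + C ^+ 2 * y i ord0 ^+ 2)); last by move=> i _; ring.
  by rewrite !big_split/= -!mulr_sumr -/A -/B -/C; ring.
have [B00 _|Bn0] := eqVneq B 0; last by rewrite pmulr_rge0 ?subr_ge0// lt_neqAle eq_sym Bn0.
rewrite B00 mulr0 /C big1 ?expr0n//= => i _.
have /eqP : y i ord0 ^+ 2 = 0.
  apply/eqP; rewrite eq_le sqr_ge0 andbT -B00 /B (bigD1 i)//= lerDl.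
  by apply: sumr_ge0 => j _; exact: sqr_ge0.
by rewrite sqrf_eq0 => /eqP ->; rewrite mulr0.
Qed.

Lemma enormD x y : enorm (x + y) <= enorm x + enorm y.
Proof.
rewrite -ler_sqr ?nnegrE ?addr_ge0 ?enorm_ge0//.
rewrite sqr_enorm (eq_bigr (fun i => x i ord0 ^+ 2 + 2 * (x i ord0 * y i ord0)
     + y i ord0 ^+ 2)); last by move=> i _; rewrite mxE; ring.
rewrite !big_split/= -mulr_sumr -!sqr_enorm sqrrD lerD2r lerD2l mulr_natl.
rewrite lerMn2r/= (le_trans (ler_norm _))// -ler_sqr ?nnegrE ?mulr_ge0 ?enorm_ge0//.
by rewrite real_normK ?num_real// exprMn cauchy_schwarz.
Qed.

Lemma enormB x y : enorm (x - y) <= enorm x + enorm y.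
Proof. by rewrite -[enorm y]enormN enormD. Qed.

Lemma enorm_coord v i : `|v i ord0| <= enorm v.
Proof.
rewrite -ler_sqr ?nnegrE ?enorm_ge0// real_normK ?num_real// sqr_enorm (bigD1 i)//= lerDl.
by apply: sumr_ge0 => j _; exact: sqr_ge0.
Qed.

Lemma enorm_le_sum v : enorm v <= \sum_(i < n) `|v i ord0|.
Proof.
have h : 0 <= \sum_(i < n) `|v i ord0| by exact: sumr_ge0.
rewrite -ler_sqr ?nnegrE ?enorm_ge0// sqr_enorm expr2 mulr_suml; apply: ler_sum => i _.
rewrite -(real_normK (num_real (v i ord0))) expr2 ler_wpM2l//.
by rewrite (bigD1 i)//= lerDl; apply: sumr_ge0.
Qed.

Lemma sum_le_enorm v : \sum_(i < n) `|v i ord0| <= n%:R * enorm v.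
Proof.
apply: le_trans (ler_sum _ (fun i _ => enorm_coord v i)) _.
by rewrite sumr_const card_ord mulr_natl.
Qed.

Lemma enorm_le0 v : enorm v <= 0 -> v = 0.
Proof.
move=> v0; apply/colP => i; rewrite mxE; apply/eqP; rewrite -normr_le0.
exact: le_trans (enorm_coord v i) v0.
Qed.

End Enorm.

Section ColumnTopology.
Context {R : realType} {n : nat}.
Implicit Types (x : R -> 'cV[R]_n) (s t : R).

Lemma cvg_colP {T : Type} (F : set_system T) {FF : Filter F} (f : T -> 'cV[R]_n) (v : 'cV[R]_n) :
  f @ F --> v <-> forall i, (fun u => f u i ord0) @ F --> v i ord0.
Proof.
split=> [fv i|fv].
  exact: (@cvg_comp _ _ _ f (fun M : 'cV[R]_n => M i ord0) F _ _ fv (@coord_continuous R n 1 i ord0 v)).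
apply/cvg_ballP => e e0; have : \forall u \near F, forall i : 'I_n, ball (v i ord0) e (f u i ord0).
  by apply: filter_forall => i; have /cvg_ballP/(_ _ e0) := fv i.
apply: filterS => u H; split=> // i j; rewrite (ord1 j); exact: H.
Qed.

Lemma continuous_colP x : continuous x <-> forall i, continuous (fun t => x t i ord0).
Proof.
split=> [cx i t|cx t]; first by have /cvg_colP/(_ i) := cx t.
by apply/cvg_colP => i; exact: cx.
Qed.

Lemma is_derive_colP x t (v : 'cV[R]_n) : is_derive t 1 x v <->
  forall i, is_derive t 1 (fun u => x u i ord0) (v i ord0).
Proof.
have E i h : (h^-1 *: ((x \o shift t) (h *: 1) - x t)) i ord0 =
   h^-1 *: (((fun u => x u i ord0) \o shift t) (h *: 1) - x t i ord0) by rewrite !mxE.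
split=> [[dx <-] i|H].
  have C : (fun h => h^-1 *: (((fun u => x u i ord0) \o shift t) (h *: 1) - x t i ord0)) @ 0^'
      --> ('D_1 x t) i ord0.
    have /cvg_colP/(_ i) : (fun h => h^-1 *: ((x \o shift t) (h *: 1) - x t)) @ 0^' --> 'D_1 x t by exact: dx.
    by under eq_fun do rewrite E.
  split; first by apply/cvg_ex; eexists; exact: C.
  by apply: cvg_lim => //; exact: norm_hausdorff.
have C : (fun h => h^-1 *: ((x \o shift t) (h *: 1) - x t)) @ 0^' --> v.
  apply/cvg_colP => i; under eq_fun do rewrite E.
  by have [dx <-] := H i; exact: dx.
split; first by apply/cvg_ex; exists v.
by apply: cvg_lim => //; exact: norm_hausdorff.
Qed.

Lemma continuous_enormP x : continuous x <-> forall t e, 0 < e ->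
  exists2 d, 0 < d & forall u, `|u - t| < d -> enorm (x u - x t) < e.
Proof.
split=> [/continuous_colP cx t e e0|H].
  have : \forall u \near t, forall i : 'I_n, `|x t i ord0 - x u i ord0| < e / n.+1%:R.
    apply: (@filter_forall _ 'I_n (fun i u => `|x t i ord0 - x u i ord0| < e / n.+1%:R) (nbhs t)) => i; have /cvgrPdist_lt := cx i t; apply.
    by rewrite divr_gt0.
  move=> /nbhs_ballP[d /= d0 Hd]; exists d => // u ud.
  have /Hd H : ball t d u by rewrite /ball/= distrC.
  apply: le_lt_trans (enorm_le_sum _) _.
  apply: (@le_lt_trans _ _ (\sum_(i < n) (e / n.+1%:R))).
    by apply: ler_sum => i _; rewrite !mxE distrC ltW.
  rewrite sumr_const card_ord -[ltLHS]mulr_natl mulrCA gtr_pMr// ltr_pdivrMr// mul1r ltr_nat.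
  exact: ltnSn.
apply/continuous_colP => i t; apply/cvgrPdist_lt => e e0.
have [d d0 Hd] := H t e e0; apply/nbhs_ballP; exists d => //= u; rewrite /ball/= distrC => /Hd.
by apply: le_lt_trans; have := enorm_coord (x u - x t) i; rewrite !mxE distrC.
Qed.

Lemma continuous_enorm x : continuous x -> continuous (fun t => enorm (x t)).
Proof.
move=> /continuous_enormP cx t; apply/cvgrPdist_lt => e e0.
have [d d0 Hd] := cx t e e0; apply/nbhs_ballP; exists d => //= u; rewrite /ball/= distrC => /Hd.
apply: le_lt_trans; rewrite ler_norml; apply/andP; split.
  rewrite lerNl opprB lerBlDr; have := enormD (x u - x t) (x t).
  by rewrite subrK.
by rewrite lerBlDr enormBC; have := enormD (x t - x u) (x u); rewrite subrK.
Qed.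

Lemma continuous_enorm_bounded a b x : continuous x ->
  exists2 B, 0 <= B & forall t, a <= t <= b -> enorm (x t) <= B.
Proof.
move=> cx; have [ab|ba] := leP a b; last first.
  exists 0 => // t /andP[at' tb]; have := le_trans at' tb.
  by rewrite leNgt ba.
have [c cab H] := @EVT_max R _ a b ab (continuous_subspaceT (continuous_enorm cx)).
by exists (enorm (x c)) => [|t atb]; [exact: enorm_ge0|apply: H; rewrite in_itv].
Qed.

Lemma abs_cont_onP a b x : abs_cont_on a b x <-> forall i, acont a b (fun t => x t i ord0).
Proof.
split=> [cx i e e0|cx e e0].
  have [d d0 H] := cx e e0; exists d => // I aI pI SI.
  apply: le_lt_trans (H I aI pI SI); apply: ler_sum => p _.
  by have := enorm_coord (x p.2 - x p.1) i; rewrite !mxE.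
have e1 : 0 < e / n.+1%:R by rewrite divr_gt0.
have /choice[d Hd] i : exists d, 0 < d /\ forall I : seq (R * R),
      all (fun p => [&& a <= p.1, p.1 <= p.2 & p.2 <= b]) I ->
      pairwise (fun p q => (p.2 <= q.1) || (q.2 <= p.1)) I ->
      \sum_(p <- I) (p.2 - p.1) < d ->
      \sum_(p <- I) `|x p.2 i ord0 - x p.1 i ord0| < e / n.+1%:R.
  by have [d d0 H] := cx i _ e1; exists d.
exists (\big[Num.min/1]_(i < n) d i) => [|I aI pI SI].
  by apply/bigmin_gtP; split => // i _; have [] := Hd i.
apply: le_lt_trans (ler_sum _ (fun p _ => enorm_le_sum (x p.2 - x p.1))) _.
rewrite exchange_big/=.
apply: (@le_lt_trans _ _ (\sum_(i < n) (e / n.+1%:R))).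
  apply: ler_sum => i _; have [di0 H] := Hd i; apply: ltW; apply: le_lt_trans (H I aI pI _).
    by apply: ler_sum => p _; rewrite !mxE.
  by apply: lt_le_trans SI _; apply: bigmin_le_cond.
rewrite sumr_const card_ord -[ltLHS]mulr_natl mulrCA gtr_pMr// ltr_pdivrMr// mul1r ltr_nat.
exact: ltnSn.
Qed.

Definition clamp (a b t : R) : R := Num.max a (Num.min t b).

Lemma clamp_itv a b t : a <= b -> a <= clamp a b t <= b.
Proof.
move=> ab; rewrite /clamp le_max lexx/= ge_max ab/= ge_min lexx orbT.
by [].
Qed.

Lemma clamp_id a b t : a <= t <= b -> clamp a b t = t.
Proof. by move=> /andP[at' tb]; rewrite /clamp (min_idPl tb) (max_idPr at'). Qed.

Lemma continuous_clamp a b : continuous (clamp a b).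
Proof.
move=> t; apply: (@continuous_max R R (fun=> a) (fun t => Num.min t b)).
  exact: cvg_cst.
by apply: (@continuous_min R R (fun t => t) (fun=> b)); [exact: cvg_id|exact: cvg_cst].
Qed.

(** Turns continuity on a segment, as in the definition of states and of initial
    value problems, into continuity on the line. *)
Lemma continuous_comp_clamp a b x : a <= b -> {within `[a, b], continuous x} ->
  continuous (x \o clamp a b).
Proof.
move=> ab cx t; have cab : `[a, b]%classic (clamp a b t) by rewrite /= in_itv; exact: clamp_itv.
have H := (subspace_continuousP _ _).1 cx _ cab.
move=> P /H HP.
have K : nbhs t (fun u => `[a, b]%classic (clamp a b u) -> P (x (clamp a b u))).
  exact: (@continuous_clamp a b t _ HP).
change (nbhs t (fun u => P (x (clamp a b u)))).
apply: filterS K => u; apply; rewrite /= in_itv; exact: clamp_itv.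
Qed.

End ColumnTopology.

(** * Integrals of vector-valued functions *)

Section VectorIntegral.
Context {R : realType} {n : nat}.
Local Notation mu := (@lebesgue_measure R).
Implicit Types (f g : R -> 'cV[R]_n) (s t u c : R).

Definition vlocint f : Prop := forall i, locint (fun u => f u i ord0).

Definition vint s t f : 'cV[R]_n :=
  \col_i integral_from_to s t (fun u => f u i ord0).

Lemma vlocint_ae f g : vlocint g -> {ae mu, forall u, f u = g u} -> vlocint f.
Proof. by move=> lg fg i; apply: locint_ae (lg i) _; apply: ae_imp fg => u ->. Qed.

Lemma vlocintD f g : vlocint f -> vlocint g -> vlocint (fun u => f u + g u).
Proof.
move=> lf lg i; rewrite (_ : (fun u => _) = fun u => f u i ord0 + g u i ord0).
  exact: locintD.
by apply/funext => u; rewrite mxE.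
Qed.

Lemma vlocintZ c f : vlocint f -> vlocint (fun u => c *: f u).
Proof.
move=> lf i; rewrite (_ : (fun u => _) = fun u => c * f u i ord0).
  exact: locintZ.
by apply/funext => u; rewrite mxE.
Qed.

Lemma vlocintB f g : vlocint f -> vlocint g -> vlocint (fun u => f u - g u).
Proof.
move=> lf lg i; rewrite (_ : (fun u => _) = fun u => f u i ord0 - g u i ord0).
  exact: locintB.
by apply/funext => u; rewrite !mxE.
Qed.

Lemma vlocint0 : vlocint (fun=> 0).
Proof. by move=> i; rewrite (_ : (fun u => _) = cst 0);[exact: locint_cst|apply/funext => u; rewrite mxE]. Qed.

Lemma vlocint_continuous f : continuous f -> vlocint f.
Proof. by move=> /continuous_colP cf i; exact: locint_continuous. Qed.

Lemma vint_ae s t f g : vlocint g -> {ae mu, forall u, f u = g u} ->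
  vint s t f = vint s t g.
Proof.
move=> lg fg; apply/colP => i; rewrite !mxE; apply: int_eq_ae => //.
by apply: ae_imp fg => u ->.
Qed.

Lemma vintD s t f g : vlocint f -> vlocint g ->
  vint s t (fun u => f u + g u) = vint s t f + vint s t g.
Proof.
move=> lf lg; apply/colP => i; rewrite !mxE -intD//.
by congr integral_from_to; apply/funext => u; rewrite mxE.
Qed.

Lemma vintZ s t c f : vlocint f -> vint s t (fun u => c *: f u) = c *: vint s t f.
Proof.
move=> lf; apply/colP => i; rewrite !mxE -intZ//.
by congr integral_from_to; apply/funext => u; rewrite mxE.
Qed.

Lemma vintB s t f g : vlocint f -> vlocint g ->
  vint s t (fun u => f u - g u) = vint s t f - vint s t g.
Proof.
move=> lf lg; apply/colP => i; rewrite !mxE -intB//.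
by congr integral_from_to; apply/funext => u; rewrite !mxE.
Qed.

Lemma vint0 s t : vint s t (fun=> 0) = 0.
Proof.
apply/colP => i; rewrite !mxE.
exact: int0.
Qed.

Lemma vint_cat s t u f : vlocint f -> s <= t -> t <= u ->
  vint s u f = vint s t f + vint t u f.
Proof. by move=> lf st tu; apply/colP => i; rewrite !mxE; exact: int_cat. Qed.

Lemma enorm_vint_le s t f (w : R -> R) : vlocint f -> locint w ->
  {ae mu, forall u, s <= u <= t -> \sum_(i < n) `|f u i ord0| <= w u} ->
  enorm (vint s t f) <= integral_from_to s t w.
Proof.
move=> lf lw fw; apply: le_trans (enorm_le_sum _) _.
have ls : locint (fun u => \sum_(i < n) `|f u i ord0|).
  by apply: locint_sum => i; exact/locint_norm/lf.
apply: le_trans (int_le ls lw fw).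
rewrite int_sum; last by move=> i; exact/locint_norm/lf.
by apply: ler_sum => i _; rewrite mxE; exact: int_norm.
Qed.

Lemma locint_enorm f : vlocint f -> locint (fun u => enorm (f u)).
Proof.
move=> lf; have /choice[g Hg] i : exists g : R -> R, borel_locint g /\ {ae mu, forall u, f u i ord0 = g u}.
  by have [g bg fg] := lf i; exists g.
apply: (@locint_dominated _ _ (fun u => Num.sqrt (\sum_(i < n) g i u ^+ 2))
  (fun u => \sum_(i < n) `|f u i ord0|)).
- apply: (@measurableT_comp _ _ _ R R R (@Num.sqrt R)); first exact: (continuous_measurable_fun (@sqrt_continuous R)).
  by apply: measurable_sum => i; apply: measurable_funX; have [[]] := Hg i.
- have : {ae mu, forall u, forall k : nat, if insub k is Some i then f u i ord0 = g i u else True}.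
    apply: ae_foralln => k; case: insubP => [i _ _|_]; first exact: (Hg i).2.
    exact: aeW.
  apply: ae_imp => u H; rewrite /enorm; congr Num.sqrt; apply: eq_bigr => i _.
  by have := H i; rewrite valK => ->.
- by apply: locint_sum => i; exact/locint_norm/lf.
by apply: aeW => u; rewrite ger0_norm ?enorm_ge0// enorm_le_sum.
Qed.

(** The factor [n] comes from bounding the Euclidean norm by the sum of the
    coordinates. *)
Lemma enorm_vint s t f : vlocint f ->
  enorm (vint s t f) <= n%:R * integral_from_to s t (fun u => enorm (f u)).
Proof.
move=> lf; rewrite -intZ; last exact: locint_enorm.
apply: enorm_vint_le => //; first exact/locintZ/locint_enorm.
by apply: aeW => u _; exact: sum_le_enorm.
Qed.

Lemma ae_forall_ord (P : 'I_n -> R -> Prop) :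
  (forall i, {ae mu, forall t, P i t}) -> {ae mu, forall t, forall i, P i t}.
Proof.
move=> H; have : {ae mu, forall t, forall k : nat, if insub k is Some i then P i t else True}.
  apply: ae_foralln => k; case: insubP => [i _ _|_]; first exact: H.
  exact: aeW.
by apply: ae_imp => t K i; have := K i; rewrite valK.
Qed.

Lemma is_derive_vint s f : vlocint f ->
  {ae mu, forall t, s < t -> is_derive t 1 (fun t => vint s t f) (f t)}.
Proof.
move=> lf; have := ae_forall_ord (fun i => is_derive_int s (lf i)).
apply: ae_imp => t H st; apply/is_derive_colP => i.
have := H i st; congr (is_derive _ _ _ _).
by apply/funext => u; rewrite mxE.
Qed.

Lemma abs_cont_vint a b x f : a <= b -> abs_cont_on a b x -> vlocint f ->
  {ae mu, forall t, a < t < b -> is_derive t 1 x (f t)} -> x b - x a = vint a b f.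
Proof.
move=> ab /abs_cont_onP cx lf dx; apply/colP => i; rewrite !mxE.
apply: (acont_int_derive ab (cx i) (lf i)); apply: ae_imp dx => t H atb.
by have /is_derive_colP := H atb.
Qed.

End VectorIntegral.

(** * The state space of continuous functions on [-r, 0] *)

Section Cseg.
Context {R : realType} {r : R} {n : nat}.
Context (r0 : 0 <= r).
Implicit Types (phi psi : Cseg r n) (x y : R -> 'cV[R]_n) (t theta c : R).

Lemma CsegD phi psi theta : (phi + psi) theta = phi theta + psi theta.
Proof. by []. Qed.

Lemma CsegZ c phi theta : (c *: phi) theta = c *: phi theta.
Proof. by []. Qed.

Lemma CsegB phi psi theta : (phi - psi) theta = phi theta - psi theta.
Proof. by []. Qed.

Lemma Cseg0 theta : (0 : Cseg r n) theta = 0.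
Proof. by []. Qed.

Lemma Cseg_out phi theta : ~ (- r <= theta <= 0) -> phi theta = 0.
Proof.
case: phi => f /= fP; have /set_mem[_ ->] := fP.
by move=> h; rewrite /patch memNset//= in_itv.
Qed.

Lemma Cseg_ext phi psi : (forall theta, - r <= theta <= 0 -> phi theta = psi theta) ->
  phi = psi.
Proof.
move=> H; apply: val_inj => /=; apply/funext => t.
have [h|h] := pselect (- r <= t <= 0); first exact: H.
by rewrite !Cseg_out.
Qed.

Lemma Cseg_within phi : {within `[- r, 0], continuous phi}.
Proof. by case: phi => f /= fP; have /set_mem[] := fP. Qed.

(** Continuous on the whole line, unlike the extension by zero that [Cseg]
    carries. *)
Definition Cseg_extend phi t : 'cV[R]_n := phi (clamp (- r) 0 t).

Lemma continuous_Cseg_extend phi : continuous (Cseg_extend phi).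
Proof. by apply: continuous_comp_clamp; [rewrite oppr_le0|exact: Cseg_within]. Qed.

Lemma Cseg_extendE phi theta : - r <= theta <= 0 -> Cseg_extend phi theta = phi theta.
Proof. by move=> h; rewrite /Cseg_extend clamp_id. Qed.

Lemma segmentE x t theta : continuous x -> - r <= theta <= 0 ->
  segment r x t theta = x (t + theta).
Proof.
move=> cx h; rewrite /segment.
have xP : patch (fun=> 0) `[- r, 0] (fun theta => x (t + theta)) \in Cseg_pred r n.
  apply/mem_set; split.
    apply: (@subspace_eq_continuous _ _ _ (fun theta => x (t + theta))).
      by move=> u uI; rewrite /from_subspace /patch ifT.
    apply: continuous_subspaceT => u; apply: (@continuous_comp _ _ _ (fun u => t + u) x); last exact: cx.
    by apply: cvgD; [exact: cvg_cst|exact: cvg_id].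
  by apply/funext => u; rewrite  /patch; case: ifP => // _; rewrite /patch.
by rewrite -[LHS]/(val (insubd _ _) theta) insubdK// /patch mem_set//= in_itv.
Qed.

Lemma segment_ext x y t : (forall u, t - r <= u <= t -> x u = y u) ->
  segment r x t = segment r y t.
Proof.
move=> xy; rewrite /segment; congr insubd; apply/funext => u; rewrite  /patch.
case: ifP => //; rewrite inE/= in_itv/= => /andP[h1 h2]; apply: xy.
by apply/andP; split; lra.
Qed.

Lemma segment0 t : segment r (fun=> 0) t = 0 :> Cseg r n.
Proof. by apply: Cseg_ext => u h; rewrite segmentE//; exact: cst_continuous. Qed.

Lemma segmentD x y t : continuous x -> continuous y ->
  segment r (fun u => x u + y u) t = segment r x t + segment r y t.
Proof.
move=> cx cy; apply: Cseg_ext => u h; rewrite CsegD !segmentE//.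
by move=> v; apply: cvgD; [exact: cx|exact: cy].
Qed.

Lemma segmentB x y t : continuous x -> continuous y ->
  segment r (fun u => x u - y u) t = segment r x t - segment r y t.
Proof.
move=> cx cy; apply: Cseg_ext => u h; rewrite CsegB !segmentE//.
by move=> v; apply: cvgB; [exact: cx|exact: cy].
Qed.

Lemma segmentZ c x t : continuous x ->
  segment r (fun u => c *: x u) t = c *: segment r x t.
Proof.
move=> cx; apply: Cseg_ext => u h; rewrite CsegZ !segmentE//.
by move=> v; apply: cvgZl_tmp; exact: cx.
Qed.

Lemma segment_Cseg_extend phi s : segment r (fun u => Cseg_extend phi (u - s)) s = phi.
Proof.
apply: Cseg_ext => u h; rewrite segmentE//; first by rewrite addrC addKr Cseg_extendE.
move=> v; apply: (@continuous_comp _ _ _ (fun u => u - s) (Cseg_extend phi)).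
  by apply: cvgB; [exact: cvg_id|exact: cvg_cst].
exact: continuous_Cseg_extend.
Qed.

Lemma cnorm_has_sup phi : has_sup [set enorm (phi theta) | theta in `[- r, 0]].
Proof.
split; first by exists (enorm (phi 0)), 0 => //=; rewrite in_itv/= oppr_le0 r0 lexx.
have [B _ HB] := continuous_enorm_bounded (- r) 0 (continuous_Cseg_extend (phi := phi)).
exists B => _ [u /= uI <-]; rewrite in_itv in uI.
by rewrite -(Cseg_extendE _ uI); exact: HB.
Qed.

Lemma enorm_le_cnorm phi theta : - r <= theta <= 0 -> enorm (phi theta) <= cnorm phi.
Proof.
move=> h; apply: ub_le_sup; first exact: (cnorm_has_sup phi).2.
by exists theta => //=; rewrite in_itv.
Qed.

Lemma cnorm_le phi c : (forall theta, - r <= theta <= 0 -> enorm (phi theta) <= c) ->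
  cnorm phi <= c.
Proof.
move=> H; apply: ge_sup; first exact: (cnorm_has_sup phi).1.
by move=> _ [u /= uI <-]; apply: H; rewrite in_itv in uI.
Qed.

Lemma cnorm_ge0 phi : 0 <= cnorm phi.
Proof.
apply: le_trans (enorm_ge0 (phi 0)) (enorm_le_cnorm _ _).
by rewrite oppr_le0 r0 lexx.
Qed.

Lemma cnorm_le0 phi : cnorm phi <= 0 -> phi = 0.
Proof.
move=> p0; apply: Cseg_ext => u h; apply: enorm_le0.
exact: le_trans (enorm_le_cnorm _ h) p0.
Qed.

Lemma cnorm0 : cnorm (0 : Cseg r n) = 0.
Proof.
apply/eqP; rewrite eq_le cnorm_ge0 andbT; apply: cnorm_le => u _.
by rewrite Cseg0 enorm0.
Qed.

Lemma cnormD phi psi : cnorm (phi + psi) <= cnorm phi + cnorm psi.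
Proof.
apply: cnorm_le => u h; rewrite CsegD (le_trans (enormD _ _))//.
by rewrite lerD// enorm_le_cnorm.
Qed.

Lemma cnormZ_le c phi : cnorm (c *: phi) <= `|c| * cnorm phi.
Proof.
by apply: cnorm_le => u h; rewrite CsegZ enormZ ler_wpM2l// enorm_le_cnorm.
Qed.

Lemma cnormZ c phi : cnorm (c *: phi) = `|c| * cnorm phi.
Proof.
apply/eqP; rewrite eq_le cnormZ_le/=.
have [->|c0] := eqVneq c 0; first by rewrite normr0 mul0r cnorm_ge0.
rewrite -ler_pdivlMl ?normr_gt0// -normfV.
by apply: le_trans (cnormZ_le _ _); rewrite scalerA mulVf// scale1r.
Qed.

Lemma cnormN phi : cnorm (- phi) = cnorm phi.
Proof. by rewrite -scaleN1r cnormZ normrN1 mul1r. Qed.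

Lemma cnorm_segment_le x t c : continuous x ->
  (forall u, t - r <= u <= t -> enorm (x u) <= c) -> cnorm (segment r x t) <= c.
Proof.
move=> cx H; apply: cnorm_le => u h; rewrite segmentE//; apply: H.
by move: h => /andP[h1 h2]; apply/andP; split; lra.
Qed.

Lemma enorm_le_segment x t u : continuous x -> t - r <= u <= t ->
  enorm (x u) <= cnorm (segment r x t).
Proof.
move=> cx /andP[h1 h2].
have h : - r <= u - t <= 0 by apply/andP; split; lra.
have := enorm_le_cnorm (segment r x t) h.
by rewrite segmentE// addrC subrK.
Qed.

Lemma opnorm_le_bound {W : Type} (nW : W -> R) (A : Cseg r n -> W) K :
  (forall phi, nW (A phi) <= K * cnorm phi) -> 0 <= K ->
  (opnorm cnorm nW A <= K%:E)%E.
Proof.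
move=> H K0; apply: ge_ereal_sup => _ [v /= v1 <-]; rewrite lee_fin.
by apply: le_trans (H v) _; rewrite ler_piMr.
Qed.

(** Scale [phi] to norm 1; a state of norm 0 is 0. *)
Lemma bound_opnorm {W : Type} (nW : W -> R) (A : Cseg r n -> W) K :
  (forall c phi, 0 < c -> nW (A (c *: phi)) = c * nW (A phi)) ->
  nW (A 0) = 0 ->
  (opnorm cnorm nW A <= K%:E)%E -> forall phi, nW (A phi) <= K * cnorm phi.
Proof.
move=> HA A0 HK phi.
have [p0|p0] := leP (cnorm phi) 0.
  by rewrite (cnorm_le0 p0) A0 cnorm0 mulr0.
have := HA (cnorm phi)^-1 phi; rewrite invr_gt0 => /(_ p0) E.
rewrite -ler_pdivrMr// mulrC -E -lee_fin; apply: le_trans HK.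
apply: ereal_sup_ubound; exists ((cnorm phi)^-1 *: phi) => //=.
by rewrite cnormZ ger0_norm ?invr_ge0 ?(ltW p0)// mulVf// gt_eqF.
Qed.

End Cseg.

(** * Riemann-Stieltjes integrals *)

Section UniformContinuity.
Context {R : realType}.

(** Stated for an abstract pseudo-distance, to serve scalar and vector-valued
    functions alike. *)
Lemma compact_uniform (D : R -> R -> R) (a b e : R) :
  (forall x y, D x y = D y x) -> (forall x y z, D x z <= D x y + D y z) ->
  (forall x e, 0 < e -> exists2 d, 0 < d & forall u, `|u - x| < d -> D u x < e) ->
  0 < e -> exists2 d, 0 < d & forall x y, a <= x <= b -> `|y - x| < d -> D y x < e.
Proof.
move=> Dsym Dtri Dloc e0.
have /compact_near_coveringP cov := @segment_compact R a b.
have := cov R (0 : R)^'+ (fun d x => forall y, `|y - x| < d -> D y x < e) _.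
move=> /(_ _)[].
  move=> x _; have e20 : 0 < e / 2 by rewrite divr_gt0.
  have [d d0 Hd] := Dloc x _ e20.
  have d20 : 0 < d / 2 by rewrite divr_gt0.
  exists (ball x (d / 2), [set h | 0 < h < d / 2]) => /=.
    split; first exact: nbhsx_ballx.
    near=> h; apply/andP; split; first by near: h; exact: nbhs_right_gt.
    by near: h; exact: nbhs_right_lt.
  move=> [x' h] /= [xx' /andP[h0 hd]] y yx'.
  have x'x : D x' x < e / 2.
    by apply: Hd; move: xx'; rewrite /ball/= distrC => xx'; lra.
  have yx : D y x < e / 2.
    apply: Hd; have := ler_distD x' y x; move: xx'; rewrite /ball/= (distrC x x') => xx' H; lra.
  have := Dtri y x x'; rewrite (Dsym x x') => H; lra.
move=> d /= d0 H; exists (d / 2) => [|x y xab yx]; first by rewrite divr_gt0.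
apply: (H (d / 2)) => //=; rewrite ?in_itv//= ?divr_gt0// sub0r normrN ger0_norm ?divr_ge0 ?(ltW d0)//.
by rewrite gtr_pMr// invf_lt1// ltr1n.
Unshelve. all: by end_near. Qed.

Lemma continuous_uniform (f : R -> R) (a b e : R) : continuous f -> 0 < e ->
  exists2 d, 0 < d & forall x y, a <= x <= b -> `|y - x| < d -> `|f y - f x| < e.
Proof.
move=> cf; apply: compact_uniform => [x y|x y z|x d d0]; [exact: distrC|exact: ler_distD|].
have /cvgrPdist_lt/(_ _ d0)/nbhs_ballP[h /= h0 H] := cf x; exists h => // u.
by rewrite distrC => /H; rewrite distrC.
Qed.

Lemma continuous_enorm_uniform {n : nat} (x : R -> 'cV[R]_n) (a b e : R) : continuous x -> 0 < e ->
  exists2 d, 0 < d & forall s t, a <= s <= b -> `|t - s| < d -> enorm (x t - x s) < e.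
Proof.
move=> /continuous_enormP cx; apply: compact_uniform => [s t|s t u|s d d0]; last exact: cx.
  exact: enormBC.
by apply: le_trans (enormD _ _); rewrite addrA subrK.
Qed.

Lemma continuous_bounded_on (f : R -> R) (a b : R) : continuous f ->
  exists2 B, 0 <= B & forall t, a <= t <= b -> `|f t| <= B.
Proof.
move=> cf; have := @continuous_enorm_bounded R 1 a b (fun t => const_mx (f t)).
case=> [|B B0 H]; first by apply/continuous_colP => i; under eq_fun do rewrite mxE.
exists B => // t /H; apply: le_trans; have := enorm_coord (const_mx (f t) : 'cV[R]_1) ord0.
by rewrite !mxE.
Qed.

End UniformContinuity.

Section RiemannStieltjes.
Context {R : realType}.
Implicit Types (g f : R -> R) (a b : R).
Local Notation int := integral_from_to.
Local Notation mu := (@lebesgue_measure R).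

Lemma itv_partition_step a b (s : seq R) i : itv_partition a b s -> (i < size s)%N ->
  nth b (a :: s) i < nth b (a :: s) i.+1.
Proof. by move=> [/(pathP b) H _] /H. Qed.

Lemma fine_partition a b d : a < b -> 0 < d -> exists2 s, itv_partition a b s &
  forall i, (i < size s)%N -> nth b (a :: s) i.+1 - nth b (a :: s) i < d.
Proof.
move=> ab d0; pose N := (Num.truncn ((b - a) / d)).+1.
have hN : (b - a) / N%:R < d.
  rewrite ltr_pdivrMr ?ltr0n// mulrC -ltr_pdivrMr//; exact: truncnS_gt.
pose p i := a + i%:R * ((b - a) / N%:R).
pose s := mkseq (fun i => p i.+1) N.
have step : 0 < (b - a) / N%:R by rewrite divr_gt0 ?subr_gt0 ?ltr0n.
have pE i : (i <= N)%N -> nth b (a :: s) i = p i.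
  case: i => [|i] iN /=; first by rewrite /p mul0r addr0.
  by rewrite nth_mkseq.
have pS i : p i.+1 - p i = (b - a) / N%:R by rewrite /p -natr1; ring.
exists s; last by move=> i; rewrite size_mkseq => iN; rewrite !pE ?(ltnW iN)// pS.
split; last first.
  have sN : size s = N := size_mkseq _ _.
  have H : nth b (a :: s) (size s) = last a s := nth_last b (a :: s).
  rewrite -H sN (pE _ (leqnn _)).
  by rewrite /p mulrC divfK ?pnatr_eq0// addrC subrK.
apply/(pathP b) => i; rewrite size_mkseq => iN.
have -> : nth b s i = p i.+1 by rewrite nth_mkseq.
by rewrite pE ?(ltnW iN)// -subr_gt0 pS.
Qed.

(** With the generalized inverse ginv y = sup {x | g x < y}, the Stieltjes
    integral is the Lebesgue integral of f (ginv y) over [g a, g b]. Over one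
    interval of a partition, ginv y stays in that interval, so the sum differs
    from the integral by at most the oscillation of [f] times g b - g a. *)
Lemma RS_monotone a b g f : a < b -> {in `[a, b] &, {homo g : x y / x <= y}} ->
  continuous f -> exists J, forall e, 0 < e -> exists2 d, 0 < d &
    forall s c, itv_partition a b s ->
      (forall i, (i < size s)%N -> [/\ nth b (a :: s) i.+1 - nth b (a :: s) i < d,
          nth b (a :: s) i <= c i & c i <= nth b (a :: s) i.+1]) ->
      `|\sum_(0 <= i < size s) (g (nth b (a :: s) i.+1) - g (nth b (a :: s) i)) * f (c i) - J| <= e.
Proof.
move=> ab gnd cf.
have gle x y : a <= x -> x <= y -> y <= b -> g x <= g y.
  by move=> ax xy yb; apply: gnd; rewrite ?in_itv/= ?ax ?yb ?(le_trans ax)// (le_trans xy).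
pose S y := [set x | x = a \/ (a <= x <= b /\ g x < y)].
have Sb y x : S y x -> a <= x <= b.
  by move=> [->|[]//]; rewrite lexx ltW.
have supS y : has_sup (S y).
  by split; [exists a; left|exists b => x /Sb/andP[]].
pose ginv y := sup (S y).
have ginv_nd : {homo ginv : x y / x <= y}.
  move=> x y xy; apply: ge_sup; first by exists a; left.
  move=> u Su; apply: ub_le_sup; first exact: (supS y).2.
  by case: Su => [->|[h gu]]; [left|right; split => //; exact: lt_le_trans xy].
have ginv_itv y : a <= ginv y <= b.
  rewrite ub_le_sup/=; [|exact: (supS y).2|by left].
  by apply: ge_sup; [exact: (supS y).1|move=> u /Sb/andP[]].
have ginv_lo u y : a <= u <= b -> g u < y -> u <= ginv y.
  by move=> h gu; apply: ub_le_sup; [exact: (supS y).2|right].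
have ginv_hi v y : a <= v <= b -> y <= g v -> ginv y <= v.
  move=> /andP[av vb] yg; apply: ge_sup; first exact: (supS y).1.
  move=> x [->//|[/andP[ax xb] gx]]; rewrite leNgt; apply/negP => vx.
  by have := gle _ _ av (ltW vx) xb; rewrite leNgt (lt_le_trans gx).
pose phi y := f (ginv y).
have [B B0 HB] := continuous_bounded_on a b cf.
have lphi : borel_locint phi.
  apply: (@borel_locint_dominated _ _ (fun=> B)).
  - apply: (@measurableT_comp _ _ _ R R R f); first exact: continuous_measurable_fun.
    exact: nondecreasing_measurable.
  - by apply: borel_locint_continuous => x; exact: cvg_cst.
  by apply: aeW => y; exact/HB/ginv_itv.
have llphi := borel_locint_locint lphi.
pose F u := int (g a) (g u) phi.
have FB u v c om : a <= u -> u <= v -> v <= b -> (forall x, u <= x <= v -> `|f x - f c| <= om) ->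
    `|(g v - g u) * f c - (F v - F u)| <= om * (g v - g u).
  move=> au uv vb Hom.
  have guv := gle _ _ au uv vb.
  have gau := gle _ _ (lexx a) au (le_trans uv vb).
  rewrite /F (int_cat llphi gau guv).
  have -> : int (g a) (g u) phi + int (g u) (g v) phi - int (g a) (g u) phi = int (g u) (g v) phi by ring.
  rewrite distrC -mulrC -(int_cst (f c) guv) -intB//; last exact: locint_cst.
  have lB : locint (fun u => phi u - f c) by apply: locintB => //; exact: locint_cst.
  apply: le_trans (int_norm _ _ lB) _.
  rewrite -int_cst//; apply: int_le; [exact: locint_norm|exact: locint_cst|].
  exists [set g u]; split => //; first exact: lebesgue_measure_set1.
  move=> y /=; apply: contra_notP => /eqP yu /andP[guy ygv].
  apply: Hom; rewrite ginv_lo ?au ?(le_trans uv)//= ?ginv_hi ?vb ?(le_trans au)//.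
  by rewrite lt_neqAle eq_sym yu.
exists (F b) => e e0.
have gab : 0 <= g b - g a by rewrite subr_ge0 gle// ltW.
have e1 : 0 < e / (g b - g a + 1) by rewrite divr_gt0// ltr_wpDl.
have [d d0 Hd] := continuous_uniform a b cf e1.
exists d => // s c ps Hs.
set p := nth b (a :: s).
have pa : p 0%N = a by [].
have pb : p (size s) = b by exact: itv_partition_nth_size.
have FT : F b = \sum_(0 <= i < size s) (F (p i.+1) - F (p i)).
  by rewrite telescope_sumr// pa pb [X in _ - X]/F intxx subr0.
rewrite FT -sumrB; apply: le_trans (ler_norm_sum _ _ _) _.
apply: (@le_trans _ _ (\sum_(0 <= i < size s) e / (g b - g a + 1) * (g (p i.+1) - g (p i)))).
  rewrite big_nat [leRHS]big_nat; apply: ler_sum => i /andP[_ isz].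
  have [h1 h2 h3] := Hs i isz.
  have ap : a <= p i by apply: itv_partition_nth_ge ps; rewrite ltnW.
  have pb' : p i.+1 <= b by apply: itv_partition_nth_le ps.
  apply: FB => //; first exact: ltW (itv_partition_step ps isz).
  move=> x /andP[px xp]; apply/ltW/Hd.
    by rewrite (le_trans ap h2) (le_trans h3 pb').
  by rewrite -/p in h1 h2 h3; rewrite ltr_norml; apply/andP; split; lra.
rewrite -mulr_sumr telescope_sumr// pa pb -mulrA ger_pMr// mulrC ler_pdivrMr ?mul1r ?lerDl//.
by rewrite ltr_wpDl.
Qed.

(** By the Jordan decomposition, [g] is a difference of nondecreasing functions. *)
Lemma RS_bounded_variation a b g f : a < b -> bounded_variation a b g ->
  continuous f -> exists J, forall e, 0 < e -> exists2 d, 0 < d &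
    forall s c, itv_partition a b s ->
      (forall i, (i < size s)%N -> [/\ nth b (a :: s) i.+1 - nth b (a :: s) i < d,
          nth b (a :: s) i <= c i & c i <= nth b (a :: s) i.+1]) ->
      `|\sum_(0 <= i < size s) (g (nth b (a :: s) i.+1) - g (nth b (a :: s) i)) * f (c i) - J| <= e.
Proof.
move=> ab gbv cf.
have gE := bounded_variation_pos_neg_tvE gbv.
have nneg := fine_neg_tv_nondecreasing gbv.
have npos := fine_neg_tv_nondecreasing (bounded_variationN gbv).
have [J1 H1] := RS_monotone ab npos cf.
have [J2 H2] := RS_monotone ab nneg cf.
exists (J1 - J2) => e e0.
have e20 : 0 < e / 2 by rewrite divr_gt0.
have [d1 d10 {}H1] := H1 _ e20; have [d2 d20 {}H2] := H2 _ e20.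
exists (Num.min d1 d2) => [|s c ps Hs]; first by rewrite lt_min d10.
have Hs1 i : (i < size s)%N -> [/\ nth b (a :: s) i.+1 - nth b (a :: s) i < d1,
          nth b (a :: s) i <= c i & c i <= nth b (a :: s) i.+1].
  by move=> /Hs []; rewrite lt_min => /andP[].
have Hs2 i : (i < size s)%N -> [/\ nth b (a :: s) i.+1 - nth b (a :: s) i < d2,
          nth b (a :: s) i <= c i & c i <= nth b (a :: s) i.+1].
  by move=> /Hs []; rewrite lt_min => /andP[].
have := H1 s c ps Hs1; have := H2 s c ps Hs2.
set S2 := \sum_(0 <= i < _) _; set S1 := \sum_(0 <= i < _) _ => K2 K1.
set S := \sum_(0 <= i < _) _.
have -> : S = S1 - S2.
  rewrite /S /S1 /S2 -sumrB big_nat [RHS]big_nat; apply: eq_bigr => i /andP[_ isz].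
  rewrite -mulrBl; congr (_ * _).
  have i1 : nth b (a :: s) i \in `[a, b].
    rewrite in_itv; apply/andP; split; first exact: (itv_partition_nth_ge (ltnW isz) ps).
    exact: (itv_partition_nth_le (ltnW isz) ps).
  have i2 : nth b (a :: s) i.+1 \in `[a, b].
    rewrite in_itv; apply/andP; split; first exact: (@itv_partition_nth_ge _ _ _ _ _ i.+1 isz ps).
    exact: (@itv_partition_nth_le _ _ _ _ _ i.+1 isz ps).
  by rewrite (gE _ i1) (gE _ i2) /=; ring.
have -> : S1 - S2 - (J1 - J2) = (S1 - J1) - (S2 - J2) by ring.
by rewrite (le_trans (ler_normB _ _))// [e]splitr lerD.
Qed.

End RiemannStieltjes.

(** * The delay operator *)

Section StieltjesOperator.
Context {R : realType} {n : nat}.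
Implicit Types (g : R -> 'M[R]_n) (f h : R -> 'cV[R]_n) (a b : R).

Lemma is_RSint_continuous a b g f : a < b ->
  (forall i j : 'I_n, bounded_variation a b (fun u => g u i j)) ->
  continuous f -> exists v, is_RSint a b g f v.
Proof.
move=> ab gbv cf.
have /choice[J HJ] (ij : 'I_n * 'I_n) := RS_bounded_variation ab (gbv ij.1 ij.2)
  ((continuous_colP f).1 cf ij.2).
exists (\col_k \sum_(j < n) J (k, j)) => e e0.
have e1 : 0 < e / (n * n).+1%:R by rewrite divr_gt0.
have /choice[d Hd] (ij : 'I_n * 'I_n) : exists d, 0 < d /\ forall s c, itv_partition a b s ->
      (forall i, (i < size s)%N -> [/\ nth b (a :: s) i.+1 - nth b (a :: s) i < d,
          nth b (a :: s) i <= c i & c i <= nth b (a :: s) i.+1]) ->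
      `|\sum_(0 <= i < size s) (g (nth b (a :: s) i.+1) ij.1 ij.2 - g (nth b (a :: s) i) ij.1 ij.2)
          * f (c i) ij.2 ord0 - J ij| <= e / (n * n).+1%:R.
  by have [d d0 H] := HJ ij _ e1; exists d.
exists (\big[Num.min/1]_(ij : 'I_n * 'I_n) d ij) => [|s c p ps Hs].
  by apply/bigmin_gtP; split => // ij _; have [] := Hd ij.
have K ij : `|\sum_(0 <= i < size s) (g (p i.+1) ij.1 ij.2 - g (p i) ij.1 ij.2)
          * f (c i) ij.2 ord0 - J ij| <= e / (n * n).+1%:R.
  have [_ H] := Hd ij; apply: H => // i /Hs[h1 h2 h3]; split => //.
  by apply: lt_le_trans h1 _; apply: bigmin_le_cond.
apply: le_lt_trans (enorm_le_sum _) _.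
apply: (@le_lt_trans _ _ (\sum_(k < n) \sum_(j < n) (e / (n * n).+1%:R))); last first.
  rewrite !sumr_const !card_ord -mulrnA -[ltLHS]mulr_natl mulrCA gtr_pMr// ltr_pdivrMr// mul1r ltr_nat.
  exact: ltnSn.
apply: ler_sum => k _; apply: (@le_trans _ _ (\sum_(j < n)
   `|\sum_(0 <= i < size s) (g (p i.+1) k j - g (p i) k j) * f (c i) j ord0 - J (k, j)|)); last first.
  by apply: ler_sum => j _; exact: (K (k, j)).
apply: le_trans (ler_norm_sum _ _ _); rewrite le_eqVlt; apply/orP; left; apply/eqP.
rewrite !mxE summxE sumrB exchange_big/=; congr (`| _ - _|).
by apply: eq_bigr => i _; rewrite mxE; apply: eq_bigr => j _; rewrite !mxE.
Qed.

Lemma is_RSint_unique a b g f v w : a < b -> is_RSint a b g f v -> is_RSint a b g f w -> v = w.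
Proof.
move=> ab Hv Hw; apply/eqP; rewrite -subr_eq0; apply/eqP/enorm_le0/ler_addgt0Pl => e e0.
rewrite addr0; have e20 : 0 < e / 2 by rewrite divr_gt0.
have [d1 d10 H1] := Hv _ e20; have [d2 d20 H2] := Hw _ e20.
have d0 : 0 < Num.min d1 d2 by rewrite lt_min d10.
have [s ps Hs] := fine_partition ab d0.
pose c i := nth b (a :: s) i.
have S i : (i < size s)%N -> [/\ nth b (a :: s) i.+1 - nth b (a :: s) i < Num.min d1 d2,
    nth b (a :: s) i <= c i & c i <= nth b (a :: s) i.+1].
  by move=> h; split; [exact: Hs|exact: lexx|exact/ltW/(itv_partition_step ps)].
have := H1 s c ps; have := H2 s c ps; set X := \sum_(_ <= _ < _) _ => K2 K1.
have -> : v - w = (X - w) - (X - v) by rewrite opprB [RHS]addrC addrA subrK.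
rewrite (le_trans (enormB _ _))// [e]splitr lerD ?ltW//.
  by apply: K2 => i /S[]; rewrite lt_min => /andP[].
by apply: K1 => i /S[]; rewrite lt_min => /andP[].
Qed.

Lemma is_RSint_linear a b g f h v w c : is_RSint a b g f v -> is_RSint a b g h w ->
  is_RSint a b g (fun u => c *: f u + h u) (c *: v + w).
Proof.
move=> Hv Hw e e0.
have e20 : 0 < e / 2 by rewrite divr_gt0.
have e30 : 0 < e / 2 / (`|c| + 1) by rewrite divr_gt0// ltr_wpDl.
have [d1 d10 H1] := Hv _ e30; have [d2 d20 H2] := Hw _ e20.
exists (Num.min d1 d2) => [|s k p ps Hs]; first by rewrite lt_min d10.
have := H1 s k ps; have := H2 s k ps.
rewrite -/p; set Y := \sum_(_ <= _ < _) _; set X := \sum_(_ <= _ < _) _ => K2 K1.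
set Z := \sum_(_ <= _ < _) _.
have -> : Z - (c *: v + w) = c *: (X - v) + (Y - w).
  rewrite scalerBr addrACA opprD; congr (_ + _).
  rewrite /Z /X /Y scaler_sumr -big_split/=; apply: eq_bigr => i _.
  by rewrite mulmxDr -scalemxAr.
rewrite (le_lt_trans (enormD _ _))// [e]splitr ltrD//; last first.
  by apply: K2 => i /Hs[]; rewrite lt_min => /andP[].
rewrite enormZ; have : enorm (X - v) < e / 2 / (`|c| + 1).
  by apply: K1 => i /Hs[]; rewrite lt_min => /andP[].
rewrite ltr_pdivlMr ?ltr_wpDl// => H; apply: le_lt_trans H.
by rewrite mulrC ler_wpM2l ?enorm_ge0// lerDl.
Qed.

Lemma is_RSint_ext a b g f h v : (forall u, a <= u <= b -> f u = h u) ->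
  is_RSint a b g f v -> is_RSint a b g h v.
Proof.
move=> fh H e e0; have [d d0 {}H] := H e e0; exists d => // s c p ps Hs.
have := H s c ps Hs; rewrite -/p; congr (enorm (_ - _) < _).
rewrite big_nat [RHS]big_nat; apply: eq_bigr => i /andP[_ isz].
have [_ h1 h2] := Hs i isz; rewrite fh// (le_trans _ h1) ?(le_trans h2)//.
  exact: (@itv_partition_nth_le _ _ _ _ _ i.+1 isz ps).
exact: (itv_partition_nth_ge (ltnW isz) ps).
Qed.

End StieltjesOperator.

Section SegmentContinuity.
Context {R : realType} {n : nat} {r : R} (r0 : 0 <= r).
Implicit Types (x : R -> 'cV[R]_n) (t : R).

Lemma segment_close x t e : continuous x -> 0 < e -> exists2 d, 0 < d &
  forall u, `|u - t| < d -> cnorm (segment r x u - segment r x t) <= e.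
Proof.
move=> cx e0; have [d d0 H] := continuous_enorm_uniform (t - r) t cx e0.
exists d => // u ut; apply: cnorm_le => // th hth.
rewrite CsegB !segmentE//; apply/ltW/H; first by move: hth => /andP[h1 h2]; apply/andP; split; lra.
by have -> : u + th - (t + th) = u - t by ring.
Qed.

Lemma continuous_cnorm_segment x : continuous x -> continuous (fun t => cnorm (segment r x t)).
Proof.
move=> cx t; apply/cvgrPdist_le => e e0.
have [d d0 Hd] := segment_close t cx e0; apply/nbhs_ballP; exists d => //= u.
rewrite /ball/= distrC => /Hd; apply: le_trans; rewrite ler_norml; apply/andP; split.
  rewrite lerNl opprB lerBlDr; have := cnormD r0 (segment r x u - segment r x t) (segment r x t).
  by rewrite subrK.
rewrite lerBlDr -[cnorm (segment r x u - segment r x t)]cnormN// opprB; have := cnormD r0 (segment r x t - segment r x u) (segment r x u).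
by rewrite subrK.
Qed.

End SegmentContinuity.

Section DelayOperator.
Context {R : realType} {n : nat} {r r0 : R} {eta : R -> R -> 'M[R]_n}.
Context (hr : 0 < r) (hr0 : 0 < r0) (heta : standing_assumptions r r0 eta).
Local Notation mu := (@lebesgue_measure R).
Local Notation int := integral_from_to.
Local Notation L := (delay_op eta).
Implicit Types (x y : R -> 'cV[R]_n) (phi psi : Cseg r n) (t s u c : R).

Let Nr0 : - r < 0. Proof. by rewrite oppr_lt0. Qed.
Let r_ge0 : 0 <= r. Proof. exact: ltW. Qed.

(** States are continuous and [eta t] has bounded variation, so the default value
    in [RSint] is never taken. *)
Lemma delay_opP t phi : is_RSint (- r) 0 (eta t) phi (L t phi).
Proof.
have [v Hv] := is_RSint_continuous Nr0 (sa_bounded_variation heta t) (continuous_Cseg_extend r_ge0 (phi := phi)).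
have Hp : is_RSint (- r) 0 (eta t) phi v.
  by apply: is_RSint_ext Hv => u; exact: Cseg_extendE.
by rewrite /delay_op /RSint; case: xgetP => [w -> //|/(_ v)].
Qed.

Lemma delay_op_linear t c phi psi : L t (c *: phi + psi) = c *: L t phi + L t psi.
Proof.
apply: (is_RSint_unique Nr0 (delay_opP t _)).
exact: (is_RSint_linear c (delay_opP t phi) (delay_opP t psi)).
Qed.

Lemma delay_op0 t : L t (0 : Cseg r n) = 0.
Proof. by have := delay_op_linear t (-1) 0 0; rewrite scaler0 addr0 scaleN1r addNr. Qed.

Lemma delay_opZ t c phi : L t (c *: phi) = c *: L t phi.
Proof. by have := delay_op_linear t c phi 0; rewrite delay_op0 !addr0. Qed.

Lemma delay_opD t phi psi : L t (phi + psi) = L t phi + L t psi.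
Proof. by have := delay_op_linear t 1 phi psi; rewrite !scale1r. Qed.

Lemma delay_opB t phi psi : L t (phi - psi) = L t phi - L t psi.
Proof. by rewrite delay_opD -scaleN1r delay_opZ scaleN1r. Qed.

(** [m] is [n] times a Borel version of the operator norm. Bounding the sum of
    the coordinates is what integrals of vectors need. *)
Lemma delay_op_bound : exists m : R -> R,
  [/\ borel_locint m, (forall t, 0 <= m t),
      {ae mu, forall t, forall phi, \sum_(i < n) `|L t phi i ord0| <= m t * cnorm phi}
    & exists M, forall t, int t (t + r0) m <= M].
Proof.
have [cm fin] := sa_norm_loc_integrable heta.
have [G mG fG] := cmeasurable_borel cm.
have op0 t : (0 <= delay_opnorm r eta t)%E.
  apply: ereal_sup_ubound; exists 0 => /=; first by rewrite cnorm0.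
  by rewrite delay_op0 enorm0.
have iG a b : (\int[mu]_(t in `[a, b]) `|G t| < +oo)%E.
  apply: le_lt_trans (fin a b); rewrite le_eqVlt; apply/orP; left; apply/eqP/esym.
  apply: ge0_ae_eq_integral_any => //.
    by apply: measurableT_comp => //; exact: measurable_funS mG.
  by apply: ae_imp fG => t -> _.
have [bG finG] := ereal_locint mG iG.
pose m0 t := `|fine (G t)|; have bm0 : borel_locint m0 := borel_locint_norm bG.
have aem0 : {ae mu, forall t, delay_opnorm r eta t = (m0 t)%:E}.
  apply: ae_imp (ae_and fG finG) => t [fGt finGt].
  have G0 : (0 <= G t)%E by rewrite -fGt.
  by rewrite /m0 ger0_norm ?fine_ge0// fineK.
exists (fun t => n%:R * m0 t); split.
- exact: borel_locintZ.
- by move=> t; apply: mulr_ge0; [exact: ler0n|exact: normr_ge0].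
- apply: ae_imp aem0 => t Ht phi; apply: le_trans (sum_le_enorm _) _.
  rewrite -mulrA ler_wpM2l//; move: phi.
  apply: bound_opnorm => //.
  - by move=> c phi c0; rewrite delay_opZ enormZ ger0_norm// ltW.
  - by rewrite delay_op0 enorm0.
  by rewrite -Ht.
have [M HM] := sa_norm_bounded heta; exists (n%:R * (r0 * M)) => t.
rewrite intZ; last exact: borel_locint_locint.
rewrite ler_wpM2l//.
have := @ereal_sup_ubound _ _ _ (ex_intro2 _ _ t I erefl : (range (fun t : R => (r0^-1)%:E *
       \int[lebesgue_measure]_(u in `[t, (t + r0)%R]) delay_opnorm r eta u)%E) _).
move=> /le_trans /(_ HM).
rewrite (ge0_ae_eq_integral_any (g := EFin \o m0))//; first last.
- by apply: ae_imp aem0 => u /= -> _.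
- by move=> u _; rewrite lee_fin; exact: normr_ge0.
- by apply/measurable_EFinP; exact: measurable_funS bm0.1.
rewrite (integral_int _ _ (borel_locint_locint bm0) (fun u => normr_ge0 _)).
by rewrite -EFinM lee_fin ler_pdivrMl.
Qed.

End DelayOperator.

Section DelayIntegrand.
Context {R : realType} {n : nat} {r r0 : R} {eta : R -> R -> 'M[R]_n}.
Context (hr : 0 < r) (hr0 : 0 < r0) (heta : standing_assumptions r r0 eta).
Local Notation mu := (@lebesgue_measure R).
Local Notation L := (delay_op eta).
Implicit Types (x y : R -> 'cV[R]_n) (phi psi : Cseg r n) (t s u c : R).

Let r_ge0 : 0 <= r. Proof. exact: ltW. Qed.

Lemma borel_glue (F : int -> R -> R) (N : nat) : (forall k, measurable_fun setT (F k)) ->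
  measurable_fun setT (fun t => F (Num.floor (t * N.+1%:R)) t).
Proof.
move=> mF _ B mB; rewrite setTI.
pose P (k : int) : set R := [set t | k%:~R <= t * N.+1%:R < (k + 1)%:~R].
have -> : (fun t => F (Num.floor (t * N.+1%:R)) t) @^-1` B =
    \bigcup_(k in [set: int]) (P k `&` F k @^-1` B).
  apply/seteqP; split => [t Ft|t [k _ [Pk Fk]]] /=.
    by exists (Num.floor (t * N.+1%:R)) => //; split => //; exact: floor_itv.
  by rewrite (floor_def Pk).
apply: countable_bigcupT_measurable; first exact: countableP.
move=> k; apply: measurableI; last by rewrite -[X in measurable X]setTI; exact: mF.
have -> : P k = `[k%:~R / N.+1%:R, (k + 1)%:~R / N.+1%:R[%classic.
  apply/seteqP; split => t; rewrite /P/= in_itv/= ler_pdivrMr// ltr_pdivlMr//.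
exact: measurable_itv.
Qed.

Lemma delay_op_borel phi i :
  exists2 g : R -> R, measurable_fun setT g & {ae mu, forall t, L t phi i ord0 = g t}.
Proof.
have cm := sa_op_measurable heta phi i.
have /cmeasurable_borel[G mG fG] : cmeasurable mu (EFin \o fun t => L t phi i ord0).
  move=> B mB; have := @EFin_measurable R setT measurableT B mB; rewrite setTI => mB'.
  exact: (cm _ mB').
exists (fine \o G); first exact: measurableT_comp.
by apply: ae_imp fG => t /= <-.
Qed.

Context {m : R -> R} (bm : borel_locint m) (m0 : forall t, 0 <= m t).
Context (Lm : {ae mu, forall t, forall phi, \sum_(i < n) `|L t phi i ord0| <= m t * cnorm phi}).

Lemma borel_locint_mul_continuous (b : R -> R) : continuous b -> borel_locint (fun t => m t * b t).
Proof.
move=> cb; have mb : measurable_fun setT (fun t => m t * b t).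
  by apply: measurable_funM; [exact: bm.1|exact: continuous_measurable_fun].
split => // c d.
have [B B0 HB] := continuous_bounded_on c d cb.
apply: (@le_integrable _ _ _ mu `[c, d] _ _ (fun t => (B * m t)%:E)) => //.
- by apply/measurable_EFinP; exact: measurable_funS mb.
- move=> t /=; rewrite in_itv/= => /HB bt; rewrite lee_fin !normrM (ger0_norm (m0 t)) (ger0_norm B0).
  by rewrite mulrC ler_wpM2r.
by have [_ /(_ c d)] := borel_locintZ B bm.
Qed.

(** For each state, L(t) phi is measurable in t up to a null set that depends on
    the state. Replacing x_t by the state at the last point before t of a grid
    of mesh 1 / (N + 1) involves countably many states only. As N grows, these
    approximations converge, because t |-> x_t is continuous and L(t) is
    bounded. *)
Lemma vlocint_delay x : continuous x -> vlocint (fun t => L t (segment r x t)).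
Proof.
move=> cx i.
have /choice[g Hg] phi : exists g : R -> R, measurable_fun setT g /\ {ae mu, forall t, L t phi i ord0 = g t}.
  by have [g mg fg] := delay_op_borel phi i; exists g.
pose seg (N : nat) (k : int) := segment r x (k%:~R / N.+1%:R).
pose G (N : nat) t := g (seg N (Num.floor (t * N.+1%:R))) t.
have mG N : measurable_fun setT (G N).
  by apply: (borel_glue N (F := fun k => g (seg N k))) => k; have [] := Hg (seg N k).
have GE : {ae mu, forall t, forall N, G N t = L t (seg N (Num.floor (t * N.+1%:R))) i ord0}.
  apply: ae_foralln => N.
  have : {ae mu, forall t, forall j : nat, if unpickle j is Some k then L t (seg N k) i ord0 = g (seg N k) t else True}.
    apply: ae_foralln => j; case: unpickle => [k|]; last exact: aeW.
    by have [] := Hg (seg N k).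
  apply: ae_imp => t H; have := H (pickle (Num.floor (t * N.+1%:R))).
  by rewrite pickleK /G => ->.
pose h t := fine (limn_esup (fun N => (G N t)%:E)).
have mh : measurable_fun setT h.
  apply: measurableT_comp => //; apply: measurable_fun_limn_esup => N.
  exact/measurable_EFinP.
have cb := continuous_cnorm_segment r_ge0 cx.
apply: (@locint_dominated _ _ h (fun t => m t * cnorm (segment r x t))) => //.
- apply: ae_imp (ae_and GE Lm) => t [Gt Lt].
  have C : (fun N => (G N t)%:E) @ \oo --> (L t (segment r x t) i ord0)%:E.
    apply: cvg_EFin; first by apply: nearW.
    apply/cvgrPdist_le => e e0; have me : 0 < e / (m t + 1) by rewrite divr_gt0// ltr_wpDl.
    have [d d0 Hd] := segment_close r_ge0 t cx me.
    near=> N; rewrite /= Gt distrC.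
    have -> : L t (seg N (Num.floor (t * N.+1%:R))) i ord0 - L t (segment r x t) i ord0 =
        L t (seg N (Num.floor (t * N.+1%:R)) - segment r x t) i ord0.
      by rewrite (delay_opB hr heta) !mxE.
    have Hs : cnorm (seg N (Num.floor (t * N.+1%:R)) - segment r x t) <= e / (m t + 1).
      apply: Hd; have /andP[f1 f2] := floor_itv (t * N.+1%:R).
      have N0 : (0 : R) < N.+1%:R by [].
      have hN : N.+1%:R^-1 < d.
        rewrite invf_plt ?posrE//; apply: (@lt_le_trans _ _ N%:R).
          by near: N; exact: nbhs_infty_gtr.
        by rewrite ler_nat.
      rewrite distrC ger0_norm ?subr_ge0 ?ler_pdivrMr//; apply: lt_trans hN.
      rewrite ltrBlDr -[X in _ < X + _]mul1r -mulrDl ltr_pdivlMr// addrC.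
      by rewrite -[1]/(1%:~R) -intrD.
    apply: (@le_trans _ _ (m t * (e / (m t + 1)))).
      apply: (@le_trans _ _ (m t * cnorm (seg N (Num.floor (t * N.+1%:R)) - segment r x t))); last exact: ler_wpM2l.
      apply: le_trans (Lt _); rewrite (bigD1 i)//= lerDl.
      by apply: sumr_ge0.
    by rewrite mulrCA ger_pMr// ler_pdivrMr ?mul1r ?lerDl// ltr_wpDl.
  rewrite /h is_cvg_limn_esupE; last by apply/cvg_ex; eexists; exact: C.
  by rewrite (cvg_lim _ C).
- exact/borel_locint_locint/borel_locint_mul_continuous.
apply: ae_imp Lm => t Lt; apply: le_trans (Lt _); rewrite (bigD1 i)//= lerDl.
by apply: sumr_ge0.
Unshelve. all: by end_near. Qed.

End DelayIntegrand.

(** * Limits of geometrically convergent sequences *)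

Section GeometricLimit.
Context {R : realType}.

Lemma exp2_small (a e : R) : 0 < e -> a / 2 ^+ (Num.truncn (a / e)).+1 <= e.
Proof.
move=> e0; rewrite ler_pdivrMr ?exprn_gt0// -ler_pdivrMl// mulrC.
apply: le_trans (ltW (truncnS_gt _)) _; rewrite -[2 ^+ _]natrX ler_nat.
by rewrite ltnW// ltn_expl.
Qed.

(** The numbers u k - 2 c / 2 ^ k increase, the numbers u k + 2 c / 2 ^ k
    decrease, and the former lie below the latter. *)
Lemma geometric_limit (u : nat -> R) (c : R) : 0 <= c ->
  (forall k, `|u k.+1 - u k| <= c / 2 ^+ k) ->
  forall k, `|sup (range (fun k => u k - 2 * c / 2 ^+ k)) - u k| <= 2 * c / 2 ^+ k.
Proof.
move=> c0 Hu; pose e k := 2 * c / 2 ^+ k.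
have eS k : e k - e k.+1 = c / 2 ^+ k by rewrite /e exprS; field.
have e0 k : 0 <= e k by rewrite /e divr_ge0 ?mulr_ge0.
pose v k := u k - e k; pose w k := u k + e k.
have vS k : v k <= v k.+1.
  have := Hu k; rewrite -eS ler_norml => /andP[h1 h2]; rewrite /v; lra.
have wS k : w k.+1 <= w k.
  have := Hu k; rewrite -eS ler_norml => /andP[h1 h2]; rewrite /w; lra.
have vnd : {homo v : i j / (i <= j)%N >-> i <= j} by apply: homo_leq => //; exact: le_trans.
have wni : {homo w : i j / (i <= j)%N >-> j <= i}.
  by apply: (homo_leq (r := fun x y => y <= x)) => // x y z xy yz; exact: le_trans yz xy.
have vw i j : v i <= w j.
  apply: (@le_trans _ _ (v (maxn i j))); first by apply: vnd; exact: leq_maxl.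
  apply: (@le_trans _ _ (w (maxn i j))); last by apply: wni; exact: leq_maxr.
  by rewrite /v /w; have := e0 (maxn i j); lra.
have hs : has_sup (range v) by split; [exists (v 0%N), 0%N|exists (w 0%N) => _ [i _ <-]; exact: vw].
move=> k; have h1 : v k <= sup (range v) by apply: ub_le_sup; [exact: hs.2|exists k].
have h2 : sup (range v) <= w k by apply: ge_sup; [exact: hs.1|move=> _ [i _ <-]; exact: vw].
by rewrite -/(e k) ler_norml; apply/andP; split; move: h1 h2; rewrite /v /w; lra.
Qed.

(** One limit [F] must satisfy the bound at [t] for every constant [c] valid at
    [t], so that local constants give continuity and a sharper pointwise
    constant gives the weighted estimates. Convergence is uniform on bounded
    sets, hence [F] is continuous. *)
Lemma geometric_limit_continuous {n : nat} (S : nat -> R -> 'cV[R]_n) :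
  (forall k, continuous (S k)) ->
  (forall T, exists2 c, 0 <= c &
     forall k t, `|t| <= T -> enorm (S k.+1 t - S k t) <= c / 2 ^+ k) ->
  exists F : R -> 'cV[R]_n, continuous F /\
    forall t c, 0 <= c -> (forall k, enorm (S k.+1 t - S k t) <= c / 2 ^+ k) ->
      forall k, enorm (F t - S k t) <= n%:R * (2 * c) / 2 ^+ k.
Proof.
move=> cS HS.
have pt t c : 0 <= c -> (forall k, enorm (S k.+1 t - S k t) <= c / 2 ^+ k) -> forall i k,
   `|S k.+1 t i ord0 - S k t i ord0| <= c / 2 ^+ k.
  move=> c0 H i k; apply: le_trans (H k).
  by have := enorm_coord (S k.+1 t - S k t) i; rewrite !mxE.
have /choice[C HC] t : exists c, 0 <= c /\ forall k, enorm (S k.+1 t - S k t) <= c / 2 ^+ k.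
  by have [c c0 H] := HS `|t|; exists c; split => // k; exact: H.
have /choice[F HF] t : exists v : 'cV[R]_n, forall c, 0 <= c ->
    (forall k, enorm (S k.+1 t - S k t) <= c / 2 ^+ k) ->
      forall k, enorm (v - S k t) <= n%:R * (2 * c) / 2 ^+ k.
  have [C0 CS] := HC t.
  pose l := \col_i sup (range (fun k => S k t i ord0 - 2 * (C t) / 2 ^+ k)) : 'cV[R]_n.
  have lP i k : `|l i ord0 - S k t i ord0| <= 2 * C t / 2 ^+ k.
    by rewrite mxE; apply: (geometric_limit C0 (u := fun k => S k t i ord0)); exact: pt.
  exists l => c c0 Hc.
  have l'P i := geometric_limit c0 (pt _ _ c0 Hc i).
  (* both limits coincide: the bounds tend to zero *)
  have E i : l i ord0 = sup (range (fun k => S k t i ord0 - 2 * c / 2 ^+ k)).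
    apply/eqP; rewrite -subr_eq0 -normr_le0; apply/ler_addgt0Pl => e e0.
    rewrite addr0; pose k := (Num.truncn ((2 * C t + 2 * c) / e)).+1.
    have := ler_normB (l i ord0 - S k t i ord0) (sup (range (fun k => S k t i ord0 - 2 * c / 2 ^+ k)) - S k t i ord0).
    rewrite opprB addrA subrK => /le_trans; apply.
    apply: le_trans (lerD (lP i k) (l'P i k)) _.
    by rewrite -mulrDl; exact: exp2_small.
  move=> k; apply: le_trans (enorm_le_sum _) _.
  apply: (@le_trans _ _ (\sum_(i < n) (2 * c / 2 ^+ k))); last by rewrite sumr_const card_ord -[leLHS]mulr_natl mulrA.
  apply: ler_sum => i _; have -> : (l - S k t) i ord0 = l i ord0 - S k t i ord0.
    by rewrite mxE [X in _ + X]mxE.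
  by rewrite E.
exists F; split => //.
apply/continuous_enormP => t e e0.
have [c c0 Hc] := HS (`|t| + 1).
have bd u k : `|u| <= `|t| + 1 -> enorm (F u - S k u) <= n%:R * (2 * c) / 2 ^+ k.
  by move=> ut; apply: HF => // j; exact: Hc.
have e40 : 0 < e / 4 by rewrite divr_gt0.
pose k := (Num.truncn (n%:R * (2 * c) / (e / 4))).+1.
have hk : n%:R * (2 * c) / 2 ^+ k <= e / 4.
  exact: exp2_small.
have [d d0 Hd] := (continuous_enormP (S k)).1 (cS k) t _ e40.
exists (Num.min d 1) => [|u]; first by rewrite lt_min d0 ltr01.
rewrite lt_min => /andP[/Hd h1 ut].
have hu : `|u| <= `|t| + 1.
  by have := ler_normD (u - t) t; rewrite subrK; lra.
have h2 := le_trans (bd u k hu) hk.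
have h3 : enorm (F t - S k t) <= e / 4 by apply: le_trans (bd t k _) hk; rewrite lerDl.
have -> : F u - F t = (F u - S k u) + (S k u - S k t) - (F t - S k t).
  by rewrite addrA subrK opprB addrA subrK.
have := enormB (F u - S k u + (S k u - S k t)) (F t - S k t).
have := enormD (F u - S k u) (S k u - S k t).
lra.
Qed.

End GeometricLimit.

(** * Primitives and the Gronwall weight *)

Section PrimitiveContinuity.
Context {R : realType}.
Local Notation mu := (@lebesgue_measure R).
Local Notation intg := integral_from_to.
Implicit Types (f : R -> R) (s t u : R).

Lemma intg_empty s t f : t < s -> intg s t f = 0.
Proof. by move=> ts; rewrite integral_from_to.unlock set_itv_ge ?Rintegral_set0// bnd_simp leNgt ts. Qed.

Lemma intg_max s t f : intg s t f = intg s (Num.max s t) f.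
Proof.
have [ts|st] := leP t s; last by [].
by rewrite intxx; move: ts; rewrite le_eqVlt => /predU1P[->|/intg_empty//]; rewrite intxx.
Qed.

Lemma continuous_intg s f : locint f -> continuous (fun t => intg s t f).
Proof.
move=> lf t; apply/cvgrPdist_lt => e e0.
have [d d0 Hd] := acont_continuous (acont_int (Num.max s t + 1) lf (lexx s)) e0.
apply/nbhs_ballP; exists (Num.min d 1); rewrite /= ?lt_min ?d0 ?ltr01// => u.
rewrite /ball/= lt_min => /andP[tud tu1].
rewrite (intg_max s t) (intg_max s u); set t' := Num.max s t; set u' := Num.max s u.
have a1 := ler_norm (t - u); have a2 := ler_norm (u - t); rewrite distrC in a2.
have [h1 h2 [h3 h4]] : [/\ s <= t', s <= u' & t' - u' <= `|t - u| /\ u' - t' <= `|t - u|].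
  have a3 := normr_ge0 (t - u).
  by rewrite /t' /u' /Num.max; case: (ltP s t) => ?; case: (ltP s u) => ?; split; try split; lra.
have [tu|ut] := leP t' u'.
  by rewrite distrC; apply: Hd => //; rewrite -/t'; lra.
by apply: Hd; rewrite -/t' ?(ltW ut)//; lra.
Qed.

Lemma continuous_vint {n : nat} s (f : R -> 'cV[R]_n) : vlocint f -> continuous (fun t => vint s t f).
Proof.
move=> lf; apply/continuous_colP => i.
have -> : (fun t => vint s t f i ord0) = fun t => intg s t (fun u => f u i ord0).
  by apply/funext => t; rewrite mxE.
exact: continuous_intg.
Qed.

Lemma vint_empty {n : nat} s t (f : R -> 'cV[R]_n) : t <= s -> vint s t f = 0.
Proof.
move=> ts; apply/colP => i; rewrite !mxE; move: ts; rewrite le_eqVlt => /predU1P[->|/intg_empty//].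
exact: intxx.
Qed.

End PrimitiveContinuity.

(** In this weight the Volterra operator of the delay equation contracts by 1/2,
    see [int_gweight]. *)
HB.lock Definition gweight {R : realType} (m : R -> R) (s t : R) : R :=
  expR (2 * integral_from_to s t m).

Section GronwallWeight.
Context {R : realType} {m : R -> R} (bm : borel_locint m) (m0 : forall t, 0 <= m t).
Local Notation mu := (@lebesgue_measure R).
Local Notation intg := integral_from_to.
Implicit Types (s t u : R).

Let lm : locint m := borel_locint_locint bm.

Lemma gweightE s t : gweight m s t = expR (2 * intg s t m).
Proof. by rewrite gweight.unlock. Qed.

Lemma intg_nd s t u : t <= u -> intg s t m <= intg s u m.
Proof.
move=> tu; have [ts|st] := ltP t s; first by rewrite intg_empty// int_ge0.
exact: int_nd.
Qed.

Lemma gweight_nd s t u : t <= u -> gweight m s t <= gweight m s u.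
Proof. by move=> tu; rewrite !gweightE ler_expR ler_pM2l// intg_nd. Qed.

Lemma gweight_ge1 s t : 1 <= gweight m s t.
Proof. by rewrite gweightE -expR0 ler_expR mulr_ge0// int_ge0. Qed.

Lemma gweight_gt0 s t : 0 < gweight m s t.
Proof. by rewrite gweightE expR_gt0. Qed.

Lemma continuous_gweight s : continuous (gweight m s).
Proof.
move=> t; have -> : gweight m s = fun t => expR (2 * intg s t m) by apply/funext => u; rewrite gweightE.
apply: (@continuous_comp _ _ _ (fun t => 2 * intg s t m) expR); last exact: continuous_expR.
by apply: cvgM; [exact: cvg_cst|exact: (@continuous_intg R s m lm t)].
Qed.

(** m W is the derivative of W / 2. *)
Lemma int_gweight s t : s <= t -> intg s t (fun u => m u * gweight m s u) <= gweight m s t / 2.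
Proof.
move=> st; pose F u := gweight m s u / 2.
have aF : acont s t F.
  apply: (@acont_lipschitz _ _ _ (fun u => intg s u m) _ (gweight m s t)); last 2 first.
  - move=> u v su uv vt; rewrite /F -mulrBl !ger0_norm ?subr_ge0 ?intg_nd//; last first.
      by rewrite mulr_ge0 ?invr_ge0// subr_ge0 gweight_nd.
    set a := intg s u m; set b := intg s v m.
    have : expR (2 * b) * (1 + (2 * a - 2 * b)) <= expR (2 * a).
      have -> : expR (2 * a) = expR (2 * b) * expR (2 * a - 2 * b) by rewrite -expRD addrC subrK.
      by rewrite ler_pM2l ?expR_gt0// expR_ge1Dx.
    have : expR (2 * b) * (b - a) <= gweight m s t * (b - a).
      by rewrite ler_wpM2r ?subr_ge0 ?intg_nd// gweightE ler_expR ler_pM2l// intg_nd.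
    rewrite !gweightE -/a -/b => h1 h2; rewrite ler_pdivrMr//; lra.
  - exact: (acont_int t lm (lexx s)).
  exact/ltW/gweight_gt0.
have lg : locint (fun u => m u * gweight m s u).
  by apply: borel_locint_locint; apply: borel_locint_mul_continuous => //; exact: continuous_gweight.
rewrite -(acont_int_derive st aF lg); first by rewrite /F lerBlDr lerDl divr_ge0// ltW// gweight_gt0.
apply: ae_imp (is_derive_int s lm) => u H /andP[su _]; have Hu := H su.
have H1 := @is_deriveZ R R R (fun t => intg s t m) 2 u 1 (m u) Hu.
have H2 := @is_derive1_comp R expR _ u _ _ (is_derive_expR _) H1.
have H3 := @is_deriveZ R R R _ (2^-1) u 1 _ H2.
have -> : F = 2^-1 \*: (expR \o (2 \*: (fun t => intg s t m))).
  by apply/funext => t'; rewrite /F gweightE mulrC.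
apply: is_derive_eq; rewrite -[_ *: _]/(2^-1 * (expR (2 * intg s u m) * (2 * m u))) gweightE; by field.
Qed.

End GronwallWeight.

(** * Integrated delay equations *)

(** The equation x'(t) = L(t) x_t + h(t) for t >= s, in integrated form.
    Continuity on the whole line makes every segment of [x] meaningful. *)
Definition sol_from {R : realType} {n : nat} (r : R) (eta : R -> R -> 'M[R]_n)
    (s : R) (h x : R -> 'cV[R]_n) : Prop :=
  continuous x /\ forall t, s <= t ->
    x t - x s = vint s t (fun u => delay_op eta u (segment r x u) + h u).

Section Volterra.
Context {R : realType} {n : nat} {r r0 : R} {eta : R -> R -> 'M[R]_n}.
Context (hr : 0 < r) (hr0 : 0 < r0) (heta : standing_assumptions r r0 eta).
Context {m : R -> R} (bm : borel_locint m) (m0 : forall t, 0 <= m t).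
Context (Lm : {ae (@lebesgue_measure R), forall t, forall phi : Cseg r n,
  \sum_(i < n) `|delay_op eta t phi i ord0| <= m t * cnorm phi}).
Local Notation mu := (@lebesgue_measure R).
Local Notation intg := integral_from_to.
Local Notation L := (delay_op eta).
Local Notation seg := (segment r).
Local Notation sol := (sol_from r eta).
Local Notation W := (gweight m).
Implicit Types (x y h : R -> 'cV[R]_n) (phi psi : Cseg r n) (t s u c : R).

Let r_ge0 : 0 <= r. Proof. exact: ltW. Qed.
Let lm : locint m := borel_locint_locint bm.
Let Wnd s t u : t <= u -> W s t <= W s u. Proof. exact: (gweight_nd bm m0). Qed.
Let W_gt0 s t : 0 < W s t. Proof. exact: gweight_gt0. Qed.
Let W_ge0 s t : 0 <= W s t. Proof. exact: ltW. Qed.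
Let W_ge1 s t : 1 <= W s t. Proof. exact: (gweight_ge1 m0). Qed.

Lemma vlocint_rhs x h : continuous x -> vlocint h -> vlocint (fun u => L u (seg x u) + h u).
Proof. by move=> cx lh; apply: vlocintD => //; exact: (vlocint_delay hr heta bm m0 Lm). Qed.

Let vlL x : continuous x -> vlocint (fun u => L u (seg x u)).
Proof. by move=> cx; exact: (vlocint_delay hr heta bm m0 Lm). Qed.

Lemma continuous_col_sub x y : continuous x -> continuous y -> continuous (fun t => x t - y t).
Proof. by move=> cx cy t; apply: cvgB; [exact: cx|exact: cy]. Qed.

Lemma continuous_col_add x y : continuous x -> continuous y -> continuous (fun t => x t + y t).
Proof. by move=> cx cy t; apply: cvgD; [exact: cx|exact: cy]. Qed.

Lemma continuous_col_scale c x : continuous x -> continuous (fun t => c *: x t).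
Proof. by move=> cx t; apply: cvgZl_tmp; exact: cx. Qed.

Lemma vint_delayB s t x y : continuous x -> continuous y ->
  vint s t (fun u => L u (seg (fun v => x v - y v) u)) =
  vint s t (fun u => L u (seg x u)) - vint s t (fun u => L u (seg y u)).
Proof.
move=> cx cy; rewrite -vintB; [|exact: vlL|exact: vlL].
by congr vint; apply/funext => u; rewrite segmentB// (delay_opB hr heta).
Qed.

Lemma enorm_vint_delay s t x (b : R -> R) : continuous x -> continuous b ->
  (forall u, s <= u <= t -> cnorm (seg x u) <= b u) ->
  enorm (vint s t (fun u => L u (seg x u))) <= intg s t (fun u => m u * b u).
Proof.
move=> cx cb H; apply: enorm_vint_le; first exact: vlL.
  by apply: borel_locint_locint; apply: borel_locint_mul_continuous.
by apply: ae_imp Lm => u Hu sut; apply: le_trans (Hu _) _; rewrite ler_wpM2l// H.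
Qed.

Lemma enorm_vint_delay_weighted s t x c : s <= t -> 0 <= c -> continuous x ->
  (forall u, s - r <= u <= t -> enorm (x u) <= c * W s u) ->
  enorm (vint s t (fun u => L u (seg x u))) <= c * W s t / 2.
Proof.
move=> st c0 cx H; apply: le_trans (@enorm_vint_delay s t x (fun u => c * W s u) cx _ _) _.
- by move=> u; apply: cvgM; [exact: cvg_cst|exact: continuous_gweight].
- move=> u /andP[su ut]; apply: cnorm_segment_le => // v /andP[uv vu].
  apply: (@le_trans _ _ (c * W s v)).
    by apply: H; rewrite (le_trans vu ut) andbT; lra.
  by apply: ler_wpM2l => //; exact: Wnd.
rewrite (_ : (fun u => _) = fun u => c * (m u * W s u)); last by apply/funext => u; ring.
rewrite intZ; last first.
  by apply: borel_locint_locint; apply: borel_locint_mul_continuous => //; exact: continuous_gweight.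
by rewrite -mulrA ler_wpM2l// int_gweight.
Qed.

Lemma sol_from_restart s s' h x : vlocint h -> s <= s' -> sol s h x -> sol s' h x.
Proof.
move=> lh ss [cx Hx]; split=> // t st; have lr := vlocint_rhs cx lh.
have := Hx t (le_trans ss st); rewrite (vint_cat lr ss st) -(Hx s' ss) => H.
by apply: (addrI (x s' - x s)); rewrite -H addrC addrA subrK.
Qed.

Lemma sol_from_comb s h (k : R -> 'cV[R]_n) x y c : vlocint h -> vlocint k -> sol s h x -> sol s k y ->
  sol s (fun u => c *: h u + k u) (fun u => c *: x u + y u).
Proof.
move=> lh lk [cx Hx] [cy Hy]; split.
  by apply: continuous_col_add => //; exact: continuous_col_scale.
move=> t st; have lx := vlocint_rhs cx lh; have ly := vlocint_rhs cy lk.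
transitivity (c *: (x t - x s) + (y t - y s)).
  by rewrite scalerBr opprD addrACA.
rewrite Hx// Hy// -vintZ// -vintD//; last exact: vlocintZ.
congr vint; apply/funext => u; rewrite segmentD//; last exact: continuous_col_scale.
by rewrite segmentZ// (delay_op_linear hr heta) scalerDr addrACA.
Qed.

Lemma sol_from_ae s h (k : R -> 'cV[R]_n) x : vlocint k -> {ae mu, forall u, h u = k u} -> sol s h x -> sol s k x.
Proof.
move=> lk hk [cx Hx]; split => // t st; rewrite Hx//.
by apply: vint_ae; [exact: vlocint_rhs|apply: ae_imp hk => u ->].
Qed.

Lemma sol_from0 s : sol s (fun=> 0) (fun=> 0).
Proof.
split=> [t|t st]; first exact: cvg_cst.
rewrite subr0 (_ : (fun u => _) = fun=> 0) ?vint0//.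
by apply/funext => u; rewrite segment0// (delay_op0 hr heta) addr0.
Qed.

Lemma sol_fromB s h (k : R -> 'cV[R]_n) x y : vlocint h -> vlocint k -> sol s h x -> sol s k y ->
  sol s (fun u => h u - k u) (fun u => x u - y u).
Proof.
move=> lh lk Hx Hy; have := sol_from_comb (-1) lk lh Hy Hx.
by congr sol_from; apply/funext => u; rewrite scaleN1r addrC.
Qed.

Lemma sol_fromD s h (k : R -> 'cV[R]_n) x y : vlocint h -> vlocint k -> sol s h x -> sol s k y ->
  sol s (fun u => h u + k u) (fun u => x u + y u).
Proof.
move=> lh lk Hx Hy; have := sol_from_comb 1 lh lk Hx Hy.
by congr sol_from; apply/funext => u; rewrite scale1r.
Qed.

(** Gronwall: over [s - r, t], the maximum of |x| / W is at most half of itself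
    plus the data, by [enorm_vint_delay_weighted]. *)
Lemma sol_from_bound s t h x : vlocint h -> s <= t -> sol s h x ->
  cnorm (seg x t) <=
    2 * (cnorm (seg x s) + n%:R * intg s t (fun u => enorm (h u))) * W s t.
Proof.
move=> lh st [cx Hx].
set N := cnorm (seg x s); set H := n%:R * _.
have le0 : locint (fun u => enorm (h u)) := locint_enorm lh.
have H0 : 0 <= H by rewrite mulr_ge0// int_ge0// => u; exact: enorm_ge0.
have N0 : 0 <= N by exact: cnorm_ge0.
pose q u := enorm (x u) * expR (- (2 * intg s u m)).
have cq : continuous q.
  move=> u; apply: cvgM; first exact: continuous_enorm.
  apply: (@continuous_comp _ _ _ (fun t => - (2 * intg s t m)) expR); last exact: continuous_expR.
  by apply: cvgN; apply: cvgM; [exact: cvg_cst|exact: (@continuous_intg R s m lm u)].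
have qE u : enorm (x u) = q u * W s u.
  by rewrite /q gweightE -mulrA -expRD addrC subrr expR0 mulr1.
have srt : s - r <= t by rewrite lerBlDr (le_trans st)// lerDl.
have [c cI Hc] := @EVT_max R q (s - r) t srt (continuous_subspaceT cq).
have q0 : 0 <= q c by rewrite mulr_ge0 ?enorm_ge0// expR_ge0.
have bd u : s - r <= u <= t -> enorm (x u) <= q c * W s u.
  by move=> hu; rewrite qE; apply: ler_wpM2r => //; apply: Hc; rewrite in_itv.
have step u : s - r <= u <= t -> enorm (x u) <= (N + H + q c / 2) * W s u.
  move=> /andP[su ut].
  have W1 := W_ge1 s u.
  have [us|us] := leP u s.
    apply: (@le_trans _ _ N); first by apply: enorm_le_segment => //; rewrite su us.
    by apply: le_trans (_ : N + H + q c / 2 <= _); [rewrite -addrA lerDl; lra|rewrite ler_peMr//; lra].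
  have Hu := Hx u (ltW us); rewrite (vintD _ _ (vlL cx) lh) in Hu.
  have -> : x u = x s + vint s u (fun u => L u (seg x u)) + vint s u h.
    by rewrite -addrA -Hu addrC subrK.
  apply: le_trans (enormD _ _) _.
  have K1 : enorm (vint s u (fun u => L u (seg x u))) <= q c * W s u / 2.
    apply: enorm_vint_delay_weighted => //; first exact: ltW.
    by move=> v /andP[sv vu]; apply: bd; rewrite sv (le_trans vu ut).
  have K2 : enorm (vint s u h) <= H.
    apply: le_trans (enorm_vint _ _ lh) _; rewrite ler_wpM2l//.
    apply: int_nd => //; [by move=> v; exact: enorm_ge0|exact: ltW].
  have K3 : enorm (x s) <= N by apply: enorm_le_segment => //; rewrite lexx andbT lerBlDr lerDl.
  have K4 := enormD (x s) (vint s u (fun u => L u (seg x u))).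
  apply: (@le_trans _ _ (N + H + q c * W s u / 2)); first lra.
  have -> : (N + H + q c / 2) * W s u = (N + H) * W s u + q c * W s u / 2 by ring.
  by rewrite lerD2r; apply: ler_peMr => //; exact: addr_ge0.
have qc : q c <= 2 * (N + H).
  move: cI; rewrite in_itv/= => /step; rewrite qE (ler_pM2r (W_gt0 _ _)); lra.
apply: cnorm_segment_le => // u /andP[tu ut].
have [su|us] := leP (s - r) u.
  apply: le_trans (bd u _) _; first by rewrite su ut.
  apply: (@le_trans _ _ (q c * W s t)); first by apply: ler_wpM2l => //; exact: Wnd.
  exact: ler_wpM2r.
lra.
Qed.

Lemma sol_from_unique s h x y : vlocint h -> sol s h x -> sol s h y -> seg x s = seg y s ->
  forall t, s <= t -> seg x t = seg y t.
Proof.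
move=> lh Hx Hy xy t st; apply/eqP; rewrite -subr_eq0; apply/eqP.
have Hd := sol_fromB lh lh Hx Hy.
have [cx _] := Hx; have [cy _] := Hy.
apply: (cnorm_le0 r_ge0); rewrite -segmentB//.
apply: le_trans (sol_from_bound (vlocintB lh lh) st Hd) _.
rewrite segmentB// xy subrr cnorm0// add0r (_ : (fun u => _) = fun=> 0).
  by rewrite int0 !(mul0r, mulr0).
by apply/funext => u; rewrite subrr enorm0.
Qed.

(** Picard iteration from the constant continuation of [phi]; consecutive
    differences shrink by 1/2 in the weight W. *)
Lemma sol_from_exists s phi h : vlocint h -> exists x, sol s h x /\ seg x s = phi.
Proof.
move=> lh.
pose x0 u := Cseg_extend phi (u - s).
have cx0 : continuous x0.
  move=> v; apply: (@continuous_comp _ _ _ (fun u => u - s) (Cseg_extend phi)).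
    by apply: cvgB; [exact: cvg_id|exact: cvg_cst].
  exact: continuous_Cseg_extend.
pose Phi x t := x0 t + vint s t (fun u => L u (seg x u) + h u).
have cPhi x : continuous x -> continuous (Phi x).
  by move=> cx; apply: continuous_col_add => //; apply: continuous_vint; exact: vlocint_rhs.
have cancel (p a b q : 'cV[R]_n) : p + (a + q) - (p + (b + q)) = a - b.
  by rewrite opprD addrACA subrr add0r opprD addrACA subrr addr0.
have PhiB x y t : continuous x -> continuous y ->
    Phi x t - Phi y t = vint s t (fun u => L u (seg (fun v => x v - y v) u)).
  move=> cx cy; rewrite (vint_delayB s t cx cy) /Phi.
  transitivity (x0 t + (vint s t (fun u => L u (seg x u)) + vint s t h) -
                (x0 t + (vint s t (fun u => L u (seg y u)) + vint s t h))).
    by congr (_ + _ - (_ + _)); apply: vintD => //; exact: vlL.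
  exact: cancel.
pose S k := iter k Phi x0.
have cS k : continuous (S k) by elim: k => //= k IH; exact: cPhi.
have SS k : S k.+1 = Phi (S k) by [].
have S_s k t : t <= s -> S k t = x0 t.
  by move=> ts; case: k => [//|k]; rewrite SS /Phi vint_empty// addr0.
have dS T : exists2 c, 0 <= c & forall k t, t <= T -> enorm (S k.+1 t - S k t) <= c * W s t / 2 ^+ k.
  have [B B0 HB] := continuous_enorm_bounded s T (continuous_col_sub (cS 1%N) (cS 0%N)).
  exists B => //; elim=> [|k IH] t tT.
    have [ts|st] := leP t s; last first.
      rewrite expr0 divr1; apply: (@le_trans _ _ B); first by apply: HB; rewrite ltW.
      by apply: ler_peMr => //; exact: W_ge1.
    by rewrite !S_s// subrr enorm0 divr_ge0// mulr_ge0// W_ge0.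
  have [ts|st] := leP t s.
    by rewrite !S_s// subrr enorm0 divr_ge0 ?exprn_ge0// mulr_ge0// W_ge0.
  rewrite SS [in X in _ - X]SS (PhiB _ _ _ (cS k.+1) (cS k)).
  have -> : B * W s t / 2 ^+ k.+1 = (B / 2 ^+ k) * W s t / 2.
    by rewrite exprS invfM; ring.
  apply: enorm_vint_delay_weighted; [exact: ltW|by rewrite divr_ge0 ?exprn_ge0| |].
    exact: (continuous_col_sub (cS k.+1) (cS k)).
  move=> u /andP[_ ut]; have -> : B / 2 ^+ k * W s u = B * W s u / 2 ^+ k by ring.
  by apply: IH; exact: le_trans ut tT.
have dS' T1 : exists2 c, 0 <= c & forall k t, `|t| <= T1 -> enorm (S k.+1 t - S k t) <= c / 2 ^+ k.
  have [c c0 Hc] := dS T1; exists (c * W s T1) => [|k t tT].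
    by apply: mulr_ge0 => //; exact: W_ge0.
  have tT' : t <= T1 by apply: le_trans (ler_norm _) tT.
  apply: le_trans (Hc k t tT') _; rewrite ler_pM2r ?invr_gt0 ?exprn_gt0//.
  by apply: ler_wpM2l => //; exact: Wnd.
have [x [cx Hx]] := geometric_limit_continuous cS dS'.
have x_s t : t <= s -> x t = x0 t.
  move=> ts; have := Hx t 0 (lexx _) _ 0%N; rewrite !mulr0 mul0r S_s// => H.
  apply/eqP; rewrite -subr_eq0; apply/eqP/enorm_le0/H => k.
  by rewrite !S_s// subrr enorm0 mul0r.
have fix_x t : s <= t -> x t = Phi x t.
  move=> st; apply/eqP; rewrite -subr_eq0; apply/eqP/enorm_le0/ler_addgt0Pl => e e0.
  rewrite addr0; have [c c0 Hc] := dS' (`|t| + `|s| + r).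
  have bd k u : s - r <= u <= t -> enorm (x u - S k u) <= n%:R * (2 * c) / 2 ^+ k.
    move=> /andP[su ut]; apply: Hx => // j; apply: Hc.
    have := ler_norm t; have := ler_norm (- s); rewrite normrN => ? ?.
    by have r1 := r_ge0; rewrite ler_norml; have := normr_ge0 t; have := normr_ge0 s; move=> ? ?; apply/andP; split; lra.
  pose D := n%:R * (2 * c).
  have D0 : 0 <= D by rewrite mulr_ge0// mulr_ge0.
  pose A := intg s t m.
  have A0 : 0 <= A by exact: int_ge0.
  pose k := (Num.truncn ((D + A * D) / e)).+1.
  have := exp2_small (D + A * D) e0; rewrite -/k => hk; apply: le_trans hk.
  have -> : x t - Phi x t = (x t - S k.+1 t) - (Phi x t - Phi (S k) t).
    by rewrite -SS opprB addrA subrK.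
  apply: le_trans (enormB _ _) _; rewrite mulrDl; apply: lerD.
    apply: le_trans (bd k.+1 t _) _; first by rewrite lexx andbT; rewrite lerBlDr (le_trans st)// lerDl.
    rewrite ler_wpM2l// lef_pV2 ?posrE ?exprn_gt0// ler_eXn2l ?ltr1n//.
  rewrite (PhiB _ _ _ cx (cS k)); apply: le_trans (@enorm_vint_delay s t _ (fun=> D / 2 ^+ k) _ _ _) _.
  - exact: (continuous_col_sub cx (cS k)).
  - by move=> u; exact: cvg_cst.
  - move=> u /andP[su ut]; apply: cnorm_segment_le => //; first exact: (continuous_col_sub cx (cS k)).
    by move=> v /andP[uv vu]; apply: bd; apply/andP; split; lra.
  rewrite (_ : (fun u => _) = fun u => D / 2 ^+ k * m u); last by apply/funext => u; rewrite mulrC.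
  by rewrite intZ// -/A le_eqVlt; apply/orP; left; apply/eqP; ring.
exists x; split; last first.
  rewrite -[RHS](segment_Cseg_extend r_ge0 phi s); apply: segment_ext => u /andP[_ us].
  exact: x_s.
split=> // t st; rewrite (fix_x t st) /Phi (x_s s (lexx s)).
have -> : x0 t = x0 s.
  by rewrite /x0 /Cseg_extend /clamp subrr minxx (min_idPr _)// subr_ge0.
by rewrite addrC addrA addNr add0r.
Qed.

End Volterra.

(** * Evolution operators *)

Section Evolution.
Context {R : realType} {n : nat} {r r0 : R} {eta : R -> R -> 'M[R]_n}.
Context (hr : 0 < r) (hr0 : 0 < r0) (heta : standing_assumptions r r0 eta).
Context {m : R -> R} (bm : borel_locint m) (m0 : forall t, 0 <= m t).
Context (Lm : {ae (@lebesgue_measure R), forall t, forall phi : Cseg r n,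
  \sum_(i < n) `|delay_op eta t phi i ord0| <= m t * cnorm phi}).
Local Notation mu := (@lebesgue_measure R).
Local Notation intg := integral_from_to.
Local Notation L := (delay_op eta).
Local Notation seg := (segment r).
Local Notation sol := (sol_from r eta).
Local Notation T := (evolution (r := r) eta).
Implicit Types (x y h f : R -> 'cV[R]_n) (phi psi : Cseg r n) (t s u c : R).

Let r_ge0 : 0 <= r. Proof. exact: ltW. Qed.
Let rhs x h : continuous x -> vlocint h -> vlocint (fun u => L u (seg x u) + h u).
Proof. exact: (vlocint_rhs hr heta bm m0 Lm). Qed.
Let uniq := sol_from_unique hr heta bm m0 Lm.
Let exist := sol_from_exists hr heta bm m0 Lm.

Lemma near_ge s t : s < t -> \forall u \near t, s <= u.
Proof.
move=> st; apply/nbhs_ballP; exists (t - s) => /= [|u]; first by rewrite subr_gt0.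
by rewrite /ball/= => h; have := ler_norm (t - u); lra.
Qed.

Lemma near_le s t : t < s -> \forall u \near t, u <= s.
Proof.
move=> st; apply/nbhs_ballP; exists (s - t) => /= [|u]; first by rewrite subr_gt0.
by rewrite /ball/= distrC => h; have := ler_norm (u - t); lra.
Qed.

Lemma abs_cont_on_primitive a b s x f : vlocint f -> s <= a ->
  (forall t, a <= t <= b -> x t - x s = vint s t f) -> abs_cont_on a b x.
Proof.
move=> lf sa Hx; apply/abs_cont_onP => i e e0.
have [d d0 H] := acont_int b (lf i) sa e0; exists d => // I aI pI SI.
rewrite (le_lt_trans _ (H I aI pI SI))// le_eqVlt; apply/orP; left; apply/eqP.
rewrite big_seq [RHS]big_seq; apply: eq_bigr => p pI'.
have /and3P[ap pp pb] := allP aI _ pI'.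
have E t : a <= t <= b -> x t i ord0 = x s i ord0 + intg s t (fun u => f u i ord0).
  by move=> /Hx /(congr1 (fun v : 'cV[R]_n => v i ord0)); rewrite !mxE => <-; ring.
rewrite (E p.2) ?(le_trans ap pp) ?pb// (E p.1) ?ap ?(le_trans pp pb)//; congr (`| _|); ring.
Qed.

Lemma abs_cont_continuous x : (forall a b, a <= b -> abs_cont_on a b x) -> continuous x.
Proof.
move=> H; apply/continuous_colP => i t; apply/cvgrPdist_lt => e e0.
have tt : t - 1 <= t + 1 by lra.
have [d d0 Hd] := acont_continuous ((abs_cont_onP _ _ _).1 (H _ _ tt) i) e0.
apply/nbhs_ballP; exists (Num.min d 1); rewrite /= ?lt_min ?d0 ?ltr01// => u.
rewrite /ball/= lt_min => /andP[tud tu1].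
have a1 := ler_norm (t - u); have a2 := ler_norm (u - t); rewrite distrC in a2.
have [tu|ut] := leP t u; last by apply: Hd; lra.
by rewrite distrC; apply: Hd; lra.
Qed.

Lemma is_derive_primitive s x f : vlocint f ->
  (forall t, s <= t -> x t - x s = vint s t f) ->
  {ae mu, forall t, s < t -> is_derive t 1 x (f t)}.
Proof.
move=> lf Hx; apply: ae_imp (is_derive_vint s lf) => t H st.
have Ht := @is_deriveD _ _ _ (cst (x s)) _ t 1 _ _ (is_derive_cst _ _ _) (H st).
rewrite add0r in Ht; apply: near_eq_is_derive Ht.
near=> u; have su : s <= u by near: u; exact: near_ge.
by rewrite fctE /= -Hx// addrC subrK.
Unshelve. all: by end_near. Qed.

Lemma sol_from_ivp s phi x : sol s (fun=> 0) x -> seg x s = phi -> ivp_solution eta s phi x.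
Proof.
move=> [cx Hx] xs; have lf := rhs cx (@vlocint0 _ n).
split => //; first exact: continuous_subspaceT.
- move=> b sb; apply: (abs_cont_on_primitive lf (lexx s)) => t /andP[st _].
  exact: Hx.
apply: ae_imp (ae_and (is_derive_primitive lf Hx) (ae_neq s)) => t [H ts] st.
by rewrite -[delay_op _ _ _]addr0; apply: H; rewrite lt_neqAle eq_sym ts.
Qed.

(** Composing with max (s - r) makes a solution that is continuous on
    [s - r, +oo[ continuous on the line, without changing later segments. *)
Lemma ivp_sol_from s phi x : ivp_solution eta s phi x ->
  exists2 y, sol s (fun=> 0) y & forall t, s <= t -> seg y t = seg x t.
Proof.
move=> [cx xs acx dx]; pose y u := x (Num.max (s - r) u).
have cy : continuous y.
  move=> u.
  have cc : {within `[s - r, Num.max (s - r) u + 1], continuous x}.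
    by apply: continuous_subspaceW cx => v /=; rewrite !in_itv/= andbT => /andP[].
  have ab : s - r <= Num.max (s - r) u + 1.
    by apply: (@le_trans _ _ (Num.max (s - r) u)); rewrite ?le_max ?lexx// lerDl.
  have H : (x \o clamp (s - r) (Num.max (s - r) u + 1)) @ u --> (x \o clamp (s - r) (Num.max (s - r) u + 1)) u.
    by apply: continuous_comp_clamp.
  have E v : v <= Num.max (s - r) u + 1 -> (x \o clamp (s - r) (Num.max (s - r) u + 1)) v = y v.
    by move=> h; rewrite /= /clamp (min_idPl h).
  have hu : u <= Num.max (s - r) u + 1.
    by apply: (@le_trans _ _ (Num.max (s - r) u)); rewrite ?le_max ?lexx ?orbT// lerDl.
  rewrite (E u hu) in H.
  apply: cvg_trans H; apply: near_eq_cvg; near=> v; rewrite E//.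
  near: v; apply: near_le; apply: (@le_lt_trans _ _ (Num.max (s - r) u)); rewrite ?le_max ?lexx ?orbT// ltrDl//.
have xy t : s <= t -> seg y t = seg x t.
  move=> st; apply: segment_ext => u /andP[tu ut].
  by rewrite /y (max_idPr _)//; lra.
have yE u : s - r <= u -> y u = x u by move=> h; rewrite /y (max_idPr h).
exists y => //; split=> // t st; have lf := rhs cy (@vlocint0 _ n).
rewrite !yE; [|by rewrite lerBlDr lerDl|by rewrite lerBlDr (le_trans st)// lerDl].
apply: (abs_cont_vint st (acx t st) lf); apply: ae_imp dx => u H /andP[su ut].
by rewrite addr0 xy ?(ltW su)//; apply: H; exact: ltW.
Unshelve. all: by end_near. Qed.

Lemma evolution_sol s t x : sol s (fun=> 0) x -> s <= t -> T t s (seg x s) = seg x t.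
Proof.
move=> Hx st; rewrite /evolution; case: xgetP => [y -> Hy|/(_ x)]; last first.
  by move=> H; exfalso; apply: H; exact: sol_from_ivp.
have [z Hz zy] := ivp_sol_from Hy.
rewrite -zy//; apply: (uniq (@vlocint0 _ n) Hz Hx) => //.
by rewrite zy//; have [_ ->] := Hy.
Qed.

Lemma evolution_exists s phi : exists x, [/\ sol s (fun=> 0) x, seg x s = phi &
  forall t, s <= t -> T t s phi = seg x t].
Proof.
have [x [Hx xs]] := exist s phi (@vlocint0 _ n).
by exists x; split => // t st; rewrite -xs evolution_sol.
Qed.

Lemma evolution_linear t s c phi psi : s <= t ->
  T t s (c *: phi + psi) = c *: T t s phi + T t s psi.
Proof.
move=> st; have [x [Hx <- Tx]] := evolution_exists s phi.
have [y [Hy <- Ty]] := evolution_exists s psi.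
have [cx _] := Hx; have [cy _] := Hy.
have Hz := sol_from_comb hr heta bm m0 Lm c (@vlocint0 _ n) (@vlocint0 _ n) Hx Hy.
have {}Hz : sol s (fun=> 0) (fun u => c *: x u + y u).
  by move: Hz; congr sol_from; apply/funext => u; rewrite scaler0 addr0.
have cZ : continuous (fun u => c *: x u) by exact: continuous_col_scale.
have <- : seg (fun u => c *: x u + y u) s = c *: seg x s + seg y s.
  by rewrite segmentD// segmentZ.
by rewrite !evolution_sol// segmentD// segmentZ.
Qed.

Lemma evolution0 t s : s <= t -> T t s 0 = 0.
Proof. by move=> st; have := evolution_linear (-1) 0 0 st; rewrite scaler0 addr0 scaleN1r addNr. Qed.

Lemma evolutionZ t s c phi : s <= t -> T t s (c *: phi) = c *: T t s phi.
Proof. by move=> st; have := evolution_linear c phi 0 st; rewrite evolution0// !addr0. Qed.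

Lemma evolutionD t s phi psi : s <= t -> T t s (phi + psi) = T t s phi + T t s psi.
Proof. by move=> st; have := evolution_linear 1 phi psi st; rewrite !scale1r. Qed.

Lemma evolutionN t s phi : s <= t -> T t s (- phi) = - T t s phi.
Proof. by move=> st; rewrite -scaleN1r evolutionZ// scaleN1r. Qed.

Lemma evolutionB t s phi psi : s <= t -> T t s (phi - psi) = T t s phi - T t s psi.
Proof. by move=> st; rewrite evolutionD// evolutionN. Qed.

Lemma evolution_id s phi : T s s phi = phi.
Proof. by have [x [_ xs ->]] := evolution_exists s phi. Qed.

Lemma evolution_comp t u s phi : s <= u -> u <= t -> T t u (T u s phi) = T t s phi.
Proof.
move=> su ut; have [x [Hx _ Tx]] := evolution_exists s phi.
rewrite (Tx u su) (Tx t (le_trans su ut)) evolution_sol//.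
exact: (sol_from_restart hr heta bm m0 Lm (@vlocint0 _ n) su Hx).
Qed.

Lemma evolution_bound t s phi : s <= t -> cnorm (T t s phi) <= 2 * gweight m s t * cnorm phi.
Proof.
move=> st; have [x [Hx <- Tx]] := evolution_exists s phi; rewrite Tx//.
apply: le_trans (sol_from_bound hr heta bm m0 Lm (@vlocint0 _ n) st Hx) _.
rewrite (_ : (fun u => _) = fun=> 0); last by apply/funext => u; rewrite enorm0.
by rewrite int0 mulr0 addr0 mulrAC.
Qed.

(** A locally absolutely continuous function is a primitive of its a.e.
    derivative, from every starting time. *)
Lemma nonhom_solutionP h y : vlocint h ->
  nonhom_solution r eta h y <-> continuous y /\ forall s, sol s h y.
Proof.
move=> lh; split=> [[acy dy]|[cy Hy]].
  have cy := abs_cont_continuous acy; split=> // s; split=> // t st.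
  apply: (abs_cont_vint st (acy s t st)); first exact: rhs.
  by apply: ae_imp dy => u H _.
have lf := rhs cy lh; split=> [a b ab|].
  by apply: (abs_cont_on_primitive lf (lexx a)) => t /andP[at' _]; apply: (Hy a).2.
have : {ae mu, forall t, forall k : nat, - k%:R < t -> is_derive t 1 y (L t (seg y t) + h t)}.
  by apply: ae_foralln => k; apply: (is_derive_primitive lf) => t; apply: (Hy _).2.
apply: ae_imp => t /(_ (Num.truncn (- t)).+1); apply.
by rewrite ltrNl; exact: truncnS_gt.
Qed.

End Evolution.

(** * A closed graph lemma *)

Section ClosedGraph.
Context {R : realType} {V : lmodType R} (N p : V -> R -> Prop) (K : R).
Implicit Types (x y v : V) (A B e : R).

(** The closed graph theorem in the form of Zabreiko. [N x A] stands for
    |x| <= A in a complete norm and [p x B] for the statement that a seminorm,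
    finite everywhere, is at most B at x; relations replace the norm and the
    seminorm because the latter is only known through the existence of bounded
    solutions. Some sublevel set of the seminorm is dense in a ball by the Baire
    argument, hence in a ball around 0; every point of that ball is then a
    series whose terms have geometrically decreasing seminorm, and the seminorm
    is countably subadditive up to the factor [K]. *)
Lemma closed_graph_estimate : 0 <= K ->
  (forall c x A, N x A -> N (c *: x) (`|c| * A)) ->
  (forall x y A B, N x A -> N y B -> N (x + y) (A + B)) ->
  (forall x A B, A <= B -> N x A -> N x B) ->
  N 0 0 ->
  (forall c x A, p x A -> p (c *: x) (`|c| * A)) ->
  (forall x y A B, p x A -> p y B -> p (x + y) (A + B)) ->
  (forall x A B, A <= B -> p x A -> p x B) ->
  (forall u : nat -> V, (forall k, N (u k) (2 ^+ k)^-1) -> exists v,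
     (forall k, N (v - \sum_(j < k) u j) (2 / 2 ^+ k)) /\
     forall B, 0 <= B -> (forall k, p (u k) (B / 2 ^+ k)) -> p v (K * B)) ->
  (forall x v B, (forall e, 0 < e -> N (x - v) e) -> p v B -> p x B) ->
  (forall x A, N x A -> exists B, p x B) ->
  exists2 C, 0 < C & forall x A, 0 < A -> N x A -> p x (C * A).
Proof.
move=> K0 NZ ND Nle N0 pZ pD ple Ncomp Nsep pfin.
have NN x A : N x A -> N (- x) A by move=> /(NZ (-1)); rewrite normrN1 mul1r scaleN1r.
have NB x y A B : N x A -> N y B -> N (x - y) (A + B) by move=> Nx /NN; exact: ND.
(* Baire: some sublevel set of p is dense in a ball *)
have [M [a [rho [[rho0 [Aa Na]] Hdense]]]] : exists (M : nat) a rho, (0 < rho /\ exists A, N a A) /\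
    forall x, N (x - a) rho -> forall e, 0 < e -> exists2 x', N (x' - x) e & p x' M%:R.
  apply: contrapT => noM.
  have step (s : nat * (V * R)) : exists q : V * R,
      0 < s.2.2 -> (exists A, N s.2.1 A) -> [/\ N (q.1 - s.2.1) s.2.2, 0 < q.2 &
        forall x', N (x' - q.1) q.2 -> ~ p x' s.1%:R].
    case: s => M [a rho] /=.
    have [rho0|rho0] := ltP 0 rho; last by exists (a, rho).
    have [aA|aA] := pselect (exists A, N a A); last by exists (a, rho).
    apply: contrapT => h; apply: noM; exists M, a, rho; split=> // x xa e e0.
    apply: contrapT => h2; apply: h; exists (x, e) => _ _; split => // x' x'x px'.
    by apply: h2; exists x'.
  have [q Hq] := choice step.
  pose st := fix st k : V * R := if k is k'.+1 then
     let s := st k' in let t := q (k', (s.1, s.2 / 4)) in (t.1, Num.min t.2 (s.2 / 4))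
     else (0, 1).
  have stS k : st k.+1 = ((q (k, ((st k).1, (st k).2 / 4))).1,
      Num.min (q (k, ((st k).1, (st k).2 / 4))).2 ((st k).2 / 4)) by [].
  have inv k : 0 < (st k).2 /\ exists A, N (st k).1 A.
    elim: k => [|k [r0 [A NA]]]; first by split => //=; exists 0.
    rewrite stS /=; have r40 : 0 < (st k).2 / 4 by rewrite divr_gt0.
    have [h1 h2 h3] := Hq (k, ((st k).1, (st k).2 / 4)) r40 (ex_intro _ A NA).
    split; first by rewrite lt_min h2.
    by exists ((st k).2 / 4 + A); have := ND _ _ _ _ h1 NA; rewrite subrK.
  pose u k := (st k.+1).1 - (st k).1.
  have stepk k : [/\ N (u k) ((st k).2 / 4), (st k.+1).2 <= (st k).2 / 4 &
      forall x', N (x' - (st k.+1).1) (st k.+1).2 -> ~ p x' k%:R].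
    have [r0 NA] := inv k; have r40 : 0 < (st k).2 / 4 by rewrite divr_gt0.
    have [h1 h2 h3] := Hq (k, ((st k).1, (st k).2 / 4)) r40 NA.
    rewrite /u stS /=; split => //; first by rewrite ge_min lexx orbT.
    by move=> x' /Nle Nx; apply: h3; apply: Nx; rewrite ge_min lexx.
  have rk k : (st k).2 <= (2 ^+ k)^-1.
    elim: k => [|k IH]; first by rewrite expr0 invr1.
    have [_ h _] := stepk k; apply: le_trans h _; rewrite exprS invfM.
    have := (inv k).1; lra.
  have uk k : N (u k) (2 ^+ k)^-1.
    have [h _ _] := stepk k; apply: Nle h; apply: le_trans (rk k).
    by have := (inv k).1; lra.
  have sumu k : \sum_(j < k) u j = (st k).1.
    elim: k => [|k IH]; first by rewrite big_ord0.
    by rewrite big_ord_recr/= IH /u addrC subrK.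
  have [v [Nv _]] := Ncomp u uk.
  have tail k j : N ((st (k + j)%N).1 - (st k).1) ((st k).2 / 3 * (1 - (4 ^+ j)^-1)) /\
      (st (k + j)%N).2 <= (st k).2 / 4 ^+ j.
    elim: j => [|j [IH1 IH2]]; first by rewrite addn0 expr0 invr1 !subrr mulr0 mulr1.
    rewrite addnS; have [h1 h2 _] := stepk (k + j)%N.
    have e1 : (st k).2 / 4 ^+ j.+1 = (st k).2 / 4 ^+ j / 4 by rewrite exprS invfM; ring.
    split; last by rewrite e1; lra.
    have := ND _ _ _ _ h1 IH1; rewrite /u addrA subrK; apply: Nle.
    have -> : (st k).2 / 3 * (1 - (4 ^+ j.+1)^-1) = (st k).2 / 3 * (1 - (4 ^+ j)^-1) + (st k).2 / 4 ^+ j / 4.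
      by rewrite exprS invfM; field; rewrite expf_neq0.
    by rewrite addrC lerD2l; lra.
  have vk k : N (v - (st k).1) (st k).2.
    have [r0 _] := inv k.
    pose j := (Num.truncn (2 / ((st k).2 / 2))).+1.
    have := exp2_small 2 (divr_gt0 r0 (ltr0n _ 2)); rewrite -/j => hj.
    have h1 := Nv (k + j)%N; rewrite sumu in h1; have [h2 _] := tail k j.
    have := ND _ _ _ _ h1 h2; rewrite addrA subrK; apply: Nle.
    have h3 : 2 / 2 ^+ (k + j)%N <= 2 / 2 ^+ j :> R.
      by rewrite ler_pM2l// lef_pV2 ?posrE ?exprn_gt0// ler_eXn2l ?ltr1n// leq_addl.
    have h4 : 0 < (4 ^+ j)^-1 :> R by rewrite invr_gt0 exprn_gt0.
    have h5 : (st k).2 / 3 * (1 - (4 ^+ j)^-1) <= (st k).2 / 3.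
      by rewrite ger_pMr ?divr_gt0//; lra.
    lra.
  have [B pvB] : exists B, p v B.
    by apply: (pfin _ (st 0%N).2); have := vk 0%N; rewrite subr0.
  have [_ _ H] := stepk (Num.truncn B).+1.
  by apply: (H v (vk _)); apply: ple pvB; exact/ltW/truncnS_gt.
(* symmetry and convexity move the ball to the origin *)
have dense0 x e : N x rho -> 0 < e -> exists2 x', N (x' - x) e & p x' M%:R.
  move=> Nx e0.
  have [|x1 h1 p1] := Hdense (a + x) _ e e0; first by rewrite addrAC subrr add0r.
  have [|x2 h2 p2] := Hdense (a - x) _ e e0; first by rewrite addrAC subrr add0r; exact: NN.
  exists (2^-1 *: (x1 - x2)); last first.
    have := pZ (2^-1) _ _ (pD _ _ _ _ p1 (pZ (-1) _ _ p2)); rewrite scaleN1r; apply: ple.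
    by rewrite normrN1 mul1r ger0_norm ?invr_ge0//; lra.
  have -> : 2^-1 *: (x1 - x2) - x = 2^-1 *: ((x1 - (a + x)) - (x2 - (a - x))).
    have -> : (x1 - (a + x)) - (x2 - (a - x)) = (x1 - x2) - 2 *: x.
      rewrite opprB addrA -[x1 - (a + x) + _]addrA opprD addrACA addNr add0r -opprD.
      by rewrite -[x + x]mulr2n -scaler_nat addrAC.
    by rewrite [RHS]scalerBr scalerA mulVf ?scale1r// pnatr_eq0.
  have := NZ (2^-1) _ _ (NB _ _ _ _ h1 h2); apply: Nle.
  by rewrite ger0_norm ?invr_ge0//; lra.
have M0 : 0 <= M%:R :> R by [].
(* one step of the expansion: the remainder is halved, and so is the seminorm
   of the next term *)
have refine (s : nat * V) : exists u, N s.2 (rho / 2 ^+ s.1) ->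
    N (u - s.2) (rho / 2 ^+ s.1.+1) /\ p u (M%:R / 2 ^+ s.1).
  case: s => k y /=; have [Ny|Ny] := pselect (N y (rho / 2 ^+ k)); last by exists y.
  have k0 : 0 < 2 ^+ k :> R by rewrite exprn_gt0.
  have [|x' h1 h2] := @dense0 (2 ^+ k *: y) (rho / 2) _ (divr_gt0 rho0 (ltr0n _ 2)).
    by have := NZ (2 ^+ k) _ _ Ny; rewrite ger0_norm ?(ltW k0)// mulrC divfK// gt_eqF.
  exists ((2 ^+ k)^-1 *: x') => _.
  have ki : `|(2 ^+ k)^-1| = (2 ^+ k)^-1 :> R by rewrite ger0_norm// invr_ge0 ltW.
  split; last by have := pZ (2 ^+ k)^-1 _ _ h2; rewrite ki mulrC.
  have := NZ (2 ^+ k)^-1 _ _ h1; rewrite scalerBr scalerA mulVf ?gt_eqF// scale1r ki.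
  by apply: Nle; rewrite exprS invfM; lra.
have [f Hf] := choice refine.
have main x : N x rho -> p x (K * M%:R).
  move=> Nx.
  pose res := fix res k : V := if k is k'.+1 then res k' - f (k', res k') else x.
  pose u k := f (k, res k).
  have Nres k : N (res k) (rho / 2 ^+ k).
    elim: k => [|k IH]; first by rewrite expr0 divr1.
    by have [/NN + _] := Hf (k, res k) IH; rewrite opprB.
  have sumu k : \sum_(j < k) u j = x - res k.
    elim: k => [|k IH]; first by rewrite big_ord0 subrr.
    by rewrite big_ord_recr/= IH opprB addrA addrAC.
  pose c := (2 * rho)^-1.
  have c0 : 0 < c by rewrite invr_gt0 mulr_gt0.
  have crho : c * rho = 2^-1 by rewrite /c; field; rewrite gt_eqF.
  have cn : `|c| = c by rewrite ger0_norm// ltW.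
  have [|v [Hv Hp]] := Ncomp (fun k => c *: u k).
    move=> k; have [h1 _] := Hf (k, res k) (Nres k).
    have := NZ c _ _ (ND _ _ _ _ h1 (Nres k)); rewrite subrK cn; apply: Nle.
    have : 0 < (2 ^+ k)^-1 :> R by rewrite invr_gt0 exprn_gt0.
    rewrite exprS invfM.
    have -> : c * (rho * (2^-1 * (2 ^+ k)^-1) + rho / 2 ^+ k) = c * rho * (2^-1 + 1) * (2 ^+ k)^-1 by ring.
    by rewrite crho; lra.
  have pv : p v (K * (c * M%:R)).
    apply: Hp => [|k]; first by rewrite mulr_ge0// ltW.
    by have [_ h] := Hf (k, res k) (Nres k); have := pZ c _ _ h; rewrite cn mulrA.
  have px : p (c *: x) (K * (c * M%:R)).
    apply: (Nsep _ v) => // e e0.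
    pose k := (Num.truncn (3 / e)).+1.
    have := exp2_small 3 e0; rewrite -/k => hk.
    have := NB _ _ _ _ (NZ c _ _ (Nres k)) (Hv k).
    have -> : c *: res k - (v - \sum_(j < k) c *: u j) = c *: x - v.
      have -> : \sum_(j < k) c *: u j = c *: x - c *: res k by rewrite -scaler_sumr sumu scalerBr.
      by rewrite opprB addrA [c *: res k + _]addrC subrK.
    rewrite cn; apply: Nle.
    have -> : c * (rho / 2 ^+ k) = (c * rho) / 2 ^+ k by ring.
    rewrite crho; apply: le_trans hk.
    have : 0 < (2 ^+ k)^-1 :> R by rewrite invr_gt0 exprn_gt0.
    lra.
  have := pZ (2 * rho) _ _ px; rewrite scalerA mulfV ?scale1r; last by rewrite gt_eqF// mulr_gt0.
  apply: ple; rewrite ger0_norm ?mulr_ge0 ?(ltW rho0)//.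
  have -> : 2 * rho * (K * (c * M%:R)) = (c * rho) * 2 * (K * M%:R) by ring.
  by rewrite crho; lra.
exists (K * M%:R / rho + 1) => [|x A A0 Nx].
  by rewrite ltr_wpDl// divr_ge0 ?mulr_ge0// ltW.
have h1 : p ((rho / A) *: x) (K * M%:R).
  apply: main; have := NZ (rho / A) _ _ Nx.
  by rewrite ger0_norm ?divr_ge0 ?(ltW rho0) ?(ltW A0)// divfK// gt_eqF.
have := pZ (A / rho) _ _ h1; rewrite scalerA mulrA divfK ?gt_eqF// mulfV ?gt_eqF// scale1r.
apply: ple; rewrite ger0_norm ?divr_ge0 ?(ltW rho0) ?(ltW A0)//.
have -> : (K * M%:R / rho + 1) * A = A / rho * (K * M%:R) + A by ring.
by rewrite lerDl ltW.
Qed.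

End ClosedGraph.

(** * Weighted bounds and completeness *)

(** The bounds |h|_{H_b} <= B / r0 and |y|_{Y_b} <= B, without suprema. *)
Definition Hbound {R : realType} {n : nat} (r0 b : R) (h : R -> 'cV[R]_n) (B : R) : Prop :=
  forall t, integral_from_to t (t + r0) (fun u => enorm (h u)) <= B * expR (- b * `|t|).

Definition Ybound {R : realType} {n : nat} (b : R) (y : R -> 'cV[R]_n) (B : R) : Prop :=
  forall t, enorm (y t) <= B * expR (- b * `|t|).

Section WeightedBounds.
Context {R : realType} {n : nat} {r0 : R} (hr0 : 0 < r0).
Local Notation mu := (@lebesgue_measure R).
Local Notation intg := integral_from_to.
Implicit Types (h y : R -> 'cV[R]_n) (f w : R -> R) (b s t u c A B : R).

Lemma weight_shift b s t : expR (- b * `|t|) <= expR (- b * `|s|) * expR (`|b| * `|t - s|).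
Proof.
rewrite -expRD ler_expR; have h1 := ler_dist_dist t s.
have -> : - b * `|t| = - b * `|s| + - b * (`|t| - `|s|) by ring.
rewrite lerD2l; apply: le_trans (ler_norm _) _; rewrite normrM normrN.
by rewrite ler_wpM2l.
Qed.

(** A segment of length [l] is covered by finitely many windows of length [r0],
    and on it the weight changes by a bounded factor. *)
Lemma window_bound b l : 0 <= l -> exists2 C, 0 < C & forall w A, locint w -> (forall u, 0 <= w u) ->
  0 <= A -> (forall t, intg t (t + r0) w <= A * expR (- b * `|t|)) ->
  forall s t, s <= t -> t <= s + l -> intg s t w <= C * A * expR (- b * `|s|).
Proof.
move=> l0; pose N := (Num.truncn (l / r0)).+1.
have lN : l <= N%:R * r0 by rewrite -ler_pdivrMr//; exact/ltW/truncnS_gt.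
pose E := expR (`|b| * (N%:R * r0)); have E0 : 0 < E by exact: expR_gt0.
exists (N%:R * E); first by rewrite mulr_gt0.
move=> w A lw w0 A0 H s t st tl.
have step k : (k <= N)%N -> intg s (s + k%:R * r0) w <= k%:R * E * A * expR (- b * `|s|).
  elim: k => [|k IH] kN; first by rewrite !mul0r addr0 intxx.
  have kr0 : 0 <= k%:R * r0 by rewrite mulr_ge0// ltW.
  have e1 : s + k.+1%:R * r0 = s + k%:R * r0 + r0 by rewrite -natr1; ring.
  rewrite e1 (@int_cat _ s (s + k%:R * r0))//; [|by rewrite lerDl|by rewrite lerDl ltW].
  have h1 := IH (ltnW kN); have h2 := H (s + k%:R * r0).
  have h3 : expR (- b * `|s + k%:R * r0|) <= expR (- b * `|s|) * E.
    apply: le_trans (weight_shift b s _) _; rewrite ler_wpM2l ?expR_ge0// ler_expR ler_wpM2l//.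
    by rewrite addrC addKr ger0_norm// ler_wpM2r ?(ltW hr0)// ler_nat ltnW.
  have h4 : A * expR (- b * `|s + k%:R * r0|) <= A * (expR (- b * `|s|) * E) by rewrite ler_wpM2l.
  have -> : k.+1%:R * E * A * expR (- b * `|s|) = k%:R * E * A * expR (- b * `|s|) + A * (expR (- b * `|s|) * E).
    by rewrite -natr1; ring.
  by apply: lerD => //; exact: le_trans h4.
apply: le_trans (step N (leqnn _)); apply: int_nd => //.
by apply: le_trans tl _; rewrite lerD2l.
Qed.

Lemma loc_integrable_locint f : loc_integrable (EFin \o f) -> locint f.
Proof.
move=> [cm fin]; have [G mG fG] := cmeasurable_borel cm.
have iG a b : (\int[mu]_(t in `[a, b]) `|G t| < +oo)%E.
  apply: le_lt_trans (fin a b); rewrite le_eqVlt; apply/orP; left; apply/eqP/esym.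
  apply: ge0_ae_eq_integral_any => //.
    by apply: measurableT_comp => //; exact: measurable_funS mG.
  by apply: ae_imp fG => t -> _.
have [bG _] := ereal_locint mG iG.
by exists (fine \o G) => //; apply: ae_imp fG => t /= <-.
Qed.

Lemma borel_locint_loc_integrable f : borel_locint f -> loc_integrable (EFin \o f).
Proof.
move=> [mf If]; split=> [B mB|a b].
  have mEf : measurable_fun setT (EFin \o f) by exact/measurable_EFinP.
  have := mEf measurableT B mB; rewrite setTI => mA.
  exists ((EFin \o f) @^-1` B) => //; exists set0; last by rewrite setU0.
  exact: negligible_set0.
by have /integrableP[] := If a b.
Qed.

Lemma in_H_Hbound b h : in_H r0 b h -> vlocint h /\ exists2 B, 0 <= B & Hbound r0 b h B.
Proof.
move=> [lh sh]; have vh : vlocint h by move=> i; exact: (loc_integrable_locint (f := fun u => h u i ord0) (lh i)).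
split=> //; have lw := locint_enorm vh.
set S := ereal_sup _ in sh.
have Sge t : ((r0^-1 * expR (b * `|t|) * intg t (t + r0) (fun u => enorm (h u)))%:E <= S)%E.
  apply: ereal_sup_ubound; exists t => //.
  by rewrite (integral_int _ _ lw (fun u => enorm_ge0 _)).
have S0 : (0 <= S)%E.
  apply: le_trans (Sge 0); rewrite lee_fin mulr_ge0//.
    by rewrite mulr_ge0 ?expR_ge0// invr_ge0 ltW.
  by apply: int_ge0 => u; exact: enorm_ge0.
have Sfin : S \is a fin_num by rewrite ge0_fin_numE.
exists (r0 * fine S) => [|t]; first by apply: mulr_ge0; [exact: ltW|exact: fine_ge0].
have := Sge t; rewrite -(fineK Sfin) lee_fin => H.
have e0 : 0 < expR (b * `|t|) := expR_gt0 _.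
rewrite mulNr expRN ler_pdivlMr// -ler_pdivrMl//.
by apply: le_trans H; rewrite le_eqVlt; apply/orP; left; apply/eqP; ring.
Qed.

Lemma Hbound_in_H b h B : (forall i, borel_locint (fun u => h u i ord0)) ->
  Hbound r0 b h B -> in_H r0 b h.
Proof.
move=> bh hB; split=> [i|]; first exact: (borel_locint_loc_integrable (bh i)).
have lw : locint (fun u => enorm (h u)) by apply: locint_enorm => i; exact: borel_locint_locint.
apply: le_lt_trans (ltry (r0^-1 * B)); apply: ge_ereal_sup => _ [t _ <-].
rewrite (integral_int _ _ lw (fun u => enorm_ge0 _)) -EFinM lee_fin.
have e0 : 0 < expR (b * `|t|) := expR_gt0 _.
rewrite -mulrA ler_wpM2l ?invr_ge0 ?(ltW hr0)//.
have := hB t; rewrite mulNr expRN => H.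
by rewrite mulrC -ler_pdivlMr.
Qed.

Lemma in_YP b y : in_Y b y <-> continuous y /\ exists2 B, 0 <= B & Ybound b y B.
Proof.
split=> [[cy sy]|[cy [B B0 yB]]]; split=> //; last first.
  apply: le_lt_trans (ltry B); apply: ge_ereal_sup => _ [t _ <-]; rewrite lee_fin.
  have := yB t; rewrite mulNr expRN ler_pdivlMr ?expR_gt0//.
  by rewrite mulrC.
set S := ereal_sup _ in sy.
have Sge t : ((expR (b * `|t|) * enorm (y t))%:E <= S)%E by apply: ereal_sup_ubound; exists t.
have S0 : (0 <= S)%E.
  by apply: le_trans (Sge 0); rewrite lee_fin mulr_ge0 ?expR_ge0// enorm_ge0.
have Sfin : S \is a fin_num by rewrite ge0_fin_numE.
exists (fine S) => [|t]; first exact: fine_ge0.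
have := Sge t; rewrite -(fineK Sfin) lee_fin => H.
by rewrite mulNr expRN ler_pdivlMr ?expR_gt0// mulrC.
Qed.

Lemma borel_representative h : vlocint h -> exists2 k : R -> 'cV[R]_n,
  (forall i, borel_locint (fun u => k u i ord0)) & {ae mu, forall u, h u = k u}.
Proof.
move=> lh; have /choice[g Hg] i : exists g : R -> R, borel_locint g /\ {ae mu, forall u, h u i ord0 = g u}.
  by have [g bg fg] := lh i; exists g.
exists (fun u => \col_i g i u) => [i|].
  have -> : (fun u => (\col_i g i u) i ord0) = g i by apply/funext => u; rewrite mxE.
  exact: (Hg i).1.
by apply: ae_imp (ae_forall_ord (fun i => (Hg i).2)) => u H; apply/colP => i; rewrite mxE.
Qed.

End WeightedBounds.

Section Completeness.
Context {R : realType} {n : nat} {r0 b : R} (hr0 : 0 < r0).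
Local Notation mu := (@lebesgue_measure R).
Local Notation intg := integral_from_to.
Implicit Types (h y : R -> 'cV[R]_n).

(** Completeness of H_b for Borel functions. The sum G_k of the |u_j| with
    j >= k has window integrals below a geometric tail, so it is finite a.e.; the
    series converges absolutely there, and |v - u_0 - ... - u_(k-1)| <= G_k.
    Taking limits superior coordinatewise makes [v] Borel everywhere. *)
Lemma Hbound_series (u : nat -> R -> 'cV[R]_n) :
  (forall k i, borel_locint (fun t => u k t i ord0)) ->
  (forall k, Hbound r0 b (u k) (2 ^+ k)^-1) ->
  exists v : R -> 'cV[R]_n, (forall i, borel_locint (fun t => v t i ord0)) /\
    forall k, Hbound r0 b (fun t => v t - \sum_(j < k) u j t) (2 / 2 ^+ k).
Proof.
move=> bu Hu.
have lu k : vlocint (u k) by move=> i; exact: borel_locint_locint.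
pose a k t := enorm (u k t).
have a0 k t : 0 <= a k t by exact: enorm_ge0.
have la k : locint (a k) := locint_enorm (lu k).
have ma k : measurable_fun setT (a k).
  apply: (@measurableT_comp _ _ _ R R R (@Num.sqrt R)); first exact: (continuous_measurable_fun (@sqrt_continuous R)).
  by apply: measurable_sum => i; apply: measurable_funX; have [] := bu k i.
pose G k t := (\sum_(j <oo) (a (k + j)%N t)%:E)%E.
have mG k : measurable_fun setT (G k).
  apply: ge0_emeasurable_sum => [|j _]; [move=> j t _ _; by rewrite lee_fin|exact/measurable_EFinP].
have G0 k t : (0 <= G k t)%E by apply: nneseries_ge0 => j _ _; rewrite lee_fin.
have IG k t : (\int[mu]_(s in `[t, (t + r0)%R]) G k s <= (2 / 2 ^+ k * expR (- b * `|t|))%:E)%E.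
  rewrite integral_nneseries; [|exact: measurable_itv|move=> j|by move=> j x _; rewrite lee_fin]; last first.
    by apply/measurable_EFinP; exact: measurable_funS (ma _).
  apply: lime_le; first by apply: is_cvg_nneseries => j _ _; apply: integral_ge0 => s _; rewrite lee_fin.
  apply: nearW => N; under eq_bigr do rewrite (integral_int _ _ (la _) (a0 _)).
  rewrite sumEFin lee_fin.
  apply: (@le_trans _ _ (\sum_(0 <= j < N) (2 ^+ (k + j)%N)^-1 * expR (- b * `|t|))).
    by apply: ler_sum => j _; exact: Hu.
  rewrite -mulr_suml ler_wpM2r ?expR_ge0//.
  suff -> : \sum_(0 <= j < N) (2 ^+ (k + j)%N)^-1 = (2 / 2 ^+ k) * (1 - (2 ^+ N)^-1) :> R.
    by rewrite ger_pMr ?divr_gt0 ?exprn_gt0// gerBl invr_ge0 exprn_ge0.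
  elim: N => [|N IH]; first by rewrite big_geq// expr0 invr1 subrr mulr0.
  by rewrite big_nat_recr//= IH exprD exprS; field; rewrite !expf_neq0.
pose S i N t := \sum_(j < N) u j t i ord0.
pose v t := \col_(i < n) fine (limn_esup (fun N => (S i N t)%:E)) : 'cV[R]_n.
have mv i : measurable_fun setT (fun t => v t i ord0).
  have -> : (fun t => v t i ord0) = fine \o (fun t => limn_esup (fun N => (S i N t)%:E)).
    by apply/funext => t; rewrite mxE.
  apply: measurableT_comp => //; apply: measurable_fun_limn_esup => N.
  by apply/measurable_EFinP; apply: measurable_sum => j; have [] := bu j i.
have IG0 c d : (\int[mu]_(s in `[c, d]) `|G 0%N s| < +oo)%E.
  under eq_integral do rewrite gee0_abs//.
  have fin k : (\int[mu]_(s in `[c, (c + k%:R * r0)%R]) G 0%N s < +oo)%E.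
    elim: k => [|k IH]; first by rewrite mul0r addr0 set_itv1 integral_set1 ltry.
    have e1 : c + k.+1%:R * r0 = c + k%:R * r0 + r0 by rewrite -natr1; ring.
    have kr0 : 0 <= k%:R * r0 by rewrite mulr_ge0// ltW.
    rewrite (@itv_bndbnd_setU _ _ _ (BLeft (c + k%:R * r0))) ?bnd_simp; last 2 first.
    - by rewrite lerDl.
    - by rewrite e1 lerDl ltW.
    rewrite ge0_integral_setU//; last 2 first.
    - exact: measurable_funS (mG 0%N).
    - apply/disj_setPS => x /= []; rewrite !in_itv/= => /andP[_ h1] /andP[h2 _].
      by have := lt_le_trans h1 h2; rewrite ltxx.
    rewrite lte_add_pinfty//.
      apply: le_lt_trans IH; apply: ge0_subset_integral => //.
      - exact: measurable_funS (mG 0%N).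
      - exact: subset_itv_co_cc.
    by rewrite e1; apply: le_lt_trans (IG 0%N _) _; rewrite ltry.
  apply: le_lt_trans (fin (Num.truncn ((d - c) / r0)).+1).
  apply: ge0_subset_integral => //; first exact: measurable_funS (mG 0%N).
  move=> x /=; rewrite !in_itv/= => /andP[-> xd]; apply: le_trans xd _.
  by rewrite -lerBlDl -ler_pdivrMr//; exact/ltW/truncnS_gt.
have [_ fG0] := ereal_locint (mG 0%N) IG0.
have key : {ae mu, forall t, forall k, ((enorm (v t - \sum_(j < k) u j t))%:E <= G k t)%E}.
  apply: ae_imp fG0 => t fin k.
  have part l N : ((\sum_(0 <= j < N) a (l + j)%N t)%:E <= G l t)%E.
    by rewrite -sumEFin; apply: nneseries_lim_ge => j _ _; rewrite lee_fin.
  have cv i : (fun N => S i N t) @ \oo --> v t i ord0.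
    have cS : cvgn (fun N => S i N t).
      have -> : (fun N => S i N t) = series (fun j => u j t i ord0).
        by apply/funext => N; rewrite /S /series/= big_mkord.
      apply: normed_cvg; apply: nondecreasing_is_cvgn.
        by apply: (@nondecreasing_series _ _ xpredT) => j _ _; exact: normr_ge0.
      exists (fine (G 0%N t)) => _ [N _ <-]; rewrite -lee_fin fineK//.
      apply: le_trans (part 0%N N); rewrite lee_fin /series/=.
      by apply: ler_sum => j _; exact: enorm_coord.
    have cE : (fun N => (S i N t)%:E) @ \oo --> (limn (fun N => S i N t))%:E.
      by apply: cvg_EFin; [exact: nearW|exact: cS].
    have -> : v t i ord0 = limn (fun N => S i N t).
      rewrite mxE is_cvg_limn_esupE; last by apply/cvg_ex; eexists; exact: cE.
      by rewrite (cvg_lim _ cE).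
    exact: cS.
  apply/lee_addgt0Pr => e e0.
  have e1 : 0 < e / n.+1%:R by rewrite divr_gt0.
  have : \forall N \near \oo, (k <= N)%N /\ forall i : 'I_n, `|v t i ord0 - S i N t| < e / n.+1%:R.
    apply: filterI; first exact: nbhs_infty_ge.
    apply: (@filter_forall _ 'I_n (fun i N => `|v t i ord0 - S i N t| < e / n.+1%:R) \oo) => i.
    by have /cvgrPdist_lt := cv i; apply.
  move=> /filter_ex[N [kN HN]].
  have h1 : enorm (v t - \sum_(j < N) u j t) <= e.
    apply: le_trans (enorm_le_sum _) _.
    apply: (@le_trans _ _ (\sum_(i < n) (e / n.+1%:R))).
      by apply: ler_sum => i _; have := HN i; rewrite /S -summxE; rewrite -(_ : (v t - \sum_(j < N) u j t) i ord0 = v t i ord0 - (\sum_(j < N) u j t) i ord0) ?[LHS]mxE ?[X in _ + X]mxE// => /ltW.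
    rewrite sumr_const card_ord -[leLHS]mulr_natl mulrCA ger_pMr// ler_pdivrMr// mul1r ler_nat.
    exact: leqnSn.
  have h2 : \sum_(j < N) u j t - \sum_(j < k) u j t = \sum_(0 <= j < N - k) u (k + j)%N t.
    rewrite -!(big_mkord xpredT (fun j => u j t)) (@big_cat_nat _ _ _ k)//=.
    rewrite addrAC subrr add0r -{1}[k]add0n big_addn.
    by apply: eq_bigr => j _; rewrite addnC.
  have h3 : enorm (\sum_(0 <= j < N - k) u (k + j)%N t) <= \sum_(0 <= j < N - k) a (k + j)%N t.
    rewrite !big_mkord; elim: (N - k)%N => [|M IH]; first by rewrite !big_ord0 enorm0.
    rewrite big_ord_recr [in leRHS]big_ord_recr /=; apply: le_trans (enormD _ _) _.
    by apply: lerD.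
  have -> : v t - \sum_(j < k) u j t = (v t - \sum_(j < N) u j t) + (\sum_(j < N) u j t - \sum_(j < k) u j t).
    by rewrite addrA subrK.
  apply: (@le_trans _ _ (e + \sum_(0 <= j < N - k) a (k + j)%N t)%:E).
    by rewrite lee_fin; apply: le_trans (enormD _ _) _; rewrite lerD// h2.
  by rewrite EFinD addeC leeD2r.
have dv k : {ae mu, forall t, ((enorm (v t - \sum_(j < k) u j t))%:E <= G k t)%E}.
  by apply: ae_imp key => t; apply.
have bv i : borel_locint (fun t => v t i ord0).
  have [bG _] := ereal_locint (mG 0%N) IG0.
  apply: (borel_locint_dominated (mv i) bG).
  apply: ae_imp (ae_and fG0 (dv 0%N)) => t [ft]; rewrite big_ord0 subr0 => H.
  by rewrite -lee_fin /= fineK//; apply: le_trans H; rewrite lee_fin enorm_coord.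
exists v; split=> // k t.
have lvk : vlocint (fun t => v t - \sum_(j < k) u j t).
  apply: vlocintB; first by move=> i; exact: borel_locint_locint.
  move=> i; have -> : (fun t => (\sum_(j < k) u j t) i ord0) = fun t => \sum_(j < k) u j t i ord0.
    by apply/funext => s; rewrite summxE.
  by apply: locint_sum => j; exact: lu.
have lw := locint_enorm lvk; rewrite -lee_fin -integral_int//; last by move=> s; exact: enorm_ge0.
apply: le_trans (IG k t).
have [g [mg Ig] eg] := lw.
rewrite (@ge0_ae_eq_integral_any _ _ _ (fun s => `|g s|%:E))//.
- apply: ae_ge0_le_integral => //.
  + by apply/measurable_EFinP; apply: measurableT_comp => //; exact: measurable_funS mg.
  + exact: measurable_funS (mG k).
  by apply: ae_imp (ae_and eg (dv k)) => s [<- H] _; rewrite ger0_norm ?enorm_ge0.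
- by apply/measurable_EFinP; apply: measurableT_comp => //; exact: measurable_funS mg.
- by move=> s _; rewrite lee_fin enorm_ge0.
by apply: ae_imp eg => s <- _; rewrite ger0_norm ?enorm_ge0.
Qed.

End Completeness.

(** * The bounded solution operator *)

Section BoundOperations.
Context {R : realType} {n : nat} {r0 b : R}.
Implicit Types (h k y : R -> 'cV[R]_n) (c A B : R).

Lemma HboundZ c h A : vlocint h -> Hbound r0 b h A -> Hbound r0 b (fun u => c *: h u) (`|c| * A).
Proof.
move=> lh hA t; rewrite (_ : (fun u => _) = fun u => `|c| * enorm (h u)); last first.
  by apply/funext => u; rewrite enormZ.
by rewrite (intZ _ _ _ (locint_enorm lh)) -mulrA ler_wpM2l.
Qed.

Lemma HboundD h k A B : vlocint h -> vlocint k -> Hbound r0 b h A -> Hbound r0 b k B ->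
  Hbound r0 b (fun u => h u + k u) (A + B).
Proof.
move=> lh lk hA kB t; rewrite mulrDl; apply: le_trans (lerD (hA t) (kB t)).
have eh := locint_enorm lh; have ek := locint_enorm lk.
rewrite -intD//; apply: int_le; [exact/locint_enorm/vlocintD|exact: locintD|].
by apply: aeW => u _; exact: enormD.
Qed.

Lemma Hbound_le h A B : A <= B -> Hbound r0 b h A -> Hbound r0 b h B.
Proof. by move=> AB H t; apply: le_trans (H t) _; rewrite ler_wpM2r ?expR_ge0. Qed.

Lemma YboundZ c y A : Ybound b y A -> Ybound b (fun u => c *: y u) (`|c| * A).
Proof. by move=> H t; rewrite enormZ -mulrA ler_wpM2l. Qed.

Lemma YboundD y x A B : Ybound b y A -> Ybound b x B -> Ybound b (fun u => y u + x u) (A + B).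
Proof. by move=> yA xB t; rewrite mulrDl; apply: le_trans (enormD _ _) _; exact: lerD. Qed.

Lemma YboundB y x A B : Ybound b y A -> Ybound b x B -> Ybound b (fun u => y u - x u) (A + B).
Proof. by move=> yA xB t; rewrite mulrDl; apply: le_trans (enormB _ _) _; exact: lerD. Qed.

Lemma Ybound_le y A B : A <= B -> Ybound b y A -> Ybound b y B.
Proof. by move=> AB H t; apply: le_trans (H t) _; rewrite ler_wpM2r ?expR_ge0. Qed.

End BoundOperations.

Section BoundedSolutionOperator.
Context {R : realType} {n : nat} {r r0 : R} {eta : R -> R -> 'M[R]_n}.
Context (hr : 0 < r) (hr0 : 0 < r0) (heta : standing_assumptions r r0 eta).
Context {m : R -> R} (bm : borel_locint m) (m0 : forall t, 0 <= m t).
Context (Lm : {ae (@lebesgue_measure R), forall t, forall phi : Cseg r n,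
  \sum_(i < n) `|delay_op eta t phi i ord0| <= m t * cnorm phi}).
Local Notation mu := (@lebesgue_measure R).
Local Notation intg := integral_from_to.
Local Notation L := (delay_op eta).
Local Notation seg := (segment r).
Local Notation sol := (sol_from r eta).
Implicit Types (x y h f : R -> 'cV[R]_n) (phi psi : Cseg r n) (t s u c b A B M : R).

Let r_ge0 : 0 <= r. Proof. exact: ltW. Qed.
Let lm : locint m := borel_locint_locint bm.
Let rhs x h : continuous x -> vlocint h -> vlocint (fun u => L u (seg x u) + h u).
Proof. exact: (vlocint_rhs hr heta bm m0 Lm). Qed.

(** The integrated equation passes to the limit: the errors in [x], in the delay
    term and in the forcing are all bounded by a multiple of 2 ^ -k. *)
Lemma sol_from_limit s t x h (xk hk : nat -> R -> 'cV[R]_n) M : s <= t ->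
  continuous x -> vlocint h -> (forall k, vlocint (hk k)) -> 0 <= M ->
  (forall k, sol s (hk k) (xk k)) ->
  (forall k u, s - r <= u <= t -> enorm (x u - xk k u) <= M / 2 ^+ k) ->
  (forall k, intg s t (fun u => enorm (h u - hk k u)) <= M / 2 ^+ k) ->
  x t - x s = vint s t (fun u => L u (seg x u) + h u).
Proof.
move=> st cx lh lhk M0 Hk xkx hkh; have r1 := r_ge0.
apply/eqP; rewrite -subr_eq0; apply/eqP/enorm_le0.
set D := _ - vint _ _ _.
pose X := (2 + intg s t m + n%:R) * M.
have DX k : enorm D <= X / 2 ^+ k.
  have [cxk Hs] := Hk k; have cd := continuous_col_sub cx cxk.
  have lrx := rhs cx lh; have lrk := rhs cxk (lhk k).
  have lL : vlocint (fun u => L u (seg (fun v => x v - xk k v) u)).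
    exact: (vlocint_delay hr heta bm m0 Lm cd).
  have lH := vlocintB lh (lhk k).
  have eD : D = (x t - xk k t) - (x s - xk k s)
     - (vint s t (fun u => L u (seg (fun v => x v - xk k v) u)) + vint s t (fun u => h u - hk k u)).
    rewrite -(vintD s t lL lH).
    have -> : vint s t (fun u => L u (seg (fun v => x v - xk k v) u) + (h u - hk k u)) =
       vint s t (fun u => L u (seg x u) + h u) - vint s t (fun u => L u (seg (xk k) u) + hk k u).
      rewrite -(vintB s t lrx lrk); congr vint; apply/funext => u.
      by rewrite segmentB// (delay_opB hr heta) opprD addrACA.
    rewrite -(Hs t st) /D; set I := vint _ _ _.
    move: (x t) (x s) (xk k t) (xk k s) I => x1 x2 x3 x4 x5.
    by apply/colP => i; rewrite !mxE; ring.
  have h1 : enorm (x t - xk k t) <= M / 2 ^+ k by apply: xkx; rewrite lexx (le_trans _ st)// gerBl.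
  have h2 : enorm (x s - xk k s) <= M / 2 ^+ k by apply: xkx; rewrite st andbT gerBl.
  have h3 : enorm (vint s t (fun u => L u (seg (fun v => x v - xk k v) u))) <= intg s t m * (M / 2 ^+ k).
    apply: (@le_trans _ _ (intg s t (fun u => m u * (M / 2 ^+ k)))).
      apply: (enorm_vint_delay hr heta bm m0 Lm) => //; first exact: cst_continuous.
      move=> u /andP[su ut]; apply: cnorm_segment_le => // v /andP[uv vu].
      by apply: xkx; apply/andP; split; lra.
    rewrite (_ : (fun u => _) = fun u => M / 2 ^+ k * m u); last by apply/funext => u; rewrite mulrC.
    by rewrite intZ// mulrC.
  have h4 : enorm (vint s t (fun u => h u - hk k u)) <= n%:R * (M / 2 ^+ k).
    by apply: le_trans (enorm_vint _ _ lH) _; rewrite ler_wpM2l.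
  rewrite eD.
  have -> : X / 2 ^+ k = M / 2 ^+ k + M / 2 ^+ k + (intg s t m * (M / 2 ^+ k) + n%:R * (M / 2 ^+ k)).
    by rewrite /X; ring.
  apply: le_trans (enormB _ _) _; apply: lerD.
    by apply: le_trans (enormB _ _) _; exact: lerD.
  by apply: le_trans (enormD _ _) _; exact: lerD.
apply/ler_addgt0Pr => e e0; rewrite add0r.
exact: le_trans (DX _) (exp2_small X e0).
Qed.

(** This is [closed_graph_estimate] for Borel forcings, with the seminorm equal
    to the Y_b norm of the bounded solution; the graph is closed by
    [sol_from_limit]. Other forcings are a.e. equal to Borel ones. *)
Theorem bounded_solution_operator b : properly_admissible r r0 b eta ->
  exists2 C, 0 < C & forall h A, vlocint h -> 0 < A -> Hbound r0 b h A ->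
    exists y, [/\ continuous y, forall s, sol s h y & Ybound b y (C * A)].
Proof.
move=> adm.
pose N (h : R -> 'cV[R]_n) A := (forall i, borel_locint (fun u => h u i ord0)) /\ Hbound r0 b h A.
pose p (h : R -> 'cV[R]_n) B := vlocint h /\ exists y, [/\ continuous y, forall s, sol s h y & Ybound b y B].
pose E t := expR (- b * `|t|); have E0 t : 0 < E t := expR_gt0 _.
have lN h A : N h A -> vlocint h by move=> [bh _] i; exact: borel_locint_locint.
have NZ : forall c h A, N h A -> N (c *: h) (`|c| * A).
  move=> c h A Nh; split=> [i|]; last by apply: HboundZ; [exact: lN Nh|exact: Nh.2].
  rewrite (_ : (fun u => _) = fun u => c * h u i ord0); first exact: borel_locintZ (Nh.1 i).
  by apply/funext => u; rewrite mxE.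
have ND : forall h k A B, N h A -> N k B -> N (h + k) (A + B).
  move=> h k A B Nh Nk; split=> [i|].
    rewrite (_ : (fun u => _) = fun u => h u i ord0 + k u i ord0).
      exact: borel_locintD (Nh.1 i) (Nk.1 i).
    by apply/funext => u; rewrite mxE.
  by apply: HboundD; [exact: lN Nh|exact: lN Nk|exact: Nh.2|exact: Nk.2].
have pD : forall h k A B, p h A -> p k B -> p (h + k) (A + B).
  move=> h k A B [lh [x [cx sx xA]]] [lk [y [cy sy yB]]]; split; first exact: vlocintD.
  exists (fun u => x u + y u); split; [exact: continuous_col_add|move=> s|exact: YboundD].
  exact: (sol_fromD hr heta bm m0 Lm lh lk (sx s) (sy s)).
have pZ : forall c h A, p h A -> p (c *: h) (`|c| * A).
  move=> c h A [lh [x [cx sx xA]]]; split; first exact: vlocintZ.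
  exists (fun u => c *: x u); split; [exact: continuous_col_scale|move=> s|exact: YboundZ].
  have := sol_from_comb hr heta bm m0 Lm c lh (@vlocint0 _ n) (sx s) (sol_from0 hr heta s).
  by congr sol_from; apply/funext => u; rewrite addr0.
have ple : forall h A B, A <= B -> p h A -> p h B.
  move=> h A B AB [lh [y [cy sy yA]]]; split => //.
  by exists y; split => //; exact: Ybound_le yA.
have sep : forall h v B, (forall e, 0 < e -> N (h - v) e) -> p v B -> p h B.
  move=> h v B hv [lv [y [cy sy yB]]].
  have lhv : vlocint (fun u => h u - v u) := lN _ _ (hv 1 ltr01).
  have lh : vlocint h.
    by apply: vlocint_ae (vlocintD lhv lv) _; apply: aeW => u /=; rewrite subrK.
  split => //; exists y; split => // s; split => // t st.
  apply: (@sol_from_limit s t y h (fun=> y) (fun=> v) 0) => [//|//|//|k|//|k|k u k2|k].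
  - exact: lv.
  - exact: sy.
  - by rewrite subrr enorm0 mul0r.
  rewrite mul0r; apply/ler_addgt0Pr => e e0; rewrite add0r.
  have ts0 : 0 <= t - s by rewrite subr_ge0.
  have [D D0 HD] := window_bound hr0 b ts0.
  pose a := e / (D * expR (- b * `|s|)).
  have a0 : 0 < a by rewrite divr_gt0// mulr_gt0 ?expR_gt0.
  have := HD _ a (locint_enorm lhv) (fun u => enorm_ge0 _) (ltW a0) (hv a a0).2 s t st.
  rewrite addrC subrK => /(_ (lexx _)) /le_trans; apply; rewrite le_eqVlt; apply/orP; left; apply/eqP.
  have X0 : expR (- b * `|s|) != 0 by rewrite gt_eqF ?expR_gt0.
  by rewrite /a; field; rewrite X0 gt_eqF.
have complete : forall u : nat -> R -> 'cV[R]_n, (forall k, N (u k) (2 ^+ k)^-1) -> exists v,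
     (forall k, N (v - \sum_(j < k) u j) (2 / 2 ^+ k)) /\
     forall B, 0 <= B -> (forall k, p (u k) (B / 2 ^+ k)) -> p v (n%:R * 2 * B).
  move=> u Nu.
  have [v [bv Hv]] := Hbound_series hr0 (fun k => (Nu k).1) (fun k => (Nu k).2).
  have lu k : vlocint (u k) := lN _ _ (Nu k).
  have lv : vlocint v by move=> i; exact: borel_locint_locint.
  have esum k : \sum_(j < k) u j = fun t => \sum_(j < k) u j t by apply/funext => t; rewrite fct_sumE.
  have bsum k i : borel_locint (fun t => (\sum_(j < k) u j t) i ord0).
    elim: k => [|k IH].
      rewrite (_ : (fun u => _) = fun=> 0); first by apply: borel_locint_continuous => t; exact: cvg_cst.
      by apply/funext => t; rewrite big_ord0 mxE.
    rewrite (_ : (fun u => _) = fun t => (\sum_(j < k) u j t) i ord0 + u k t i ord0).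
      exact: borel_locintD IH ((Nu k).1 i).
    by apply/funext => t; rewrite big_ord_recr mxE.
  have lsum k : vlocint (fun t => \sum_(j < k) u j t) by move=> i; exact: borel_locint_locint.
  exists v; split=> [k|B B0 pB].
    rewrite esum; split; last exact: Hv.
    move=> i; rewrite (_ : (fun u => _) = fun t => v t i ord0 + -1 * (\sum_(j < k) u j t) i ord0).
      exact: borel_locintD (bv i) (borel_locintZ _ (bsum k i)).
    by apply/funext => t; rewrite !mxE mulN1r.
  split=> //; have /choice[y Hy] k := (pB k).2.
  pose S k t := \sum_(j < k) y j t.
  have SS k t : S k.+1 t - S k t = y k t by rewrite /S big_ord_recr/= addrAC subrr add0r.
  have sS k s : sol s (fun t => \sum_(j < k) u j t) (S k).
    elim: k => [|k IH].
      have := sol_from0 hr heta s; congr sol_from; apply/funext => t; by rewrite /S ?big_ord0.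
    have [_ sk _] := Hy k; have := sol_fromD hr heta bm m0 Lm (lsum k) (lu k) IH (sk s).
    by congr sol_from; apply/funext => t; rewrite /S big_ord_recr.
  have cS k : continuous (S k) by have [] := sS k 0.
  have yE k t : enorm (S k.+1 t - S k t) <= B * E t / 2 ^+ k.
    by rewrite SS mulrAC; have [_ _] := Hy k; apply.
  have Ele t T : `|t| <= T -> E t <= expR (`|b| * T).
    move=> tT; rewrite ler_expR; apply: le_trans (ler_norm _) _.
    by rewrite normrM normrN normr_id ler_wpM2l.
  have [F [cF HF]] : exists F : R -> 'cV[R]_n, continuous F /\
    forall t c, 0 <= c -> (forall k, enorm (S k.+1 t - S k t) <= c / 2 ^+ k) ->
      forall k, enorm (F t - S k t) <= n%:R * (2 * c) / 2 ^+ k.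
    apply: geometric_limit_continuous => // T; exists (B * expR (`|b| * T)).
      by rewrite mulr_ge0 ?expR_ge0.
    move=> k t tT; apply: le_trans (yE k t) _; rewrite ler_wpM2r ?invr_ge0 ?exprn_ge0//.
    by rewrite ler_wpM2l// Ele.
  have FS t k : enorm (F t - S k t) <= n%:R * 2 * B * E t / 2 ^+ k.
    have := HF t (B * E t) (mulr_ge0 B0 (ltW (E0 t))) (fun k => yE k t) k.
    by rewrite !mulrA.
  exists F; split => //; last first.
    by move=> t; have := FS t 0%N; rewrite /S big_ord0 subr0 expr0 divr1.
  move=> s; split => // t st.
  have ts0 : 0 <= t - s by rewrite subr_ge0.
  have [D D0 HD] := window_bound hr0 b ts0.
  pose M1 := n%:R * 2 * B * expR (`|b| * (`|s| + `|t| + r)); pose M2 := D * 2 * E s.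
  have M10 : 0 <= M1 by rewrite !mulr_ge0 ?expR_ge0.
  have M20 : 0 <= M2 by rewrite !mulr_ge0 ?expR_ge0// ltW.
  apply: (@sol_from_limit s t F v S (fun k t => \sum_(j < k) u j t) (M1 + M2)) => //.
  - exact: addr_ge0.
  - move=> k w /andP[sw wt]; apply: le_trans (FS w k) _; rewrite ler_wpM2r ?invr_ge0 ?exprn_ge0//.
    apply: (@le_trans _ _ M1); last by rewrite lerDl.
    rewrite ler_wpM2l ?mulr_ge0// Ele// ler_norml; have r1 := r_ge0.
    have h1 := ler_norm t; have h2 := ler_norm (- s); have h3 := normr_ge0 t; have h4 := normr_ge0 s.
    by rewrite normrN in h2; apply/andP; split; lra.
  move=> k.
  have lvk := vlocintB lv (lsum k).
  have := HD _ (2 / 2 ^+ k) (locint_enorm lvk) (fun u => enorm_ge0 _) _ (Hv k) s t st.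
  rewrite [s + _]addrC subrK => /(_ _ (lexx _)) H.
  apply: le_trans (H _) _; first by rewrite divr_ge0 ?exprn_ge0.
  have -> : D * (2 / 2 ^+ k) * expR (- b * `|s|) = M2 / 2 ^+ k by rewrite /M2 /E; ring.
  by rewrite ler_wpM2r ?invr_ge0 ?exprn_ge0// lerDr.
have [C C0 HC] : exists2 C, 0 < C & forall h A, 0 < A -> N h A -> p h (C * A).
  apply: (@closed_graph_estimate R (R -> 'cV[R]_n) N p (n%:R * 2)) => //.
  - by move=> h A B AB [bh hA]; split=> //; exact: Hbound_le hA.
  - split=> [i|t]; last by rewrite (_ : (fun u => _) = fun=> 0) ?int0 ?mul0r//; apply/funext => u; exact: enorm0.
    rewrite (_ : (fun u => _) = fun=> 0); first by apply: borel_locint_continuous => u; exact: cvg_cst.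
    by apply/funext => u; rewrite mxE.
  move=> h A [bh hA]; have Hh := Hbound_in_H hr0 bh hA.
  have [y [[yY yS] _]] := adm h Hh.
  have lh : vlocint h by move=> i; exact: borel_locint_locint.
  have [cy [B _ yB]] := (in_YP b y).1 yY.
  have [_ sy] := (nonhom_solutionP hr heta bm m0 Lm y lh).1 yS.
  by exists B; split => //; exists y.
exists C => // h A lh A0 hA.
have [k bk hk] := borel_representative lh.
have lk : vlocint k by move=> i; exact: borel_locint_locint.
have NkA : N k A.
  split=> // t; rewrite -(int_eq_ae _ _ (locint_enorm lk) (f := fun u => enorm (h u)))//.
  by apply: ae_imp hk => u ->.
have [_ [y [cy sy yB]]] := HC k A A0 NkA.
exists y; split => // s; apply: (sol_from_ae hr heta bm m0 Lm lh _ (sy s)).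
by apply: ae_imp hk => u ->.
Qed.

End BoundedSolutionOperator.

(** * Splitting a state with a bounded solution *)

Section IntervalEquality.
Context {R : realType}.
Local Notation mu := (@lebesgue_measure R).
Local Notation intg := integral_from_to.
Implicit Types (s t a u : R).

Lemma int_eq_on s t (f g : R -> R) : locint f -> locint g ->
  {ae mu, forall u, s <= u <= t -> f u = g u} -> intg s t f = intg s t g.
Proof.
move=> lf lg fg; apply/le_anti/andP; split; apply: int_le => //; apply: ae_imp fg => u H /H -> //.
Qed.

Lemma vint_eq_on {n} s t (f g : R -> 'cV[R]_n) : vlocint f -> vlocint g ->
  {ae mu, forall u, s <= u <= t -> f u = g u} -> vint s t f = vint s t g.
Proof.
move=> lf lg fg; apply/colP => i; rewrite !mxE; apply: int_eq_on => //.
by apply: ae_imp fg => u H /H ->.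
Qed.

Lemma vlocint_indic {n} (A : set R) (f : R -> 'cV[R]_n) : measurable A -> vlocint f ->
  vlocint (fun u => \1_A u *: f u).
Proof.
move=> mA lf i; rewrite (_ : (fun u => _) = fun u => \1_A u * f u i ord0); first exact: locint_indic.
by apply/funext => u; rewrite mxE.
Qed.

Lemma vlocint_cst {n} (v : 'cV[R]_n) : @vlocint R n (fun=> v).
Proof. by apply: vlocint_continuous => t; exact: cvg_cst. Qed.

(** The ramp that switches a solution on in [forcing_of_state]. *)
Lemma int_ramp a s t : s <= t ->
  intg s t (\1_(`]-oo, a])) = Num.max 0 (a - s) - Num.max 0 (a - t).
Proof.
have l1 : locint (\1_(`]-oo, a]) : R -> R).
  rewrite (_ : \1_ _ = fun u => \1_(`]-oo, a]) u * 1); last by apply/funext => u; rewrite mulr1.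
  by apply: locint_indic; [exact: measurable_itv|exact: locint_cst].
have lo s' t' : s' <= t' -> t' <= a -> intg s' t' (\1_(`]-oo, a])) = t' - s'.
  move=> st ta; rewrite (int_eq_on l1 (@locint_cst R 1)) ?int_cst ?mul1r//.
  by apply: aeW => u /andP[_ ut]; rewrite indicE mem_set//= in_itv/= (le_trans ut).
have hi s' t' : a <= s' -> intg s' t' (\1_(`]-oo, a])) = 0.
  move=> as'; rewrite (int_eq_on l1 (@locint_cst R 0)) ?int0//.
  apply: ae_imp (ae_neq a) => u ua /andP[su _]; rewrite indicE memNset//= in_itv/=.
  by apply/negP; rewrite -ltNge lt_neqAle eq_sym ua (le_trans as').
move=> st; have [ta|at'] := leP t a.
  by rewrite lo// !max_r ?subr_ge0 ?(le_trans st)//; ring.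
rewrite (max_l (_ : a - t <= 0)) ?subr_le0 ?ltW// subr0.
have [sa|as'] := leP s a; last by rewrite hi ?max_l ?subr_le0 ?ltW.
by rewrite (int_cat l1 sa (ltW at')) lo// hi// addr0 max_r ?subr_ge0.
Qed.

End IntervalEquality.

Section Green.
Context {R : realType} {n : nat} {r r0 : R} {eta : R -> R -> 'M[R]_n}.
Context (hr : 0 < r) (hr0 : 0 < r0) (heta : standing_assumptions r r0 eta).
Context {m : R -> R} (bm : borel_locint m) (m0 : forall t, 0 <= m t).
Context (Lm : {ae (@lebesgue_measure R), forall t, forall phi : Cseg r n,
  \sum_(i < n) `|delay_op eta t phi i ord0| <= m t * cnorm phi}).
Local Notation mu := (@lebesgue_measure R).
Local Notation intg := integral_from_to.
Local Notation L := (delay_op eta).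
Local Notation seg := (segment r).
Local Notation sol := (sol_from r eta).
Implicit Types (x y h f : R -> 'cV[R]_n) (phi psi : Cseg r n) (t s u c b A B M : R).

Let r_ge0 : 0 <= r. Proof. exact: ltW. Qed.
Let lm : locint m := borel_locint_locint bm.
Let rhs x h : continuous x -> vlocint h -> vlocint (fun u => L u (seg x u) + h u).
Proof. exact: (vlocint_rhs hr heta bm m0 Lm). Qed.

Lemma enorm_Cseg_extend phi t : enorm (Cseg_extend phi t) <= cnorm phi.
Proof. by apply: enorm_le_cnorm; [exact: r_ge0|apply: clamp_itv; rewrite oppr_le0]. Qed.

(** [w] is x - d after [s] and 0 before, where [d] continues the history of [x]
    on [s - r, s] by phi(0) times a ramp that reaches 0 at s + 1. Substituting
    [w] into the equation leaves the slope phi(0) of the ramp and the term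
    L(t) d_t, which vanishes as soon as t - r >= s + 1. *)
Lemma forcing_of_state s phi x : sol s (fun=> 0) x -> seg x s = phi ->
  exists h w, [/\ vlocint h, forall s', sol s' h w, forall t, t <= s -> w t = 0,
    forall t, s - r <= t -> enorm (x t - w t) <= if t <= s + 1 then cnorm phi else 0 &
    {ae mu, forall t, enorm (h t) <= if s <= t <= s + 1 + r then (1 + m t) * cnorm phi else 0}].
Proof.
move=> [cx Hx] xs; have r1 := r_ge0.
pose rho t := Num.min 1 (Num.max 0 (s + 1 - t)).
pose d t := rho t *: Cseg_extend phi (t - s).
pose w t := x (Num.max t s) - d (Num.max t s).
pose I1 : set R := `]s, +oo[%classic; pose I2 : set R := `]-oo, s + 1]%classic.
pose h t := \1_I1 t *: (\1_I2 t *: phi 0 + L t (seg d t)).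
have I1T t : s < t -> \1_I1 t = 1 :> R by move=> st; rewrite indicE mem_set// /I1/= in_itv/= andbT.
have I1F t : t <= s -> \1_I1 t = 0 :> R.
  by move=> ts; rewrite indicE memNset// /I1/= in_itv/= andbT; apply/negP; rewrite -leNgt.
have I2F t : s + 1 < t -> \1_I2 t = 0 :> R.
  by move=> ts; rewrite indicE memNset// /I2/= in_itv/=; apply/negP; rewrite -ltNge.
have crho : continuous rho.
  move=> t; apply: (@continuous_min _ _ (cst 1) (fun t => Num.max 0 (s + 1 - t))).
    exact: cvg_cst.
  apply: (@continuous_max _ _ (cst 0) (fun t => s + 1 - t)); first exact: cvg_cst.
  by apply: cvgB; [exact: cvg_cst|exact: cvg_id].
have cd : continuous d.
  move=> t; apply: cvgZ; first exact: crho.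
  apply: (@continuous_comp _ _ _ (fun t => t - s) (Cseg_extend phi)).
    by apply: cvgB; [exact: cvg_id|exact: cvg_cst].
  exact: continuous_Cseg_extend.
have cmax : continuous (fun t => Num.max t s).
  by move=> t; apply: (@continuous_max _ _ id (cst s)); [exact: cvg_id|exact: cvg_cst].
have cw : continuous w.
  apply: continuous_col_sub => t.
    by apply: (@continuous_comp _ _ _ (fun t => Num.max t s) x); [exact: cmax|exact: cx].
  by apply: (@continuous_comp _ _ _ (fun t => Num.max t s) d); [exact: cmax|exact: cd].
have rho01 t : 0 <= rho t <= 1 by rewrite /rho le_min ler01 le_max lexx ge_min lexx.
have rho_lo t : t <= s -> rho t = 1.
  by move=> ts; apply: min_l; rewrite le_max; apply/orP; right; lra.
have rho_hi t : s <= t -> rho t = Num.max 0 (s + 1 - t).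
  by move=> st; apply: min_r; rewrite ge_max ler01/=; lra.
have dx t : s - r <= t <= s -> d t = x t.
  move=> /andP[h1 h2]; rewrite /d rho_lo// scale1r Cseg_extendE; last by apply/andP; split; lra.
  by rewrite -xs segmentE ?subrKC//; apply/andP; split; lra.
have dhi t : s <= t -> d t = Num.max 0 (s + 1 - t) *: phi 0.
  move=> st; rewrite /d rho_hi//; congr (_ *: _).
  rewrite /Cseg_extend /clamp (min_idPr _) ?subr_ge0// max_r// oppr_le0//.
(* x and d agree on [s - r, s]; hence w is continuous at s *)
have ds : x s = d s by rewrite dx// lexx andbT gerBl.
have wlo t : t <= s -> w t = 0 by move=> ts; rewrite /w max_r// ds subrr.
have whi t : s <= t -> w t = x t - d t by move=> st; rewrite /w max_l.
have xw t : s - r <= t -> x t - w t = d t.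
  move=> st; have [ts|ts] := leP t s; first by rewrite wlo// subr0 dx// st.
  by rewrite whi ?(ltW ts)// opprB addrC subrK.
have d_le t : enorm (d t) <= if t <= s + 1 then cnorm phi else 0.
  have rt := rho01 t; case: ifP => [_|/negbT]; last first.
    rewrite -ltNge => st; rewrite /d /rho (max_l (_ : s + 1 - t <= 0)); last by rewrite subr_le0 ltW.
    by rewrite min_r// scale0r enorm0.
  move: rt => /andP[h1 h2]; rewrite enormZ ger0_norm//.
  by apply: le_trans (enorm_Cseg_extend phi (t - s)); rewrite ler_piMl ?enorm_ge0.
have lLd : vlocint (fun t => L t (seg d t)) := vlocint_delay hr heta bm m0 Lm cd.
have lI2 : vlocint (fun t => \1_I2 t *: phi 0).
  by apply: vlocint_indic; [exact: measurable_itv|exact: vlocint_cst].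
have lh : vlocint h by apply: vlocint_indic; [exact: measurable_itv|exact: vlocintD].
have lF := rhs cw lh.
exists h, w; split => //.
- have lo s' t : s' <= t -> t <= s -> w t - w s' = vint s' t (fun u => L u (seg w u) + h u).
    move=> st ts; rewrite !wlo ?(le_trans st)// subrr.
    rewrite (vint_eq_on lF (vlocint_cst 0)) ?vint0//; apply: aeW => u /andP[_ ut].
    rewrite (_ : seg w u = 0); last first.
      by rewrite -(segment0 u); apply: segment_ext => v /andP[_ vu]; apply: wlo; rewrite (le_trans vu)// (le_trans ut).
    by rewrite (delay_op0 hr heta) add0r /h I1F ?scale0r// (le_trans ut).
  have hi s' t : s <= s' -> s' <= t -> w t - w s' = vint s' t (fun u => L u (seg w u) + h u).
    move=> ss st; have lx : vlocint (fun u => L u (seg x u)) := vlocint_delay hr heta bm m0 Lm cx.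
    rewrite (vint_eq_on lF (vlocintD lI2 lx)); last first.
      apply: ae_imp (ae_neq s) => u us /andP[su ut].
      have su' : s < u by rewrite lt_neqAle eq_sym us (le_trans ss).
      rewrite /h I1T// scale1r.
      have e : seg w u + seg d u = seg x u.
        rewrite -segmentD//; apply: segment_ext => v /andP[vu _].
        by rewrite -xw ?subrKC//; lra.
      by rewrite addrCA -[L u (seg w u) + _](delay_opD hr heta) e.
    rewrite (vintD s' t lI2 lx).
    have -> : vint s' t (fun u => L u (seg x u)) = x t - x s'.
      have [_ Hx'] := sol_from_restart hr heta bm m0 Lm (@vlocint0 _ n) ss (conj cx Hx).
      by rewrite Hx'//; congr vint; apply/funext => u; rewrite addr0.
    have -> : vint s' t (fun u => \1_I2 u *: phi 0) = d s' - d t.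
      rewrite !dhi ?(le_trans ss)// -scalerBl -int_ramp//.
      apply/colP => i; rewrite !mxE [RHS]mulrC -intZ.
        by congr intg; apply/funext => u; rewrite mxE mulrC.
      rewrite (_ : \1_ _ = fun u => \1_I2 u * 1); last by apply/funext => u; rewrite mulr1.
      by apply: locint_indic; [exact: measurable_itv|exact: locint_cst].
    rewrite !whi ?(le_trans ss)//; move: (x t) (x s') (d t) (d s') => x1 x2 x3 x4.
    by apply/colP => i; rewrite !mxE; ring.
  move=> s'; split=> // t st.
  have [ts|ts] := leP t s; first exact: lo.
  have [ss|ss] := leP s s'; first exact: hi.
  have lo' := lo s' s (ltW ss) (lexx s); have hi' := hi s t (lexx s) (ltW ts).
  by rewrite (vint_cat lF (ltW ss) (ltW ts)) -lo' -hi' [RHS]addrC addrA subrK.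
- by move=> t st; rewrite xw.
apply: ae_imp Lm => t Lt; rewrite /h.
have [ts|ts] := leP t s.
  rewrite I1F// scale0r enorm0; case: ifP => // _.
  by rewrite mulr_ge0 ?addr_ge0// cnorm_ge0.
rewrite I1T// scale1r (ltW ts)/=.
have [tr|tr] := leP t (s + 1 + r).
  apply: le_trans (enormD _ _) _; rewrite mulrDl mul1r; apply: lerD.
    rewrite enormZ; apply: (@le_trans _ _ (1 * enorm (phi 0))).
      by rewrite ler_wpM2r ?enorm_ge0// indicE; case: (_ \in _); rewrite ?normr1 ?normr0.
    by rewrite mul1r; apply: enorm_le_cnorm => //; rewrite lexx andbT oppr_le0.
  apply: le_trans (enorm_le_sum _) _; apply: le_trans (Lt _) _; rewrite ler_wpM2l//.
  apply: cnorm_segment_le => // u _; apply: le_trans (d_le u) _; case: ifP => // _.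
  exact: cnorm_ge0.
rewrite (_ : seg d t = 0); last first.
  rewrite -(segment0 t); apply: segment_ext => v /andP[vt _].
  by apply: enorm_le0; apply: le_trans (d_le v) _; case: ifP => //; lra.
by rewrite (delay_op0 hr heta) addr0 I2F ?scale0r ?enorm0//; lra.
Qed.

End Green.

Lemma weight_near {R : realType} (b beta l s t u : R) : `|b| <= beta -> `|u - t| <= l ->
  expR (b * (`|s| - `|u|)) <= expR (beta * l) * expR (b * (`|s| - `|t|)).
Proof.
move=> bb ul; rewrite -expRD ler_expR.
have -> : b * (`|s| - `|u|) = b * (`|t| - `|u|) + b * (`|s| - `|t|) by ring.
rewrite lerD2r; apply: le_trans (ler_norm _) _; rewrite normrM ler_pM//.
by apply: le_trans (ler_dist_dist _ _) _; rewrite distrC.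
Qed.

Section GreenBounds.
Context {R : realType} {n : nat} {r r0 : R} {eta : R -> R -> 'M[R]_n}.
Context (hr : 0 < r) (hr0 : 0 < r0) (heta : standing_assumptions r r0 eta).
Context {m : R -> R} (bm : borel_locint m) (m0 : forall t, 0 <= m t).
Context (Lm : {ae (@lebesgue_measure R), forall t, forall phi : Cseg r n,
  \sum_(i < n) `|delay_op eta t phi i ord0| <= m t * cnorm phi}).
Context {Mm : R} (HM : forall t, integral_from_to t (t + r0) m <= Mm).
Local Notation mu := (@lebesgue_measure R).
Local Notation intg := integral_from_to.
Local Notation L := (delay_op eta).
Local Notation seg := (segment r).
Local Notation sol := (sol_from r eta).
Local Notation T := (evolution (r := r) eta).
Implicit Types (x y h v w : R -> 'cV[R]_n) (phi psi : Cseg r n) (t s u c b A B M : R).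

Let r_ge0 : 0 <= r. Proof. exact: ltW. Qed.
Let lm : locint m := borel_locint_locint bm.

(** Only windows within distance r0 + 1 + r of [s] meet the support of [h], and
    over that distance the weight changes by a bounded factor. *)
Lemma Hbound_forcing b : exists2 C, 0 < C & forall s A h, vlocint h -> 0 <= A ->
  {ae mu, forall t, enorm (h t) <= if s <= t <= s + 1 + r then (1 + m t) * A else 0} ->
  Hbound r0 b h (C * A * expR (b * `|s|)).
Proof.
have r1 := r_ge0; have r01 := hr0.
have Mm0 : 0 <= Mm := le_trans (int_ge0 0 (0 + r0) m0) (HM 0).
pose l := r0 + 1 + r.
exists ((r0 + Mm) * expR (`|b| * l)); first by rewrite mulr_gt0 ?expR_gt0//; lra.
move=> s A h lh A0 hb t; have le := locint_enorm lh.
have [/andP[h1 h2]|H] := boolP ((t <= s + 1 + r) && (s <= t + r0)).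
  have l1 : locint (fun u => 1 + m u) by apply: locintD => //; exact: locint_cst.
  apply: (@le_trans _ _ ((r0 + Mm) * A)).
    apply: (@le_trans _ _ (intg t (t + r0) (fun u => A * (1 + m u)))).
      apply: int_le => //; first exact: locintZ.
      apply: ae_imp hb => u hu _; apply: le_trans hu _; rewrite mulrC.
      by case: ifP => // _; rewrite mulr_ge0// addr_ge0.
    rewrite intZ// mulrC ler_wpM2r// intD//; last exact: locint_cst.
    rewrite int_cst; last by rewrite lerDl ltW.
    by rewrite mul1r [t + _]addrC addrK lerD2l [r0 + _]addrC.
  have H1 : 1 <= expR (`|b| * l) * expR (b * (`|s| - `|t|)).
    rewrite -[leLHS]expR0 -(mulr0 b) -{1}(subrr `|s|); apply: weight_near => //.
    by rewrite /l ler_norml; apply/andP; split; lra.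
  have -> : (r0 + Mm) * expR (`|b| * l) * A * expR (b * `|s|) * expR (- b * `|t|) =
    (r0 + Mm) * A * (expR (`|b| * l) * expR (b * (`|s| - `|t|))).
    by rewrite mulrBr -mulNr expRD; ring.
  by rewrite ler_peMr// mulr_ge0//; lra.
have -> : intg t (t + r0) (fun u => enorm (h u)) = 0.
  rewrite (int_eq_on le (@locint_cst R 0)) ?int0//.
  apply: ae_imp hb => u hu /andP[tu ut]; apply/le_anti; rewrite enorm_ge0 andbT.
  apply: le_trans hu _; case: ifP => // /andP[su us].
  by move: H; rewrite (le_trans tu us) (le_trans su ut).
by rewrite !mulr_ge0 ?expR_ge0//; lra.
Qed.

Context {b1 b2 : R} (b1_lt0 : b1 < 0) (b2_gt0 : 0 < b2).
Context (adm1 : properly_admissible r r0 b1 eta) (adm2 : properly_admissible r r0 b2 eta).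

Let b12 : b1 <= b2. Proof. exact/ltW/(lt_trans b1_lt0). Qed.

(** Both [v] and 0 are the solution in Y_{b1} for the forcing 0. *)
Lemma bounded_hom_zero v B : (forall s, sol s (fun=> 0) v) -> Ybound b1 v B -> v = fun=> 0.
Proof.
move=> Hv vB.
have H0 : in_H r0 b1 (fun=> 0 : 'cV[R]_n).
  apply: (@Hbound_in_H _ _ _ hr0 _ _ 0) => [i|t].
    rewrite (_ : (fun u => _) = fun=> 0); last by apply/funext => u; rewrite mxE.
    by apply: borel_locint_continuous => t; exact: cvg_cst.
  by rewrite (_ : (fun u => _) = fun=> 0) ?int0 ?mul0r//; apply/funext => u; rewrite enorm0.
have [y [_ uy]] := adm1 H0.
have solP z : (forall s, sol s (fun=> 0) z) -> (exists B, Ybound b1 z B) ->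
    in_Y b1 z /\ nonhom_solution r eta (fun=> 0) z.
  move=> Hz [D zD]; have [cz _] := Hz 0; split.
    apply/in_YP; split => //; exists `|D|; first exact: normr_ge0.
    exact: Ybound_le (ler_norm D) zD.
  by apply/(nonhom_solutionP hr heta bm m0 Lm _ (@vlocint0 _ n)).
rewrite -(uy v); last by apply: solP => //; exists B.
apply: uy; apply: solP => [s|]; first exact: (sol_from0 hr heta).
by exists 0 => t; rewrite enorm0 mul0r.
Qed.

(** v = w - y with [w] and its forcing [h] from [forcing_of_state] and [y] the
    bounded solution for [h]. The same [y] satisfies both weighted bounds: the
    solution in Y_{b2} also lies in Y_{b1}, where solutions are unique. *)
Lemma splitting_estimates : exists2 C, 1 <= C & forall s phi, exists v, [/\ forall s', sol s' (fun=> 0) v,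
  forall b t, b = b1 \/ b = b2 -> t <= s ->
    cnorm (seg v t) <= C * cnorm phi * expR (b * (`|s| - `|t|)) &
  forall b t, b = b1 \/ b = b2 -> s <= t ->
    cnorm (T t s (phi - seg v s)) <= C * cnorm phi * expR (b * (`|s| - `|t|))].
Proof.
have r1 := r_ge0; have b1n := b1_lt0; have b2p := b2_gt0.
have [C1 C10 HC1] := bounded_solution_operator hr hr0 heta bm m0 Lm adm1.
have [C2 C20 HC2] := bounded_solution_operator hr hr0 heta bm m0 Lm adm2.
have [H1 H10 HH1] := Hbound_forcing b1; have [H2 H20 HH2] := Hbound_forcing b2.
pose D := C1 * H1 + C2 * H2; have D0 : 0 < D by rewrite addr_gt0// mulr_gt0.
pose beta := b2 - b1.
have bbeta b : b = b1 \/ b = b2 -> `|b| <= beta by rewrite /beta => -[->|->]; rewrite ler_norml; apply/andP; split; lra.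
have beta0 : 0 <= beta by rewrite /beta; lra.
pose E1 := expR (beta * (1 + r)); pose E2 := expR (beta * r).
have E11 : 1 <= E1 by rewrite /E1 -[leLHS]expR0 ler_expR mulr_ge0//; lra.
have E21 : 1 <= E2 by rewrite /E2 -[leLHS]expR0 ler_expR mulr_ge0//; lra.
have DE : D * E2 <= (E1 + D) * E2 by rewrite ler_wpM2r//; lra.
exists ((E1 + D) * E2).
  by rewrite -[leLHS]mulr1 ler_pM//; lra.
move=> s phi; set A := cnorm phi.
have [A0|A0] : A = 0 \/ 0 < A.
  by have := cnorm_ge0 r_ge0 phi; rewrite le_eqVlt => /predU1P[->|]; [left|right].
  exists (fun=> 0); have -> : phi = 0 by apply: (cnorm_le0 r_ge0); rewrite -/A A0.
  split=> [s'|b t _ _|b t _ st]; first exact: (sol_from0 hr heta).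
    by rewrite segment0 (cnorm0 r_ge0) A0 mulr0 mul0r.
  by rewrite segment0 subrr (evolution0 hr heta bm m0 Lm st) (cnorm0 r_ge0) A0 mulr0 mul0r.
have [x [Hx xs Tx]] := evolution_exists hr heta bm m0 Lm s phi.
have [h [w [lh Hw wlo xw hb]]] := forcing_of_state hr heta bm m0 Lm Hx xs.
have Hb1 := HH1 s A h lh (ltW A0) hb; have Hb2 := HH2 s A h lh (ltW A0) hb.
have pos H b : 0 < H -> 0 < H * A * expR (b * `|s|) by move=> H0; rewrite !mulr_gt0 ?expR_gt0.
have [y1 [cy1 sy1 yb1]] := HC1 h _ lh (pos _ _ H10) Hb1.
have [y [cy sy yb2]] := HC2 h _ lh (pos _ _ H20) Hb2.
(* the solution in the smaller space Y_{b2} is the one in Y_{b1} *)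
have y1y : y1 = y.
  have Hd s' : sol s' (fun=> 0) (fun u => y1 u - y u).
    have := sol_fromB hr heta bm m0 Lm lh lh (sy1 s') (sy s').
    by congr sol_from; apply/funext => u; rewrite subrr.
  have yb1' : Ybound b1 y (C2 * (H2 * A * expR (b2 * `|s|))).
    move=> t; apply: le_trans (yb2 t) _; rewrite ler_wpM2l ?(ltW (mulr_gt0 _ (pos _ _ _)))//.
    by rewrite ler_expR ler_wpM2r// lerN2.
  have := bounded_hom_zero Hd (YboundB yb1 yb1') => H.
  by apply/funext => t; apply/eqP; rewrite -subr_eq0; apply/eqP; exact: (congr1 (@^~ t) H).
have yb b t : b = b1 \/ b = b2 -> enorm (y t) <= D * A * expR (b * (`|s| - `|t|)).
  move=> hb'; rewrite mulrBr -[- (b * _)]mulNr expRD.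
  have e1 : 0 <= A * expR (b * `|s|) * expR (- b * `|t|) by rewrite !mulr_ge0 ?expR_ge0// ltW.
  have p1 := mulr_gt0 C10 H10; have p2 := mulr_gt0 C20 H20.
  case: hb' e1 => -> e1.
    have := yb1 t; rewrite y1y => /le_trans; apply.
    have -> : C1 * (H1 * A * expR (b1 * `|s|)) * expR (- b1 * `|t|) = C1 * H1 * (A * expR (b1 * `|s|) * expR (- b1 * `|t|)) by ring.
    rewrite (_ : D * A * _ = D * (A * expR (b1 * `|s|) * expR (- b1 * `|t|))); last by ring.
    by rewrite ler_wpM2r// /D lerDl ltW.
  have := yb2 t => /le_trans; apply.
  have -> : C2 * (H2 * A * expR (b2 * `|s|)) * expR (- b2 * `|t|) = C2 * H2 * (A * expR (b2 * `|s|) * expR (- b2 * `|t|)) by ring.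
  rewrite (_ : D * A * _ = D * (A * expR (b2 * `|s|) * expR (- b2 * `|t|))); last by ring.
  by rewrite ler_wpM2r// /D lerDr ltW.
have Hv s' : sol s' (fun=> 0) (fun u => w u - y u).
  have := sol_fromB hr heta bm m0 Lm lh lh (Hw s') (sy s').
  by congr sol_from; apply/funext => u; rewrite subrr.
have [cv _] := Hv 0.
have near_w b t u c : b = b1 \/ b = b2 -> t - r <= u <= t -> 0 <= c ->
    c * A * expR (b * (`|s| - `|u|)) <= c * E2 * A * expR (b * (`|s| - `|t|)).
  move=> hb' /andP[h1 h2] c0.
  have -> : c * E2 * A * expR (b * (`|s| - `|t|)) = c * A * (E2 * expR (b * (`|s| - `|t|))) by ring.
  rewrite ler_wpM2l ?mulr_ge0 ?(ltW A0)//; apply: weight_near; first exact: bbeta.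
  by rewrite ler_norml; apply/andP; split; lra.
exists (fun u => w u - y u); split => // b t hb' ts.
  apply: cnorm_segment_le => // u /andP[tu ut].
  rewrite wlo ?(le_trans ut)// sub0r enormN; apply: le_trans (yb b u hb') _.
  apply: le_trans (near_w b t u D hb' _ (ltW D0)) _; first by rewrite tu.
  by rewrite ler_wpM2r ?expR_ge0// ler_wpM2r// ltW.
have Hxv := sol_fromB hr heta bm m0 Lm (@vlocint0 _ n) (@vlocint0 _ n) Hx (Hv s).
have Hxv0 : sol s (fun=> 0) (fun u => x u - (w u - y u)).
  by move: Hxv; congr sol_from; apply/funext => u; rewrite subrr.
have [cx _] := Hx; have [cxv _] := Hxv0.
rewrite -xs -segmentB// (evolution_sol hr heta bm m0 Lm Hxv0 ts).
apply: cnorm_segment_le => // u /andP[tu ut].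
rewrite opprB addrA addrAC; apply: le_trans (enormD _ _) _.
apply: le_trans (near_w b t u (E1 + D) hb' _ _); [|by rewrite tu|by lra].
rewrite 2!mulrDl; apply: lerD; last exact: yb.
have su : s - r <= u by lra.
apply: le_trans (xw u su) _; rewrite -/A; case: ifP => [us|_]; last first.
  by rewrite !mulr_ge0 ?expR_ge0//; lra.
have -> : E1 * A * expR (b * (`|s| - `|u|)) = A * (E1 * expR (b * (`|s| - `|u|))) by ring.
rewrite ler_peMr ?(ltW A0)// -[leLHS]expR0 -(mulr0 b) -{1}(subrr `|s|); apply: weight_near; first exact: bbeta.
by rewrite ler_norml; apply/andP; split; lra.
Qed.

End GreenBounds.

(** * From admissibility to a dichotomy *)

Section Splitting.
Context {R : realType} {n : nat} {r r0 : R} {eta : R -> R -> 'M[R]_n}.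
Context (hr : 0 < r) (hr0 : 0 < r0) (heta : standing_assumptions r r0 eta).
Context {m : R -> R} (bm : borel_locint m) (m0 : forall t, 0 <= m t).
Context (Lm : {ae (@lebesgue_measure R), forall t, forall phi : Cseg r n,
  \sum_(i < n) `|delay_op eta t phi i ord0| <= m t * cnorm phi}).
Context {Mm : R} (HM : forall t, integral_from_to t (t + r0) m <= Mm).
Context {b1 b2 : R} (b1_lt0 : b1 < 0) (b2_gt0 : 0 < b2).
Context (adm1 : properly_admissible r r0 b1 eta) (adm2 : properly_admissible r r0 b2 eta).
Local Notation mu := (@lebesgue_measure R).
Local Notation intg := integral_from_to.
Local Notation L := (delay_op eta).
Local Notation seg := (segment r).
Local Notation sol := (sol_from r eta).
Local Notation T := (evolution (r := r) eta).
Implicit Types (x y h v w : R -> 'cV[R]_n) (phi psi : Cseg r n) (t s u c b A B M : R).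

Let r_ge0 : 0 <= r. Proof. exact: ltW. Qed.
Let T_linear t s c phi psi : s <= t -> T t s (c *: phi + psi) = c *: T t s phi + T t s psi.
Proof. exact: (evolution_linear hr heta bm m0 Lm). Qed.
Let T_B t s phi psi : s <= t -> T t s (phi - psi) = T t s phi - T t s psi.
Proof. exact: (evolutionB hr heta bm m0 Lm). Qed.
Let T_comp t u s phi : s <= u -> u <= t -> T t u (T u s phi) = T t s phi.
Proof. exact: (evolution_comp hr heta bm m0 Lm). Qed.
Let T_id s phi : T s s phi = phi.
Proof. exact: (evolution_id hr heta bm m0 Lm). Qed.

(** The orbit [v] on the whole line carries the unstable component v_s of [phi]
    at time [s], and phi - v_s is the stable component. The bounds required are
    those of Y_{b1}, the larger of the two spaces and hence the one in which
    uniqueness says most; exponential decay follows in [unstable_part_bound]. *)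
Definition unstable_part s phi v :=
  [/\ forall s', sol s' (fun=> 0) v,
      exists B, forall t, t <= s -> enorm (v t) <= B * expR (- b1 * `|t|) &
      exists B, forall t, s <= t -> cnorm (T t s (phi - seg v s)) <= B * expR (- b1 * `|t|)].
Local Notation G := unstable_part.

Let hom_T s t v : (forall s', sol s' (fun=> 0) v) -> s <= t -> T t s (seg v s) = seg v t.
Proof. by move=> Hv st; apply: (evolution_sol hr heta bm m0 Lm) => //; exact: Hv. Qed.

Let hom_cont v : (forall s', sol s' (fun=> 0) v) -> continuous v.
Proof. by move=> /(_ 0)[]. Qed.

Let hom_comb c v w : (forall s', sol s' (fun=> 0) v) -> (forall s', sol s' (fun=> 0) w) ->
  forall s', sol s' (fun=> 0) (fun u => c *: v u + w u).
Proof.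
move=> Hv Hw s'; have := sol_from_comb hr heta bm m0 Lm c (@vlocint0 _ n) (@vlocint0 _ n) (Hv s') (Hw s').
by congr sol_from; apply/funext => u; rewrite scaler0 addr0.
Qed.

Lemma unstable_part_linear s c phi psi v w : G s phi v -> G s psi w ->
  G s (c *: phi + psi) (fun u => c *: v u + w u).
Proof.
move=> [Hv [B vB] [C vC]] [Hw [B' wB] [C' wC]]; split; first exact: hom_comb.
  exists (`|c| * B + B') => t ts; rewrite mulrDl; apply: le_trans (enormD _ _) _.
  by apply: lerD (wB t ts); rewrite enormZ -mulrA ler_wpM2l// vB.
exists (`|c| * C + C') => t st; rewrite mulrDl.
have cv := hom_cont Hv; have cw := hom_cont Hw.
rewrite segmentD//; last exact: continuous_col_scale.
rewrite segmentZ// (_ : _ - _ = c *: (phi - seg v s) + (psi - seg w s)); last first.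
  by rewrite scalerBr opprD addrACA.
rewrite T_linear//; apply: le_trans (cnormD r_ge0 _ _) _.
by apply: lerD (wC t st); rewrite (cnormZ r_ge0) -mulrA ler_wpM2l// vC.
Qed.

(** The difference of two choices is bounded in the past by definition, and in
    the future because it is the difference of two stable orbits. *)
Lemma unstable_part_unique s phi v w : G s phi v -> G s phi w -> v = w.
Proof.
move=> Gv Gw; have [Hd [B dB] [C dC]] := unstable_part_linear (-1) Gw Gv.
have cd := hom_cont Hd.
have := bounded_hom_zero hr hr0 heta bm m0 Lm adm1 Hd (B := Num.max B C) => H.
have H0 : (fun u => -1 *: w u + v u) = fun=> 0.
  apply: H => t; have [ts|st] := leP t s.
    by apply: le_trans (dB t ts) _; rewrite ler_wpM2r ?expR_ge0// le_max lexx.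
  apply: (@le_trans _ _ (C * expR (- b1 * `|t|))); last first.
    by rewrite ler_wpM2r ?expR_ge0// le_max lexx orbT.
  apply: le_trans (dC t (ltW st)).
  rewrite [-1 *: phi]scaleN1r addNr sub0r (evolutionN hr heta bm m0 Lm _ (ltW st)) (cnormN r_ge0).
  rewrite hom_T//; last exact: ltW.
  by apply: (enorm_le_segment r_ge0 cd); rewrite lexx andbT gerBl.
apply/funext => t; apply/eqP; rewrite -subr_eq0 addrC -scaleN1r; apply/eqP.
exact: (congr1 (@^~ t) H0).
Qed.

Lemma unstable_part_shift s t phi v : s <= t -> G s phi v -> G t (T t s phi) v.
Proof.
move=> st [Hv [B vB] [C vC]]; split => //.
  have [D D0 HD] := continuous_enorm_bounded s t (hom_cont Hv).
  exists (`|B| + D) => u ut; rewrite mulrDl.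
  have [us|su] := leP u s.
    apply: le_trans (vB u us) _; rewrite -[leLHS]addr0; apply: lerD; last by rewrite mulr_ge0 ?expR_ge0.
    by rewrite ler_wpM2r ?expR_ge0// ler_norm.
  rewrite -[leLHS]add0r; apply: lerD; first by rewrite mulr_ge0 ?expR_ge0.
  apply: le_trans (HD u _) _; first by rewrite ltW.
  by rewrite ler_peMr// -[leLHS]expR0 ler_expR mulr_ge0// oppr_ge0 ltW.
exists C => u tu; rewrite -(hom_T Hv st) -T_B// T_comp//.
by apply: vC; exact: le_trans tu.
Qed.

Lemma unstable_part_orbit s t phi v : G s phi v -> t <= s -> G t (seg v t) v.
Proof.
move=> [Hv [B vB] _] ts; split => //; first by exists B => u ut; apply: vB; exact: le_trans ts.
by exists 0 => u tu; rewrite subrr (evolution0 hr heta bm m0 Lm tu) (cnorm0 r_ge0) mul0r.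
Qed.

Lemma unstable_part_stable s phi v : G s phi v -> G s (phi - seg v s) (fun=> 0).
Proof.
move=> [Hv _ [C vC]]; split => [s'||]; first exact: (sol_from0 hr heta).
  by exists 0 => t _; rewrite enorm0 mul0r.
by exists C => t st; rewrite segment0 subr0; exact: vC.
Qed.

Let alpha := Num.min b2 (- b1).

Let alpha_gt0 : 0 < alpha. Proof. by rewrite lt_min b2_gt0 oppr_gt0. Qed.

(** [b2] gives decay away from time 0 and [b1] decay towards it. If 0 lies
    between [s] and [t], the orbit is cut at 0, at the cost of a factor [C]. *)
Lemma unstable_part_bound : exists2 K, 0 < K &
  (forall s phi, exists v, G s phi v) /\
  forall s phi v, G s phi v ->
    (forall t, t <= s -> cnorm (seg v t) <= K * cnorm phi * expR (- alpha * (s - t))) /\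
    (forall t, s <= t -> cnorm (T t s (phi - seg v s)) <= K * cnorm phi * expR (- alpha * (t - s))).
Proof.
have [C C1 HC] := splitting_estimates hr hr0 heta bm m0 Lm HM b1_lt0 b2_gt0 adm1 adm2.
have C0 : 0 < C := lt_le_trans ltr01 C1.
have b1n := b1_lt0; have b2p := b2_gt0; have a0 := alpha_gt0.
have a1 : alpha <= - b1 by rewrite ge_min lexx orbT.
have a2 : alpha <= b2 by rewrite ge_min lexx.
have ex s phi : exists v, [/\ G s phi v,
  forall b t, b = b1 \/ b = b2 -> t <= s ->
    cnorm (seg v t) <= C * cnorm phi * expR (b * (`|s| - `|t|)) &
  forall b t, b = b1 \/ b = b2 -> s <= t ->
    cnorm (T t s (phi - seg v s)) <= C * cnorm phi * expR (b * (`|s| - `|t|))].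
  have [v [Hv Hb Hf]] := HC s phi; exists v; split => //; split => //.
    exists (C * cnorm phi * expR (b1 * `|s|)) => t ts.
    have := Hb b1 t (or_introl erefl) ts; rewrite mulrBr -[- (_ * _)]mulNr expRD mulrA.
    apply: le_trans; apply: (enorm_le_segment r_ge0 (hom_cont Hv)).
    by rewrite lexx andbT gerBl.
  exists (C * cnorm phi * expR (b1 * `|s|)) => t st.
  by have := Hf b1 t (or_introl erefl) st; rewrite mulrBr -[- (_ * _)]mulNr expRD mulrA.
have est s phi v : G s phi v ->
    (forall b t, b = b1 \/ b = b2 -> t <= s ->
      cnorm (seg v t) <= C * cnorm phi * expR (b * (`|s| - `|t|))) /\
    (forall b t, b = b1 \/ b = b2 -> s <= t ->
      cnorm (T t s (phi - seg v s)) <= C * cnorm phi * expR (b * (`|s| - `|t|))).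
  by move=> Gv; have [w [Gw Hb Hf]] := ex s phi; rewrite (unstable_part_unique Gv Gw).
have n0 phi : 0 <= cnorm phi := cnorm_ge0 r_ge0 phi.
have CC : C <= C * C by rewrite ler_peMr// ltW.
have up phi a e : C * cnorm phi * expR a <= C * C * cnorm phi * expR e \/ e < a.
  have [ae|] := leP a e; [left|by right].
  by rewrite ler_pM ?expR_ge0// ?ler_expR// ?mulr_ge0 ?ler_wpM2r// ltW.
exists (C * C); first exact: mulr_gt0.
split=> [s phi|s phi v Gv]; first by have [v [Gv _ _]] := ex s phi; exists v.
have one_sided a e X : X <= C * cnorm phi * expR a -> a <= e ->
    X <= C * C * cnorm phi * expR e.
  by move=> Xa ae; apply: le_trans Xa _; have [//|] := up phi a e; rewrite ltNge ae.
have two_sided a a' e psi X : X <= C * cnorm psi * expR a -> cnorm psi <= C * cnorm phi * expR a' ->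
    a + a' <= e -> X <= C * C * cnorm phi * expR e.
  move=> Xa Ha ae; apply: le_trans Xa _.
  apply: (@le_trans _ _ (C * (C * cnorm phi * expR a') * expR a)).
    by rewrite ler_wpM2r ?expR_ge0// ler_wpM2l// ltW.
  have -> : C * (C * cnorm phi * expR a') * expR a = C * C * cnorm phi * expR (a + a') by rewrite expRD; ring.
  by rewrite ler_wpM2l ?ler_expR// !mulr_ge0// ltW.
have [Hb Hf] := est s phi v Gv; split=> t.
  move=> ts; have [s0|s0] := leP s 0.
    apply: (one_sided _ _ _ (Hb b2 t (or_intror erefl) ts)).
    by rewrite (ler0_norm s0) (ler0_norm (le_trans ts s0)); nra.
  have [t0|t0] := leP 0 t.
    apply: (one_sided _ _ _ (Hb b1 t (or_introl erefl) ts)).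
    by rewrite (gtr0_norm s0) (ger0_norm t0); nra.
  have [Hb0 _] := est 0 _ v (unstable_part_orbit Gv (ltW s0)).
  apply: (two_sided _ _ _ _ _ (Hb0 b2 t (or_intror erefl) (ltW t0)) (Hb b1 0 (or_introl erefl) (ltW s0))).
  by rewrite normr0 (gtr0_norm s0) (ltr0_norm t0); nra.
move=> st; have [s0|s0] := leP 0 s.
  apply: (one_sided _ _ _ (Hf b2 t (or_intror erefl) st)).
  by rewrite (ger0_norm s0) (ger0_norm (le_trans s0 st)); nra.
have [t0|t0] := leP t 0.
  apply: (one_sided _ _ _ (Hf b1 t (or_introl erefl) st)).
  by rewrite (ltr0_norm s0) (ler0_norm t0); nra.
have [_ Hf0] := est 0 _ _ (unstable_part_shift (ltW s0) (unstable_part_stable Gv)).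
have := Hf0 b2 t (or_intror erefl) (ltW t0); rewrite segment0 subr0 (T_comp _ (ltW s0) (ltW t0)) => H.
apply: (two_sided _ _ _ _ _ H (Hf b1 0 (or_introl erefl) (ltW s0))).
by rewrite normr0 (ltr0_norm s0) (gtr0_norm t0); nra.
Qed.

(** P(s) phi = phi - v_s, with [v] the unique orbit of [unstable_part]. The orbit
    attached to T(t, s) phi is the same [v]; hence the invariance of the
    splitting, and on kernels T(t, s) is inverted by evaluating [v] at [s]. *)
Theorem admissible_dichotomy : exponential_dichotomy r eta.
Proof.
have [K K0 [ex est]] := unstable_part_bound.
have /choice[g' Hg'] (q : R * Cseg r n) : exists v, G q.1 q.2 v by exact: ex.
pose g s phi := g' (s, phi); have Hg s phi : G s phi (g s phi) := Hg' (s, phi).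
have gE s phi v : G s phi v -> g s phi = v by move=> Gv; exact: unstable_part_unique (Hg s phi) Gv.
pose P s phi := phi - seg (g s phi) s.
have hg s phi : forall s', sol s' (fun=> 0) (g s phi) by have [] := Hg s phi.
have cg s phi := hom_cont (hg s phi).
have gT s t phi : s <= t -> g t (T t s phi) = g s phi.
  by move=> st; apply: gE; exact: unstable_part_shift.
have gorb s t phi : t <= s -> g t (seg (g s phi) t) = g s phi.
  by move=> ts; apply: gE; exact: unstable_part_orbit ts.
have PE s phi : (P s phi = 0) <-> (phi = seg (g s phi) s).
  by rewrite /P; split=> [/eqP|<-]; [rewrite subr_eq0 => /eqP|rewrite subrr].
have Tg s t phi : s <= t -> T t s (seg (g s phi) s) = seg (g s phi) t.
  by move=> st; rewrite hom_T.
have n0 phi : 0 <= cnorm phi := cnorm_ge0 r_ge0 phi.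
have bij s t : s <= t -> set_bij (kernel_of (P s)) (kernel_of (P t)) (T t s).
  move=> st; split.
  - by move=> phi /PE e; apply/PE; rewrite gT// {1}e Tg.
  - move=> phi psi /set_mem/PE e1 /set_mem/PE e2 e.
    by rewrite e1 e2 -(gT s t phi st) e gT.
  - move=> psi /PE e; exists (seg (g t psi) s).
      by apply/PE; rewrite gorb.
    by rewrite hom_T// -e.
have inv s t psi : s <= t -> kernel_of (P t) psi ->
    inv_on (kernel_of (P s)) (T t s) psi = seg (g t psi) s.
  move=> st /PE e; have [_ inj _] := bij s t st.
  have -> : psi = T t s (seg (g t psi) s) by rewrite hom_T// -e.
  rewrite /inv_on pinvKV//; last by apply/mem_set/PE; rewrite gorb.
  by rewrite hom_T// -e.
exists alpha, K, P; split => //.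
- move=> s; split.
  + move=> c phi psi; rewrite /P (gE s _ _ (unstable_part_linear c (Hg s phi) (Hg s psi))).
    rewrite segmentD//; last exact: continuous_col_scale.
    by rewrite segmentZ// scalerBr opprD addrACA.
  + apply: le_lt_trans (ltry K); apply: opnorm_le_bound => //; last exact: ltW.
    move=> phi; have [_ /(_ s (lexx s))] := est s phi _ (Hg s phi).
    by rewrite T_id subrr mulr0 expR0 mulr1.
  + by move=> phi; rewrite {1}/P (gE _ _ _ (unstable_part_stable (Hg s phi))) segment0 subr0.
- by move=> t s phi st; rewrite /P T_B// gT// Tg.
- move=> t s st; split=> //.
  + by move=> a phi psi _ _; exact: T_linear.
  + exact: bij.
  + exists (2 * gweight m s t) => phi _; exact: (evolution_bound hr heta bm m0 Lm).
  + exists (K * expR (- alpha * (t - s))) => psi Npsi; rewrite inv//.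
    by rewrite mulrAC; exact: (est t psi _ (Hg t psi)).1.
split=> t s st; apply: opnorm_le_bound; try by rewrite mulr_ge0 ?expR_ge0// ltW.
  by move=> phi; rewrite mulrAC; exact: (est s phi _ (Hg s phi)).2.
move=> phi; have -> : phi - P s phi = seg (g s phi) s by rewrite /P opprB addrC subrK.
rewrite inv//; last by apply/PE; rewrite gorb.
by rewrite gorb// mulrAC; exact: (est s phi _ (Hg s phi)).1.
Qed.

End Splitting.

(** * Solutions with a prescribed past *)

Section Gluing.
Context {R : realType} {n : nat} {r r0 : R} {eta : R -> R -> 'M[R]_n}.
Context (hr : 0 < r) (hr0 : 0 < r0) (heta : standing_assumptions r r0 eta).
Context {m : R -> R} (bm : borel_locint m) (m0 : forall t, 0 <= m t).
Context (Lm : {ae (@lebesgue_measure R), forall t, forall phi : Cseg r n,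
  \sum_(i < n) `|delay_op eta t phi i ord0| <= m t * cnorm phi}).
Local Notation mu := (@lebesgue_measure R).
Local Notation intg := integral_from_to.
Local Notation L := (delay_op eta).
Local Notation seg := (segment r).
Local Notation sol := (sol_from r eta).
Local Notation T := (evolution (r := r) eta).
Implicit Types (x y h v w : R -> 'cV[R]_n) (phi psi : Cseg r n) (t s u c b A B M : R).

Let r_ge0 : 0 <= r. Proof. exact: ltW. Qed.
Let rhs x h : continuous x -> vlocint h -> vlocint (fun u => L u (seg x u) + h u).
Proof. exact: (vlocint_rhs hr heta bm m0 Lm). Qed.

(** The value at [t] is read off from any solution started before [t]. *)
Lemma sol_from_glue c h (x : nat -> R -> 'cV[R]_n) : vlocint h ->
  (forall k, sol (c - k%:R) h (x k)) ->
  (forall j k t, (j <= k)%N -> c - j%:R <= t -> x j t = x k t) ->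
  exists v, (forall s, sol s h v) /\ forall k t, c - k%:R <= t -> v t = x k t.
Proof.
move=> lh Hx xx; pose N t := (Num.truncn (c - t)).+1.
have Nt t : c - (N t)%:R <= t by rewrite lerBlDr -lerBlDl; exact/ltW/truncnS_gt.
pose v t := x (N t) t.
have vx k t : c - k%:R <= t -> v t = x k t.
  move=> kt; have [Nk|/ltnW kN] := leqP (N t) k; first exact: xx.
  by rewrite /v -(xx k _ t kN).
have cv : continuous v.
  move=> t; pose k := N (t - 1).
  have kt : c - k%:R < t by apply: le_lt_trans (Nt (t - 1)) _; rewrite ltrBlDr ltrDl.
  have [cx _] := Hx k; rewrite /continuous_at (vx k _ (ltW kt)).
  apply: cvg_trans (cx t); apply: near_eq_cvg.
  by apply: filterS (near_ge kt) => u /vx.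
exists v; split=> // s; split=> // t st.
pose k := N (s - r).
have ks : c - k%:R <= s - r := Nt _.
have r1 := r_ge0; have ks' : c - k%:R <= s by lra.
have [cx Hk] := sol_from_restart hr heta bm m0 Lm lh ks' (Hx k).
rewrite (vx k t (le_trans ks' st)) (vx k s ks') (Hk t st).
apply: vint_eq_on; [exact: rhs|exact: rhs|apply: aeW => u /andP[su ut]].
have -> : seg v u = seg (x k) u; last by [].
by apply: segment_ext => w /andP[uw _]; apply: vx; lra.
Qed.

Lemma sol_from_zero_past s h : vlocint h -> (forall t, t <= s -> h t = 0) ->
  exists x, (forall s', sol s' h x) /\ forall t, t <= s -> x t = 0.
Proof.
move=> lh h0; have r1 := r_ge0.
have /choice[x Hx] k := sol_from_exists hr heta bm m0 Lm (s - k%:R) (0 : Cseg r n) lh.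
have x0 k t : s - k%:R <= t -> t <= s -> seg (x k) t = 0.
  move=> kt ts; apply: (cnorm_le0 r_ge0).
  apply: le_trans (sol_from_bound hr heta bm m0 Lm lh kt (Hx k).1) _.
  rewrite (Hx k).2 (cnorm0 r_ge0) add0r (_ : intg _ _ _ = 0) ?mulr0 ?mul0r//.
  rewrite (int_eq_on (locint_enorm lh) (@locint_cst R 0)) ?int0//.
  by apply: aeW => u /andP[_ ut]; rewrite h0 ?enorm0// (le_trans ut).
have xk0 k t : s - k%:R <= t -> t <= s -> x k t = 0.
  move=> kt ts; apply: enorm_le0; have [[cx _] _] := Hx k.
  rewrite -(cnorm0 (n := n) r_ge0) -(x0 k t kt ts); apply: (enorm_le_segment r_ge0 cx).
  by rewrite lexx andbT gerBl.
have jk j k : (j <= k)%N -> s - k%:R <= s - j%:R :> R by rewrite lerD2l lerN2 ler_nat.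
have le0 k : s - k%:R <= s by rewrite gerBl.
have [v [Hv vx]] : exists v, (forall s', sol s' h v) /\ forall k t, s - k%:R <= t -> v t = x k t.
  apply: sol_from_glue => // [k|j k t jk' jt]; first exact: (Hx k).1.
  have Hk := sol_from_restart hr heta bm m0 Lm lh (jk _ _ jk') (Hx k).1.
  have e0 : seg (x j) (s - j%:R) = seg (x k) (s - j%:R) by rewrite !x0// jk.
  have := sol_from_unique hr heta bm m0 Lm lh (Hx j).1 Hk e0 jt.
  have [[cj _] _] := Hx j; have [ck _] := Hk.
  have z0 : - r <= (0 : R) <= 0 by rewrite oppr_le0 (ltW hr) lexx.
  by move=> /(congr1 (fun phi : Cseg r n => phi 0)); rewrite !segmentE// addr0.
exists v; split=> // t ts; pose k := (Num.truncn (s - t)).+1.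
have kt : s - k%:R <= t by rewrite lerBlDr -lerBlDl; exact/ltW/truncnS_gt.
by rewrite (vx k t kt) xk0.
Qed.

End Gluing.

(** * Localized responses under a dichotomy *)

Section FromDichotomy.
Context {R : realType} {n : nat} {r r0 : R} {eta : R -> R -> 'M[R]_n}.
Context (hr : 0 < r) (hr0 : 0 < r0) (heta : standing_assumptions r r0 eta).
Context {m : R -> R} (bm : borel_locint m) (m0 : forall t, 0 <= m t).
Context (Lm : {ae (@lebesgue_measure R), forall t, forall phi : Cseg r n,
  \sum_(i < n) `|delay_op eta t phi i ord0| <= m t * cnorm phi}).
Context {Mm : R} (HM : forall t, integral_from_to t (t + r0) m <= Mm).
Local Notation mu := (@lebesgue_measure R).
Local Notation intg := integral_from_to.
Local Notation L := (delay_op eta).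
Local Notation seg := (segment r).
Local Notation sol := (sol_from r eta).
Local Notation T := (evolution (r := r) eta).
Implicit Types (x y h v w : R -> 'cV[R]_n) (phi psi : Cseg r n) (t s u c b A B M : R).

Context {alpha K : R} {P : R -> Cseg r n -> Cseg r n} (alpha_gt0 : 0 < alpha) (K_gt0 : 0 < K).
Context (Pproj : forall t, is_projection (P t)).
Context (TP : forall t s phi, s <= t -> T t s (P s phi) = P t (T t s phi)).
Context (Tiso : forall t s, s <= t ->
  is_isomorphism_on (kernel_of (P s)) (kernel_of (P t)) (T t s)).
Context (Pdec : forall t s, s <= t -> (opnorm cnorm cnorm (fun phi => T t s (P s phi))
           <= (K * expR (- alpha * (t - s)))%:E)%E).
Context (Qdec : forall t s, t <= s ->
         (opnorm cnorm cnorm (fun phi => inv_on (kernel_of (P t)) (T s t) (phi - P s phi)%R)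
           <= (K * expR (- alpha * (s - t)))%:E)%E).
Local Notation N t := (kernel_of (P t)).
Local Notation J t s := (inv_on (N t) (T s t)).

Let r_ge0 : 0 <= r. Proof. exact: ltW. Qed.
Let T_linear t s c phi psi : s <= t -> T t s (c *: phi + psi) = c *: T t s phi + T t s psi.
Proof. exact: (evolution_linear hr heta bm m0 Lm). Qed.
Let T_B t s phi psi : s <= t -> T t s (phi - psi) = T t s phi - T t s psi.
Proof. exact: (evolutionB hr heta bm m0 Lm). Qed.
Let T_comp t u s phi : s <= u -> u <= t -> T t u (T u s phi) = T t s phi.
Proof. exact: (evolution_comp hr heta bm m0 Lm). Qed.
Let T_id s phi : T s s phi = phi.
Proof. exact: (evolution_id hr heta bm m0 Lm). Qed.
Let T_Z t s c phi : s <= t -> T t s (c *: phi) = c *: T t s phi.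
Proof. exact: (evolutionZ hr heta bm m0 Lm). Qed.
Let T_0 t s : s <= t -> T t s 0 = 0.
Proof. exact: (evolution0 hr heta bm m0 Lm). Qed.
Let hom_T s t v : (forall s', sol s' (fun=> 0) v) -> s <= t -> T t s (seg v s) = seg v t.
Proof. by move=> Hv st; apply: (evolution_sol hr heta bm m0 Lm) => //; exact: Hv. Qed.

Lemma P_linear t c phi psi : P t (c *: phi + psi) = c *: P t phi + P t psi.
Proof. by have [H _ _] := Pproj t; rewrite H. Qed.

Lemma P_0 t : P t 0 = 0.
Proof. by have := P_linear t (-1) 0 0; rewrite scaler0 addr0 scaleN1r addNr. Qed.

Lemma P_Z t c phi : P t (c *: phi) = c *: P t phi.
Proof. by have := P_linear t c phi 0; rewrite P_0 !addr0. Qed.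

Lemma P_B t phi psi : P t (phi - psi) = P t phi - P t psi.
Proof. by rewrite addrC -scaleN1r P_linear scaleN1r addrC. Qed.

Lemma kernel_Q t phi : N t (phi - P t phi).
Proof. by have [_ _ PP] := Pproj t; rewrite /kernel_of/= P_B PP subrr. Qed.

Lemma kernel_inverse_unique t s phi : t <= s -> N t phi -> J t s (T s t phi) = phi.
Proof.
by move=> ts Nphi; have [_ [_ inj _] _ _] := Tiso ts; rewrite /inv_on pinvKV//; exact/mem_set.
Qed.

Lemma kernel_inverse t s phi : t <= s -> N s phi -> N t (J t s phi) /\ T s t (J t s phi) = phi.
Proof.
move=> ts Nphi; have [_ [_ inj surj] _ _] := Tiso ts.
by have [psi Npsi <-] := surj _ Nphi; rewrite kernel_inverse_unique.
Qed.

Lemma stable_decay t s phi : s <= t -> cnorm (T t s (P s phi)) <= K * expR (- alpha * (t - s)) * cnorm phi.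
Proof.
move=> st; move: phi; apply: (bound_opnorm r_ge0 (A := fun phi => T t s (P s phi))); last exact: Pdec.
  by move=> c phi c0; rewrite P_Z T_Z// (cnormZ r_ge0) gtr0_norm.
by rewrite P_0 T_0// (cnorm0 r_ge0).
Qed.

(** [bound_opnorm] asks for homogeneity of the inverse of T(s, t) on the kernels,
    which follows from uniqueness of preimages. *)
Lemma unstable_decay t s phi : t <= s ->
  cnorm (J t s (phi - P s phi)) <= K * expR (- alpha * (s - t)) * cnorm phi.
Proof.
move=> ts; move: phi; apply: (bound_opnorm r_ge0 (A := fun phi => J t s (phi - P s phi))); last exact: Qdec.
  move=> c phi c0; have [NJ TJ] := kernel_inverse ts (kernel_Q s phi).
  have -> : c *: phi - P s (c *: phi) = T s t (c *: J t s (phi - P s phi)).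
    by rewrite T_Z// TJ P_Z scalerBr.
  rewrite kernel_inverse_unique ?(cnormZ r_ge0) ?gtr0_norm//.
  by rewrite /kernel_of/= P_Z NJ scaler0.
have N0 : N t 0 by rewrite /kernel_of/= P_0.
by rewrite P_0 subr0 -(T_0 ts) kernel_inverse_unique// (cnorm0 r_ge0).
Qed.

(** Orbits are started from the preimages of [phi] at the times c - k. Uniqueness
    of preimages makes them agree, so they can be glued. *)
Lemma unstable_orbit c phi : N c phi -> exists v, [/\ forall s, sol s (fun=> 0) v,
  seg v c = phi & forall t, t <= c -> seg v t = J t c phi].
Proof.
move=> Nphi; have le0 k : c - k%:R <= c by rewrite gerBl.
have jk j k : (j <= k)%N -> c - k%:R <= c - j%:R :> R by rewrite lerD2l lerN2 ler_nat.
have Tx t u : t <= u -> u <= c -> T u t (J t c phi) = J u c phi.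
  move=> tu uc; have [NJ TJ] := kernel_inverse (le_trans tu uc) Nphi.
  have [_ [maps _ _] _ _] := Tiso tu.
  by rewrite -[LHS](kernel_inverse_unique uc) ?T_comp ?TJ//; exact: maps.
have /choice[x Hx] k := evolution_exists hr heta bm m0 Lm (c - k%:R) (J (c - k%:R) c phi).
have [v [Hv vx]] : exists v, (forall s', sol s' (fun=> 0) v) /\ forall k t, c - k%:R <= t -> v t = x k t.
  apply: (sol_from_glue hr heta bm m0 Lm (@vlocint0 _ n)) => [k|j k t jk' jt].
    by have [] := Hx k.
  have [Hj xj _] := Hx j; have [Hk xk Tk] := Hx k.
  have Hk' := sol_from_restart hr heta bm m0 Lm (@vlocint0 _ n) (jk _ _ jk') Hk.
  have e0 : seg (x j) (c - j%:R) = seg (x k) (c - j%:R).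
    by rewrite xj -(Tk _ (jk _ _ jk')) Tx// jk.
  have := sol_from_unique hr heta bm m0 Lm (@vlocint0 _ n) Hj Hk' e0 jt.
  have [cj _] := Hj; have [ck _] := Hk.
  have z0 : - r <= (0 : R) <= 0 by rewrite oppr_le0 (ltW hr) lexx.
  by move=> /(congr1 (fun phi : Cseg r n => phi 0)); rewrite !segmentE// addr0.
have vJ t : t <= c -> seg v t = J t c phi.
  move=> tc; pose k := (Num.truncn (c - (t - r))).+1.
  have kt : c - k%:R <= t - r by rewrite lerBlDr -lerBlDl; exact/ltW/truncnS_gt.
  have r1 := r_ge0; have kt' : c - k%:R <= t by lra.
  have [Hk xk Tk] := Hx k.
  rewrite -(Tx _ _ kt' tc) (Tk _ kt'); apply: segment_ext => u /andP[tu _].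
  by apply: vx; exact: le_trans tu.
exists v; split => //; rewrite vJ// -[RHS](T_id c).
by have [_] := kernel_inverse (lexx c) Nphi; rewrite !T_id.
Qed.

Lemma le0_of_exp_decay a c X : 0 < a -> (forall k : nat, X <= c * expR (- a * k%:R)) -> X <= 0.
Proof.
move=> a0 H; rewrite leNgt; apply/negP => X0.
pose k := (Num.truncn (c / (a * X))).+1.
have h1 : c < k%:R * (a * X) by rewrite -ltr_pdivrMr ?mulr_gt0//; exact: truncnS_gt.
have := H k; rewrite mulNr expRN ler_pdivlMr ?expR_gt0// leNgt => /negP; apply.
apply: lt_le_trans h1 _; have -> : k%:R * (a * X) = X * (a * k%:R) by ring.
rewrite ler_wpM2l ?(ltW X0)//.
by apply: le_trans (expR_ge1Dx _); rewrite lerDr ler01.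
Qed.

(** The stable component at [t] is transported from t - k and the unstable one
    from t + k. Transport contracts by e^{- alpha k}, whereas the bound on [v]
    deteriorates by e^{(alpha / 2) k} only. *)
Lemma dichotomy_bounded_zero b v B : `|b| <= alpha / 2 -> (forall s, sol s (fun=> 0) v) ->
  Ybound b v B -> v = fun=> 0.
Proof.
move=> ba Hv vB; have [cv _] := Hv 0; have r1 := r_ge0; have a0 := alpha_gt0.
pose a := alpha / 2; have a1 : 0 < a by rewrite /a; lra.
have /andP[b1 b2] : - a <= b <= a by rewrite -ler_norml.
pose B' := `|B| * expR (a * r); have B'0 : 0 <= B' by rewrite mulr_ge0 ?expR_ge0.
have segB t : cnorm (seg v t) <= B' * expR (a * `|t|).
  apply: cnorm_segment_le => // u /andP[tu ut]; apply: le_trans (vB u) _.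
  apply: (@le_trans _ _ (`|B| * expR (- b * `|u|))); first by rewrite ler_wpM2r ?expR_ge0// ler_norm.
  rewrite /B' -mulrA -expRD ler_wpM2l// ler_expR -mulrDr.
  apply: (@le_trans _ _ (a * `|u|)); first by rewrite ler_wpM2r//; lra.
  rewrite ler_wpM2l ?(ltW a1)//; have h1 := ler_norm t; have h2 := ler_norm (- t).
  by rewrite normrN in h2; rewrite ler_norml; apply/andP; split; lra.
have small t s : `|t - s| >= 0 -> K * expR (- alpha * `|t - s|) * (B' * expR (a * `|s|)) <=
    K * B' * expR (a * `|t|) * expR (- a * `|t - s|).
  move=> _.
  have -> : K * expR (- alpha * `|t - s|) * (B' * expR (a * `|s|)) = K * B' * (expR (- alpha * `|t - s|) * expR (a * `|s|)) by ring.
  rewrite -[leRHS]mulrA ler_wpM2l ?mulr_ge0 ?(ltW K_gt0)// -!expRD ler_expR.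
  have h : `|s| <= `|t| + `|t - s| by rewrite -{1}(subKr t s); apply: ler_normB.
  have : a * `|s| <= a * (`|t| + `|t - s|) by rewrite ler_wpM2l// ltW.
  by rewrite /a; lra.
have Pz t : cnorm (P t (seg v t)) <= 0.
  apply: (@le0_of_exp_decay a (K * B' * expR (a * `|t|))) => // k.
  have kt : t - k%:R <= t by rewrite gerBl.
  rewrite -(hom_T Hv kt) -TP//; apply: le_trans (stable_decay _ kt) _.
  have e1 : t - (t - k%:R) = k%:R by rewrite opprB addrC subrK.
  have := small t (t - k%:R) (normr_ge0 _); rewrite e1 normr_nat; apply: le_trans.
  by rewrite ler_wpM2l ?segB// mulr_ge0 ?expR_ge0// ltW.
have Qz t : cnorm (seg v t - P t (seg v t)) <= 0.
  apply: (@le0_of_exp_decay a (K * B' * expR (a * `|t|))) => // k.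
  have kt : t <= t + k%:R by rewrite lerDl.
  have := unstable_decay (seg v (t + k%:R)) kt.
  rewrite -(hom_T Hv kt) -TP// -T_B// kernel_inverse_unique//; last exact: kernel_Q.
  move=> /le_trans; apply.
  have e1 : t + k%:R - t = k%:R by rewrite addrC addKr.
  have := small t (t + k%:R) (normr_ge0 _); rewrite distrC e1 normr_nat; apply: le_trans.
  by rewrite hom_T// ler_wpM2l ?segB// mulr_ge0 ?expR_ge0// ltW.
apply/funext => t; apply: enorm_le0.
apply: le_trans (enorm_le_segment r_ge0 (t := t) cv _) _; first by rewrite lexx andbT gerBl.
rewrite -(subrK (P t (seg v t)) (seg v t)); apply: le_trans (cnormD r_ge0 _ _) _.
by rewrite -[leRHS]addr0; apply: lerD; [exact: Qz|exact: Pz].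
Qed.

(** y = x - v, with [x] the solution that vanishes before [s] and [v] the orbit of
    the unstable part of its state at s + l. Before [s], y is -v, which decays
    backwards; after s + l, the state of y is stable. *)
Lemma block_solution l : 0 <= l -> exists2 C, 0 < C & forall s h, vlocint h ->
  (forall t, t <= s -> h t = 0) -> (forall t, s + l < t -> h t = 0) ->
  exists y, [/\ continuous y, forall s', sol s' h y & forall t,
    enorm (y t) <= C * intg s (s + l) (fun u => enorm (h u)) * expR (- alpha * `|t - s|)].
Proof.
move=> l0; have [Cw Cw0 HCw] := window_bound hr0 0 l0.
have lm : locint m := borel_locint_locint bm.
have Mm0 : 0 <= Mm := le_trans (int_ge0 0 (0 + r0) m0) (HM 0).
pose W := expR (2 * (Cw * Mm)).
have Wle s t : s <= t -> t <= s + l -> gweight m s t <= W.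
  move=> st tl; rewrite gweightE ler_expR ler_wpM2l//.
  have := HCw m Mm lm m0 Mm0 _ s t st tl; rewrite oppr0 mul0r expR0 mulr1; apply.
  by move=> u; rewrite mul0r expR0 mulr1.
have W0 : 0 < W by exact: expR_gt0.
have K0 := K_gt0; have a0 := alpha_gt0.
pose E := expR (alpha * l); pose C := (1 + K) * E * (2 * n%:R * W).
have E1 : 1 <= E by rewrite /E -[leLHS]expR0 ler_expR mulr_ge0// ltW.
have C0 : 0 <= C.
  by rewrite /C !mulr_ge0// ?(ltW W0)//; lra.
exists (C + 1); first by lra.
move=> s h lh hlo hhi; pose c := s + l; have sc : s <= c by rewrite lerDl.
set I := intg s (s + l) _; have I0 : 0 <= I by apply: int_ge0 => u; exact: enorm_ge0.
have [x [Hx x0]] := sol_from_zero_past hr heta bm m0 Lm lh hlo.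
have [cx _] := Hx 0.
pose X := 2 * n%:R * W * I; have X0 : 0 <= X by rewrite /X !mulr_ge0// ltW.
have xs0 : seg x s = 0.
  by rewrite -(segment0 s); apply: segment_ext => u /andP[_ us]; exact: x0.
have xX t : s <= t -> t <= c -> cnorm (seg x t) <= X.
  move=> st tc; apply: le_trans (sol_from_bound hr heta bm m0 Lm lh st (Hx s)) _.
  rewrite xs0 (cnorm0 r_ge0) add0r.
  have h1 : intg s t (fun u => enorm (h u)) <= I.
    by apply: int_nd => //; [exact: locint_enorm|move=> u; exact: enorm_ge0].
  have h2 := Wle s t st tc.
  have -> : X = 2 * (n%:R * I) * W by rewrite /X; ring.
  apply: ler_pM => //; first by rewrite !mulr_ge0// int_ge0// => u; exact: enorm_ge0.
    by rewrite ltW// gweight_gt0.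
  by rewrite ler_wpM2l// ler_wpM2l.
pose w := seg x c; have wX : cnorm w <= X by exact: xX.
have [v [Hv vc vJ]] := unstable_orbit (kernel_Q c w).
have [cv _] := Hv 0.
have vX t : t <= c -> enorm (v t) <= K * X * expR (- alpha * (c - t)).
  move=> tc; apply: (@le_trans _ _ (cnorm (seg v t))).
    by apply: (enorm_le_segment r_ge0 cv); rewrite lexx andbT gerBl.
  rewrite vJ//; apply: le_trans (unstable_decay w tc) _; rewrite mulrAC.
  by rewrite ler_wpM2r ?expR_ge0// ler_wpM2l// ltW.
have Hy s' : sol s' h (fun u => x u - v u).
  have := sol_fromB hr heta bm m0 Lm lh (@vlocint0 _ n) (Hx s') (Hv s').
  by congr sol_from; apply/funext => u; rewrite subr0.
have [cy _] := Hy 0.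
have yX t : c <= t -> enorm (x t - v t) <= K * X * expR (- alpha * (t - c)).
  move=> ct; apply: (@le_trans _ _ (cnorm (seg (fun u => x u - v u) t))).
    by apply: (@enorm_le_segment _ _ _ r_ge0 (fun u => x u - v u)) => //; rewrite lexx andbT gerBl.
  have Hyc : sol c (fun=> 0) (fun u => x u - v u).
    have l2 := vlocint_rhs hr heta bm m0 Lm cy lh.
    have l3 := vlocint_rhs hr heta bm m0 Lm cy (@vlocint0 _ n).
    split=> // u cu; have [_ ->//] := Hy c; apply: vint_eq_on => //.
    apply: ae_imp (ae_neq c) => z zc /andP[cz _]; rewrite hhi//.
    by rewrite lt_neqAle eq_sym zc.
  rewrite -(evolution_sol hr heta bm m0 Lm Hyc ct) segmentB// -/w vc subKr.
  apply: le_trans (stable_decay w ct) _; rewrite mulrAC.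
  by rewrite ler_wpM2r ?expR_ge0// ler_wpM2l// ltW.
have fin t : enorm (x t - v t) <= (1 + K) * E * X * expR (- alpha * `|t - s|).
  have KX : 0 <= K * X by rewrite mulr_ge0// ltW.
  have le1 e a : 0 <= e -> e <= (1 + K) * X * (E * expR (- alpha * `|t - s|)) -> a <= e ->
      a <= (1 + K) * E * X * expR (- alpha * `|t - s|).
    move=> _ h1 h2; apply: le_trans h2 _; apply: le_trans h1 _.
    by rewrite le_eqVlt; apply/orP; left; apply/eqP; ring.
  have KK : K * X <= (1 + K) * X by rewrite ler_wpM2r//; lra.
  have [ct|tc] := leP c t.
    apply: le1 (yX t ct); first by rewrite mulr_ge0 ?expR_ge0.
    apply: ler_pM => //; rewrite ?expR_ge0//.
    rewrite -expRD ler_expR ger0_norm ?subr_ge0 ?(le_trans sc)//.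
    by rewrite /c; lra.
  have [ts|st] := leP t s.
    have := vX t (ltW tc); rewrite x0// sub0r enormN; apply: le1; first by rewrite mulr_ge0 ?expR_ge0.
    apply: ler_pM => //; rewrite ?expR_ge0//.
    rewrite -[leLHS]mul1r; apply: ler_pM => //; rewrite ?expR_ge0//.
    rewrite ler_expR ler0_norm ?subr_le0// /c !mulNr lerN2 ler_wpM2l ?(ltW a0)//; lra.
  have h1 : enorm (x t - v t) <= (1 + K) * X.
    rewrite mulrDl mul1r; apply: le_trans (enormB _ _) _; apply: lerD.
      apply: le_trans (xX t (ltW st) (ltW tc)).
      by apply: (enorm_le_segment r_ge0 cx); rewrite lexx andbT gerBl.
    apply: le_trans (vX t (ltW tc)) _; rewrite ler_piMr// -[leRHS]expR0 ler_expR.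
    by rewrite mulNr oppr_le0 mulr_ge0 ?(ltW a0)// subr_ge0 ltW.
  apply: le1 h1; first by rewrite mulr_ge0//; lra.
  rewrite ler_peMr//; first by rewrite mulr_ge0//; lra.
  rewrite -expRD -[leLHS]expR0 ler_expR gtr0_norm ?subr_gt0// mulNr -mulrBr mulr_ge0 ?(ltW a0)//.
  by move: tc; rewrite /c; lra.
exists (fun u => x u - v u); split => // t; apply: le_trans (fin t) _.
rewrite ler_wpM2r ?expR_ge0//.
have -> : (1 + K) * E * X = C * I by rewrite /C /X; ring.
by rewrite mulrDl lerDl mul1r.
Qed.

End FromDichotomy.

(** * From a dichotomy to admissibility *)

(** For t <= 0 the sum is geometric. For t > 0 the first term is split off and the
    others are the same sum at t - l; the slack e^{- a t} in the bound absorbs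
    that term in the induction. *)
Lemma sum_exp_dist_le {R : realType} (a l : R) : 0 < a -> 0 < l -> 2 <= expR (a * l) ->
  forall k t, \sum_(j < k) expR (- a * `|t - j%:R * l|) <= 4.
Proof.
move=> a0 l0 al k.
suff H t : (t <= 0 -> \sum_(j < k) expR (- a * `|t - j%:R * l|) <= 2 * expR (a * t)) /\
    (0 < t -> \sum_(j < k) expR (- a * `|t - j%:R * l|) <= 4 - expR (- a * t)).
  move=> t; have [t0|t0] := leP t 0.
    apply: le_trans ((H t).1 t0) _; have : expR (a * t) <= 1 by rewrite -[leRHS]expR0 ler_expR; nra.
    by lra.
  by apply: le_trans ((H t).2 t0) _; rewrite gerBl expR_ge0.
elim: k t => [|k IH] t.
  rewrite big_ord0; split=> t0; first by rewrite mulr_ge0 ?expR_ge0.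
  have : expR (- a * t) <= 1 by rewrite -[leRHS]expR0 ler_expR; nra.
  by lra.
have e1 : \sum_(j < k.+1) expR (- a * `|t - j%:R * l|) =
    expR (- a * `|t|) + \sum_(j < k) expR (- a * `|(t - l) - j%:R * l|).
  rewrite big_ord_recl mul0r subr0; congr (_ + _); apply: eq_bigr => j _.
  by rewrite /bump /= natrD mulrDl mul1r opprD addrA.
have e2 : expR (a * (t - l)) * expR (a * l) = expR (a * t) by rewrite -expRD; congr expR; ring.
have p1 := expR_gt0 (a * (t - l)).
rewrite e1; split=> t0.
  rewrite ler0_norm// mulrNN; have tl : t - l <= 0 by lra.
  have := (IH (t - l)).1 tl; nra.
rewrite gtr0_norm//.
have h1 : expR (- a * t) <= 1 by rewrite -[leRHS]expR0 ler_expR; nra.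
have [tl|tl] := leP (t - l) 0.
  have := (IH (t - l)).1 tl; have : expR (a * (t - l)) <= 1 by rewrite -[leRHS]expR0 ler_expR; nra.
  by lra.
have := (IH (t - l)).2 tl.
have e3 : expR (- a * (t - l)) = expR (- a * t) * expR (a * l) by rewrite -expRD; congr expR; ring.
have p2 := expR_gt0 (- a * t).
rewrite e3; nra.
Qed.

Section LocalizedForcing.
Context {R : realType} {n : nat} {r r0 : R} {eta : R -> R -> 'M[R]_n}.
Context (hr : 0 < r) (hr0 : 0 < r0) (heta : standing_assumptions r r0 eta).
Context {m : R -> R} (bm : borel_locint m) (m0 : forall t, 0 <= m t).
Context (Lm : {ae (@lebesgue_measure R), forall t, forall phi : Cseg r n,
  \sum_(i < n) `|delay_op eta t phi i ord0| <= m t * cnorm phi}).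
Local Notation mu := (@lebesgue_measure R).
Local Notation intg := integral_from_to.
Local Notation L := (delay_op eta).
Local Notation seg := (segment r).
Local Notation sol := (sol_from r eta).
Implicit Types (x y h v w : R -> 'cV[R]_n) (t s u c b A B M : R).

Context {alpha : R} (alpha_gt0 : 0 < alpha).
Context (localized : forall l, 0 <= l -> exists2 C, 0 < C & forall s h, vlocint h ->
  (forall t, t <= s -> h t = 0) -> (forall t, s + l < t -> h t = 0) ->
  exists y, [/\ continuous y, forall s', sol s' h y & forall t,
    enorm (y t) <= C * intg s (s + l) (fun u => enorm (h u)) * expR (- alpha * `|t - s|)]).
Context (bounded_zero : forall b v B, `|b| <= alpha / 2 -> (forall s, sol s (fun=> 0) v) ->
  Ybound b v B -> v = fun=> 0).

Let r_ge0 : 0 <= r. Proof. exact: ltW. Qed.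

Let window (p q : R) h t : 'cV[R]_n := \1_(`]p, q]) t *: h t.

Let windowE p q h t : window p q h t = if p < t <= q then h t else 0.
Proof.
rewrite /window indicE; case: ifP => H.
  by rewrite mem_set ?scale1r//= in_itv/=.
by rewrite memNset ?scale0r//= in_itv/= H.
Qed.

Let vlocint_window p q h : vlocint h -> vlocint (window p q h).
Proof. by move=> lh; apply: vlocint_indic. Qed.

Let window_split p q c h t : p <= q -> q <= c -> window p c h t = window p q h t + window q c h t.
Proof.
move=> pq qc; rewrite !windowE.
have [pt|tp] := ltP p t; last by rewrite (ltNge q t) (le_trans tp pq)/= addr0.
have [tq|qt] := leP t q; first by rewrite (le_trans tq qc)/= addr0.
by rewrite /= add0r.
Qed.

(** The k-th step adds the responses to the pieces of the forcing on
    ]kl, (k + 1)l] and ]- (k + 1)l, - kl], so the partial sum [S k] solves the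
    equation with the forcing restricted to ]- kl, kl]. Each response is at most
    a multiple of e^{- b |t|} e^{- (alpha / 2) |t - s|}, with [s] the left end of
    its block, because |b| <= alpha / 2; these bounds sum to a multiple of
    e^{- b |t|} by [sum_exp_dist_le]. The block length makes
    e^{- (alpha / 2) l} at most 1/2, so that the partial sums converge
    geometrically. *)
Theorem localized_admissible b : `|b| <= alpha / 2 -> properly_admissible r r0 b eta.
Proof.
move=> ba; have al0 := alpha_gt0; have r1 := r_ge0.
pose a := alpha / 2; have a0 : 0 < a by rewrite /a; lra.
have [l l0 al] : exists2 l, 0 < l & 2 <= expR (a * l).
  exists (2 / alpha); first by rewrite divr_gt0.
  have -> : a * (2 / alpha) = 1 by rewrite /a; field; rewrite gt_eqF.
  by apply: le_trans (expR_ge1Dx 1).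
have [C C0 HC] := localized (ltW l0).
have [Cw Cw0 HCw] := window_bound hr0 b (ltW l0).
move=> h /in_H_Hbound => /(_ hr0)[lh [B B0 hB]].
have le := locint_enorm lh.
pose E t := C * (Cw * B) * expR (- b * `|t|).
have E0 t : 0 <= E t by rewrite /E !mulr_ge0 ?expR_ge0// ltW.
(* the response to the part of the forcing on one block *)
have block s : exists y, [/\ continuous y, forall s', sol s' (window s (s + l) h) y &
    forall t, enorm (y t) <= E t * expR (- a * `|t - s|)].
  have [|t ts|t st|y [cy sy yb]] := HC s (window s (s + l) h).
  - exact: vlocint_window.
  - by rewrite windowE ltNge ts.
  - by rewrite windowE [t <= _]leNgt st andbF.
  exists y; split => // t; apply: le_trans (yb t) _.
  have h1 : intg s (s + l) (fun u => enorm (window s (s + l) h u)) <= Cw * B * expR (- b * `|s|).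
    apply: le_trans (HCw _ B le (fun u => enorm_ge0 _) B0 hB s (s + l) _ (lexx _)); last by rewrite lerDl ltW.
    apply: int_le => //; first exact/locint_enorm/vlocint_window.
    by apply: aeW => u _; rewrite windowE; case: ifP => // _; rewrite enorm0 enorm_ge0.
  have h2 : expR (- b * `|s|) <= expR (- b * `|t|) * expR (a * `|t - s|).
    apply: le_trans (weight_shift b t s) _; rewrite ler_wpM2l ?expR_ge0// ler_expR distrC.
    by rewrite ler_wpM2r.
  have e1 : expR (- alpha * `|t - s|) = expR (- a * `|t - s|) * expR (- a * `|t - s|).
    by rewrite -expRD; congr expR; rewrite /a; field.
  have e2 : expR (a * `|t - s|) * expR (- a * `|t - s|) = 1.
    by rewrite -expRD mulNr subrr expR0.
  apply: (@le_trans _ _ (C * (Cw * B * (expR (- b * `|t|) * expR (a * `|t - s|))) * expR (- alpha * `|t - s|))).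
    rewrite ler_wpM2r ?expR_ge0// ler_wpM2l ?(ltW C0)//; apply: le_trans h1 _.
    by rewrite ler_wpM2l// mulr_ge0// ltW.
  rewrite e1 /E le_eqVlt; apply/orP; left; apply/eqP.
  transitivity (C * (Cw * B) * expR (- b * `|t|) * expR (- a * `|t - s|) * (expR (a * `|t - s|) * expR (- a * `|t - s|))); first by ring.
  by rewrite e2 mulr1.
have /choice[yr Hyr] (k : nat) := block (k%:R * l).
have /choice[yl Hyl] (k : nat) := block (- (k.+1%:R * l)).
pose H k := window (- (k%:R * l)) (k%:R * l) h.
have lH k : vlocint (H k) by exact: vlocint_window.
(* the forcing used up after k steps is h on ]- kl, kl] *)
have HS k t : H k.+1 t = H k t + (window (k%:R * l) (k%:R * l + l) h t + window (- (k.+1%:R * l)) (- (k.+1%:R * l) + l) h t).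
  have e1 : k.+1%:R * l = k%:R * l + l by rewrite -natr1 mulrDl mul1r.
  have kl : 0 <= k%:R * l by rewrite mulr_ge0// ltW.
  have l0' := ltW l0.
  rewrite /H e1 (_ : - (k%:R * l + l) + l = - (k%:R * l)); last by rewrite opprD subrK.
  rewrite (@window_split _ (- (k%:R * l))); [|by lra|by lra].
  rewrite (@window_split (- (k%:R * l)) (k%:R * l) (k%:R * l + l)); [|by lra|by lra].
  by rewrite addrC -addrA.
pose S k t := \sum_(j < k) (yr j t + yl j t).
have SS k t : S k.+1 t - S k t = yr k t + yl k t by rewrite /S big_ord_recr/= addrAC subrr add0r.
have sS k s : sol s (H k) (S k).
  elim: k => [|k IH].
    have := sol_from0 hr heta s; congr sol_from; apply/funext => t; rewrite ?/S ?big_ord0// /H windowE.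
    by rewrite mul0r oppr0; case: ifP => // /andP[h1 h2]; have := lt_le_trans h1 h2; rewrite ltxx.
  have [_ s1 _] := Hyr k; have [_ s2 _] := Hyl k.
  have l1 := vlocint_window (k%:R * l) (k%:R * l + l) lh.
  have l2 := vlocint_window (- (k.+1%:R * l)) (- (k.+1%:R * l) + l) lh.
  have s12 := sol_fromD hr heta bm m0 Lm l1 l2 (s1 s) (s2 s).
  have := sol_fromD hr heta bm m0 Lm (lH k) (vlocintD l1 l2) IH s12.
  by congr sol_from; apply/funext => t; rewrite ?HS// /S big_ord_recr.
have cS k : continuous (S k) by have [] := sS k 0.
have yrb k t : enorm (yr k t) <= E t * expR (- a * `|t - k%:R * l|) by have [_ _] := Hyr k.
have ylb k t : enorm (yl k t) <= E t * expR (- a * `|- (t + l) - k%:R * l|).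
  have [_ _ /(_ t)] := Hyl k; congr (_ <= _ * expR (_ * _)).
  by rewrite -normrN; congr `|_|; rewrite -natr1; ring.
(* 4 for the blocks on each side of 0 *)
have Sb k t : enorm (S k t) <= E t * 8.
  have -> : 8 = 4 + 4 :> R by ring.
  apply: (@le_trans _ _ (E t * (\sum_(j < k) expR (- a * `|t - j%:R * l|) + \sum_(j < k) expR (- a * `|- (t + l) - j%:R * l|)))).
    rewrite -big_split mulr_sumr /S.
    elim: (k) => [|k' IH]; first by rewrite !big_ord0 enorm0.
    rewrite !big_ord_recr/=; apply: le_trans (enormD _ _) _; apply: lerD => //.
    by rewrite mulrDr; apply: le_trans (enormD _ _) _; exact: lerD.
  by rewrite ler_wpM2l// lerD// sum_exp_dist_le.
pose c t := 2 * E t * expR (a * `|t|).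
have c0 t : 0 <= c t by rewrite /c mulr_ge0 ?expR_ge0// mulr_ge0 ?E0.
have Sc k t : enorm (S k.+1 t - S k t) <= c t / 2 ^+ k.
  rewrite SS; apply: le_trans (enormD _ _) _.
  have key u : k%:R * l <= `|u| + `|t| -> expR (- a * `|u|) <= expR (a * `|t|) / 2 ^+ k.
    move=> ku; rewrite ler_pdivlMr ?exprn_gt0//.
    apply: (@le_trans _ _ (expR (- a * `|u|) * expR (k%:R * (a * l)))).
      rewrite ler_wpM2l ?expR_ge0// expRM_natl; apply: lerXn2r => //; rewrite nnegrE// expR_ge0.
    rewrite -expRD ler_expR.
    have : a * (k%:R * l) <= a * (`|u| + `|t|) by rewrite ler_wpM2l// ltW.
    by lra.
  have kl : 0 <= k%:R * l by rewrite mulr_ge0// ltW.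
  have k1 : k%:R * l <= `|t - k%:R * l| + `|t|.
    rewrite distrC; have := ler_normD (k%:R * l - t) t; rewrite subrK (ger0_norm kl); lra.
  have k2 : k%:R * l <= `|- (t + l) - k%:R * l| + `|t|.
    rewrite -opprD normrN; have := ler_normB (t + l + k%:R * l) t.
    rewrite (_ : t + l + k%:R * l - t = l + k%:R * l); last by ring.
    by rewrite (ger0_norm (addr_ge0 (ltW l0) kl)); lra.
  have -> : c t / 2 ^+ k = E t * (expR (a * `|t|) / 2 ^+ k) + E t * (expR (a * `|t|) / 2 ^+ k).
    by rewrite /c; ring.
  apply: lerD; first by apply: le_trans (yrb k t) _; rewrite ler_wpM2l// key.
  by apply: le_trans (ylb k t) _; rewrite ler_wpM2l// key.
pose c' T := 2 * (C * (Cw * B) * expR (a * T)) * expR (a * T).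
have cc' t T : `|t| <= T -> c t <= c' T.
  move=> tT; have h1 : expR (a * `|t|) <= expR (a * T) by rewrite ler_expR ler_wpM2l// ltW.
  have h2 : expR (- b * `|t|) <= expR (a * `|t|).
    by rewrite ler_expR ler_wpM2r//; apply: le_trans ba; rewrite -normrN; exact: ler_norm.
  have h3 : E t <= C * (Cw * B) * expR (a * T).
    by apply: ler_wpM2l; [rewrite !mulr_ge0// ltW|exact: le_trans h1].
  have h4 : 2 * E t <= 2 * (C * (Cw * B) * expR (a * T)) by apply: ler_wpM2l.
  by apply: ler_pM => //; apply: mulr_ge0 => //; exact: E0.
have c'0 T : 0 <= c' T by rewrite /c' !mulr_ge0 ?expR_ge0// ltW.
have [F [cF HF]] : exists F : R -> 'cV[R]_n, continuous F /\
    forall t c, 0 <= c -> (forall k, enorm (S k.+1 t - S k t) <= c / 2 ^+ k) ->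
      forall k, enorm (F t - S k t) <= n%:R * (2 * c) / 2 ^+ k.
  apply: geometric_limit_continuous => // T; exists (c' T) => // k t tT.
  by apply: le_trans (Sc k t) _; rewrite ler_wpM2r ?invr_ge0 ?exprn_ge0// cc'.
have FS t k : enorm (F t - S k t) <= n%:R * (2 * c t) / 2 ^+ k by exact: HF.
have FY : Ybound b F (C * (Cw * B) * 8).
  move=> t; have -> : C * (Cw * B) * 8 * expR (- b * `|t|) = E t * 8 by rewrite /E; ring.
  apply/ler_addgt0Pr => e e0.
  pose k := (Num.truncn (n%:R * (2 * c t) / e)).+1.
  rewrite -[F t](subrK (S k t)) addrC; apply: le_trans (enormD _ _) _.
  by apply: lerD => //; apply: le_trans (FS t k) _; exact: exp2_small.
have FSol s : sol s h F.
  split=> // t st; pose T := `|s| + `|t| + r.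
  (* from step k0 on, the forcing of S k is h on the whole of [s, t] *)
  pose k0 := (Num.truncn (T / l)).+1.
  have k0T k : T < (k + k0)%N%:R * l.
    rewrite -ltr_pdivrMr//; apply: lt_le_trans (truncnS_gt _) _; rewrite ler_nat.
    exact: leq_addl.
  have h1 := ler_norm t; have h2 := ler_norm (- t); have h3 := ler_norm s; have h4 := ler_norm (- s).
  rewrite normrN in h2; rewrite normrN in h4; have h5 := normr_ge0 s; have h6 := normr_ge0 t.
  have cM0 : 0 <= n%:R * (2 * c' T) by apply: mulr_ge0 => //; apply: mulr_ge0 => //; exact: c'0.
  apply: (sol_from_limit hr heta bm m0 Lm (xk := fun k => S (k + k0)%N)
    (hk := fun k => H (k + k0)%N) (M := n%:R * (2 * c' T)) st cF lh) => [k||k|k u /andP[su ut]|k].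
  - exact: lH.
  - exact: cM0.
  - exact: sS.
  - apply: le_trans (FS u _) _; apply: ler_pM.
    + by apply: mulr_ge0 => //; apply: mulr_ge0 => //; exact: c0.
    + by rewrite invr_ge0 exprn_ge0.
    + rewrite ler_wpM2l// ler_wpM2l// cc'// ler_norml /T; apply/andP; split; lra.
    by rewrite lef_pV2 ?posrE ?exprn_gt0// ler_weXn2l ?leq_addr// ler1n.
  rewrite (int_eq_on _ (@locint_cst R 0)) ?int0 ?divr_ge0 ?exprn_ge0//.
    by apply: locint_enorm; apply: vlocintB.
  apply: aeW => u /andP[su ut]; have := k0T k; rewrite /T => kT.
  rewrite /H windowE (_ : (_ < u <= _)) ?subrr ?enorm0//.
  by apply/andP; split; lra.
exists F; split.
  split; first by apply/in_YP; split => //; exists (C * (Cw * B) * 8) => //; rewrite !mulr_ge0// ltW.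
  by apply/(nonhom_solutionP hr heta bm m0 Lm _ lh).
move=> y [/in_YP[cy [D D0 yD]] /(nonhom_solutionP hr heta bm m0 Lm _ lh)[_ sy]].
have Hd s : sol s (fun=> 0) (fun u => F u - y u).
  have := sol_fromB hr heta bm m0 Lm lh lh (FSol s) (sy s).
  by congr sol_from; apply/funext => u; rewrite subrr.
have Z := bounded_zero ba Hd (YboundB FY yD).
apply/funext => t; apply/eqP; rewrite -subr_eq0; apply/eqP; exact: (congr1 (@^~ t) Z).
Qed.

End LocalizedForcing.

(** * The equivalence *)

Theorem theorem2p1 (R : realType) (n : nat) (r r0 : R)
    (eta : R -> R -> 'M[R]_n)
    (hr : 0 < r) (hr0 : 0 < r0) (heta : standing_assumptions r r0 eta) :
  exponential_dichotomy r eta <->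
  exists bm bp : R, [/\ bm < 0, 0 < bp,
    properly_admissible r r0 bp eta & properly_admissible r r0 bm eta].
Proof.
have [m [bm m0 Lm [Mm HM]]] := delay_op_bound hr hr0 heta.
split=> [[alpha [K [P [[a0 K0] Pproj TP Tiso [Pdec Qdec]]]]]|[b1 [b2 [b10 b20 adm2 adm1]]]].
  have adm b : `|b| <= alpha / 2 -> properly_admissible r r0 b eta.
    apply: (localized_admissible hr hr0 heta bm m0 Lm a0) => [l|c v B].
      exact: (block_solution hr hr0 heta bm m0 Lm HM a0 K0 Pproj Tiso Pdec Qdec).
    exact: (dichotomy_bounded_zero hr heta bm m0 Lm a0 K0 Pproj TP Tiso Pdec Qdec).
  by exists (- (alpha / 2)), (alpha / 2); split; [lra|lra|apply: adm; rewrite ger0_norm//; lra|apply: adm; rewrite normrN ger0_norm//; lra].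
exact: (admissible_dichotomy hr hr0 heta bm m0 Lm HM b10 b20 adm1 adm2).
Qed.
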